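(* Let $T=(T,S,-F)$ be a negative simple BY tree satisfying parity conditions (A) and (B). Suppose first that $T$ is not a path (i.e. $T$ has a vertex of degree $\ge3$). Write $S=S_0\sqcup S_1$, where $S_0$ (resp. $S_1$) consists of the points of $S$ lying in $F$-orbits of even (resp. odd) size. Write the orbit set $S_1/\langle F\rangle=A_0\sqcup A_1$, where $A_1$ consists exactly of the orbits of points of $S_1$ at the end of an odd-length twig, i.e. whose distance to the nearest vertex of degree $\ge3$ is odd. Let $T'$ be the BY tree formed from $T$ by removing $S_1$ from $S$, contracting all edges of $T$ lying in $F$-orbits of odd size, adding to $S$ the unique $F$-fixed point of the resulting tree, and declaring the sign to be $+1$ on every component. Then $c_T=\tilde c_1\,c_{T'}$, where \[\tilde c_1=\begin{cases}2^{\#A_0-1}&\text{if }\#A_0\ge1,\\ 2&\text{if }\#A_0=0\text{ and }\#S\text{ is even},\\ 1&\text{if }\#A_0=0\text{ and }\#S\text{ is odd}.\end{cases}\] In the remaining case that $T$ is a path: if $\#S=1$ then $c_T=1$; and if $T$ is a single path of length $l$ connecting two points of $S$, then $c_T=2$ if $l$ is even and $F$ fixes $T$ pointwise, $c_T=1$ if $l$ is odd and $F$ fixes $T$ pointwise, and $c_T=l$ if $F$ reverses $T$.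
   Context: A BY forest is a triple $T=(T,S,\epsilon F)$ where $T$ is a finite graph-theoretic forest with an edge-length function $l:E(T)\to\{1,2,3,\dots\}$ (distances are sums of edge lengths), $S\subseteq T$ is a subgraph, $F$ is a length-preserving graph automorphism of $T$ with $F(S)=S$, and $\epsilon:\pi_0(T\setminus S)\to\{\pm1\}$ is a function on the connected components of the topological complement $T\setminus S$; it is a BY tree if $T$ is a tree. A BY tree is simple if $S$ is a non-empty set of degree-$1$ vertices (so $\epsilon$ is a single sign); it is negative, written $(T,S,-F)$, if that sign is $-1$. Let $\Lambda_T=H_1(T,S;\mathbb Z)$, viewed inside the free abelian group on oriented edges of $T$ not in $S$, with intersection length pairing the restriction of $\langle e,e'\rangle=l(e)\delta_{e,e'}$. The signed automorphism acts on $\Lambda_T$ by sending the class of a path $\gamma$ in the closure of a component $C$ of $T\setminus S$ to $\epsilon(C)[F\gamma]$. The Tamagawa number is $c_T=\#(\Lambda_T^\vee/\Lambda_T)^{\epsilon F}$, with $\Lambda_T^\vee=\mathrm{Hom}(\Lambda_T,\mathbb Z)$ and $\Lambda_T\hookrightarrow\Lambda_T^\vee$ induced by the pairing. Parity condition (A): if two vertices of $T$ lie an odd distance apart, then at least one is either (i) a leaf in $S$ whose incident edge is not in $S$, (ii) of degree $2$ and not in $S$, or (iii) of degree $2$ and in the interior of $S$. Parity condition (B): no iterate of $F$ inverts (maps to itself with endpoints swapped) any edge of odd length.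
   Formalization: If F maps an edge to itself with its endpoints swapped, that edge is not contracted in forming T' (though its orbit has size 1); it is subdivided at its midpoint, which is the F-fixed point added to S. Contracting it would make the formula false. *)

(* Defs.v *)
From HB Require Import structures.
(* [finset] is imported after [classical_sets]: unqualified set operations are
   those of finite sets. *)
From mathcomp Require Import boolp classical_sets cardinality.
From mathcomp Require Import finmap.
From mathcomp Require Import all_boot all_order all_algebra.

Set Implicit Arguments.
Unset Strict Implicit.
Unset Printing Implicit Defensive.

Import Order.TTheory GRing.Theory Num.Theory.

Local Open Scope set_scope.
Local Open Scope nat_scope.

(* [len x y] is only meaningful when [edge x y] holds. *)
Record lgraph := LGraph {
  vtx : finType;
  edge : rel vtx;
  len : vtx -> vtx -> nat;
  frob : vtx -> vtx }.

Section Graph.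
Variable G : lgraph.
Implicit Types (x y : vtx G) (p : seq (vtx G)).

Definition deg x : nat := #|[set y | edge x y]|.

Definition simple_path x y p : bool :=
  [&& path (@edge G) x p, uniq (x :: p) & last x p == y].

Fixpoint path_length x p : nat :=
  if p is y :: p' then len x y + path_length y p' else 0.

(* In a forest there is at most one simple path from [x] to [y], and its
   vertices after [x] form a sequence of size at most #|vtx G|.  The value is
   0 when [x] and [y] are not connected. *)
Definition dist x y : nat :=
  if [pick p : #|vtx G|.-bseq (vtx G) | simple_path x y p] is Some p
  then path_length x p else 0.

Definition is_lforest : Prop :=
  [/\ symmetric (@edge G), irreflexive (@edge G),
      forall c : seq (vtx G), 2 < size c -> ~ ucycle (@edge G) c,
      forall x y, len x y = len y x
    & forall x y, edge x y -> 0 < len x y].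

Definition frob_automorphism : Prop :=
  [/\ injective (@frob G),
      forall x y, edge (frob x) (frob y) = edge x y
    & forall x y, edge x y -> len (frob x) (frob y) = len x y].

Definition is_connected : Prop :=
  0 < #|vtx G| /\ forall x y, connect (@edge G) x y.

Definition has_branch_vertex : bool := [exists x, 2 < deg x].

Definition odd_twig x : bool :=
  [exists v, [&& 2 < deg v,
    [forall w, (2 < deg w) ==> (dist x v <= dist x w)] & odd (dist x v)]].

End Graph.

(* Unoriented edges are the two-element sets [set x; y] with [edge x y].  A cell
   is a vertex, written [set x], or an open edge, written [set x; y]; the sign
   epsilon is -1 on a cell off S exactly when [neg] holds there, and the values
   of [neg] on the cells of S are irrelevant. *)
Record by_data := BYData {
  gr :> lgraph;
  SV : {set vtx gr};
  SE : rel (vtx gr);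
  neg : {set vtx gr} -> bool }.

(* A function on the components of T \ S is a function on the cells off S that
   takes the same value on every edge off S and on each endpoint of it that is
   not in S. *)
Definition is_BY_forest (T : by_data) : Prop :=
  [/\ is_lforest T, frob_automorphism T,
      [/\ symmetric (@SE T),
          forall x y : vtx T, SE x y -> edge x y
        & forall x y : vtx T, SE x y -> x \in SV T],
      (@frob T) @: SV T = SV T /\
        (forall x y : vtx T, SE (frob x) (frob y) = SE x y)
    & forall x y : vtx T, edge x y -> ~~ SE x y -> x \notin SV T ->
        neg [set x; y] = neg [set x]].

Definition is_BY_tree (T : by_data) : Prop := is_BY_forest T /\ is_connected T.

Definition is_simple (T : by_data) : Prop :=
  [/\ SV T != set0, forall x, x \in SV T -> deg x = 1
    & forall x y : vtx T, ~~ SE x y].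

Definition is_negative (T : by_data) : Prop :=
  (forall x : vtx T, x \notin SV T -> neg [set x]) /\
  (forall x y : vtx T, edge x y -> ~~ SE x y -> neg [set x; y]).

Definition parity_exempt (T : by_data) (x : vtx T) : Prop :=
  [\/ [/\ deg x = 1, x \in SV T & forall y, edge x y -> ~~ SE x y],
      deg x = 2 /\ x \notin SV T
    | [/\ deg x = 2, x \in SV T & forall y, edge x y -> SE x y]].

Definition parityA (T : by_data) : Prop :=
  forall x y : vtx T, odd (dist x y) -> parity_exempt x \/ parity_exempt y.

Definition parityB (T : by_data) : Prop :=
  forall (k : nat) (x y : vtx T), edge x y -> odd (len x y) ->
    ~ (iter k (@frob T) x = y /\ iter k (@frob T) y = x).

(* A one-chain is an antisymmetric function on oriented edges; [f (x, y)] is the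
   coefficient of the edge oriented from [x] to [y]. *)
Definition chain (T : by_data) := {ffun vtx T * vtx T -> int}.

HB.instance Definition _ (T : by_data) := GRing.Zmodule.on (chain T).

(* There are no two-cells, so H_1(T, S) is the group of relative one-cycles:
   chains off S whose boundary is supported on the vertices of S. *)
Definition rel_cycle (T : by_data) : {pred chain T} :=
  fun f => [&& [forall x, forall y, f (x, y) == (- f (y, x))%R],
    [forall x, forall y, (f (x, y) != 0%R) ==> edge x y && ~~ SE x y]
  & [forall x, (x \notin SV T) ==> ((\sum_y f (x, y))%R == 0%R)]].

Lemma rel_cycle_zmod_closed (T : by_data) : zmod_closed (@rel_cycle T).
Proof.
split=> [|f g /and3P[/forallP fA /forallP fS /forallP fB]
          /and3P[/forallP gA /forallP gS /forallP gB]].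
  apply/and3P; split; apply/forallP=> x; first 2 last.
  - by apply/implyP=> _; rewrite big1 // => y _; rewrite ffunE.
  - by apply/forallP=> y; rewrite !ffunE oppr0.
  - by apply/forallP=> y; rewrite !ffunE eqxx.
apply/and3P; split; apply/forallP=> x; first 2 last.
- apply/implyP=> xS; rewrite (eq_bigr (fun y => f (x, y) - g (x, y))%R).
    by rewrite sumrB (eqP (implyP (fB x) xS)) (eqP (implyP (gB x) xS)) subr0.
  by move=> y _; rewrite !ffunE.
- apply/forallP=> y; rewrite !ffunE.
  by rewrite (eqP (forallP (fA x) y)) (eqP (forallP (gA x) y)) opprD.
- apply/forallP=> y; rewrite !ffunE; apply/implyP.
  have := forallP (fS x) y; have := forallP (gS x) y.
  case: (f (x, y) =P 0%R) => [->|_ _ /implyP-> //].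
  case: (g (x, y) =P 0%R) => [->|_ /implyP-> //].
  by rewrite subr0 eqxx.
Qed.

HB.instance Definition _ (T : by_data) :=
  GRing.isZmodClosed.Build (chain T) (@rel_cycle T) (@rel_cycle_zmod_closed T).

Record lattice (T : by_data) :=
  Lattice { lattice_val :> chain T; _ : lattice_val \in @rel_cycle T }.

HB.instance Definition _ (T : by_data) := [isSub for @lattice_val T].
HB.instance Definition _ (T : by_data) := [Choice of lattice T by <:].
HB.instance Definition _ (T : by_data) :=
  [SubChoice_isSubZmodule of lattice T by <:].

(* The condition on ranks picks one orientation of every edge. *)
Definition pairing (T : by_data) (f g : chain T) : int :=
  (\sum_(d : vtx T * vtx T | (enum_rank d.1 < enum_rank d.2)%N)
     (len d.1 d.2)%:Z * f d * g d)%R.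

Definition signed_push (T : by_data) (f : chain T) : chain T :=
  [ffun e : vtx T * vtx T => (\sum_(d | (frob d.1, frob d.2) == e)
     (-1) ^+ neg [set d.1; d.2] * f d)%R].

(* In a BY forest [signed_push] preserves the lattice; see [signedFE]. *)
Definition signedF (T : by_data) (u : lattice T) : lattice T :=
  insubd (0%R : lattice T) (signed_push u).

Definition dual_lattice (T : by_data) := {additive lattice T -> int}.

Definition eq_mod_lattice (T : by_data) (phi psi : lattice T -> int) : Prop :=
  exists u : lattice T, forall v, (phi v - psi v)%R = pairing u v.

(* [epsilon F] acts on the dual through its inverse; being fixed by it is the
   same as being fixed by precomposition with [epsilon F]. *)
Definition fixed_mod_lattice (T : by_data) (phi : dual_lattice T) : Prop :=
  eq_mod_lattice (phi \o @signedF T) phi.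

Definition dual_coset (T : by_data) (phi : dual_lattice T) :
    set (dual_lattice T) :=
  [set psi : dual_lattice T | eq_mod_lattice psi phi]%classic.

(* The discriminant group is finite, the pairing being positive definite. *)
Definition tamagawa (T : by_data) : nat :=
  #|` fset_set [set dual_coset phi | phi in @fixed_mod_lattice T]%classic |.

Lemma signed_pushE (T : by_data) (f : chain T) (x y : vtx T) :
    injective (@frob T) ->
  signed_push f (frob x, frob y) = ((-1) ^+ neg [set x; y] * f (x, y))%R.
Proof.
move=> Finj; rewrite ffunE (big_pred1 (x, y)) // => -[a b] /=.
by rewrite !xpair_eqE !(inj_eq Finj).
Qed.

Lemma signedFE (T : by_data) (u : lattice T) :
  is_BY_forest T -> val (signedF u) = signed_push u.
Proof.
move=> [[symE _ _ _ _] [Finj FE _] [symS _ _] [FV FS] epsC].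
rewrite val_insubd ifT //; case: u => f /= /and3P[/forallP fA /forallP fS /forallP fB].
have Fsurj (z : vtx T) : exists x, z = frob x by exists (finv (@frob T) z); rewrite (f_finv Finj).
apply/and3P; split; apply/forallP=> x'; have [x {x'}->] := Fsurj x'; first 2 last.
- apply/implyP=> xS; have {}xS : x \notin SV T.
    by apply: contra xS => xS; rewrite -FV imset_f.
  rewrite (reindex_inj Finj) /= (eq_bigr (fun y => (-1) ^+ neg [set x] * f (x, y)))%R.
    by rewrite -big_distrr /= (eqP (implyP (fB x) xS)) mulr0.
  move=> y _; rewrite signed_pushE //; have [->|nz] := eqVneq (f (x, y)) 0%R.
    by rewrite !mulr0.
  by have /andP[? ?] := implyP (forallP (fS x) y) nz; rewrite epsC.
- apply/forallP=> y'; have [y {y'}->] := Fsurj y'; rewrite !signed_pushE //.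
  by rewrite (eqP (forallP (fA x) y)) mulrN setUC.
- apply/forallP=> y'; have [y {y'}->] := Fsurj y'; rewrite signed_pushE //.
  rewrite FE FS mulf_eq0 signr_eq0 /=; exact: (forallP (fS x) y).
Qed.

(* F may invert an edge, and then its fixed point is the midpoint of that edge;
   [subdivide] makes it a vertex.  The new vertices are indexed by the inverted
   edges, and F fixes each of them.  Under parity condition (B) an inverted edge
   has even length, so the halved lengths are exact. *)
Section Subdivide.
Variable G : lgraph.

Definition inverted (m : {set vtx G}) : bool :=
  [exists x, [&& edge x (frob x), frob (frob x) == x & m == [set x; frob x]]].

Definition sub_vtx : finType := (vtx G + {m : {set vtx G} | inverted m})%type.

Definition sub_edge (a b : sub_vtx) : bool :=
  match a, b with
  | inl x, inl y => edge x y && ~~ inverted [set x; y]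
  | inl x, inr m | inr m, inl x => x \in val m
  | inr _, inr _ => false
  end.

Definition sub_len (a b : sub_vtx) : nat :=
  match a, b with
  | inl x, inl y => len x y
  | inl x, inr _ | inr _, inl x => (len x (frob x))./2
  | inr _, inr _ => 0
  end.

Definition sub_frob (a : sub_vtx) : sub_vtx :=
  match a with inl x => inl (frob x) | inr m => inr m end.

Definition subdivide : lgraph := LGraph sub_edge sub_len sub_frob.

End Subdivide.

(* Contraction of the edges lying in orbits of odd size.  The vertices of the
   result are the classes of vertices joined by contracted edges. *)
Section Contract.
Variable G : lgraph.

Definition odd_edge : rel (vtx G) := fun x y =>
  edge x y && odd (order (fun m : {set vtx G} => (@frob G) @: m) [set x; y]).

Definition class_of (x : vtx G) : {set vtx G} := [set y | connect odd_edge x y].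

Definition con_vtx : finType :=
  {B : {set vtx G} | B \in [set class_of x | x : vtx G]}.

Definition con_edge (B C : con_vtx) : bool :=
  (B != C) && [exists x in val B, exists y in val C, edge x y].

(* In a tree, distinct classes are joined by at most one edge, so that the sum
   is the length of that edge. *)
Definition con_len (B C : con_vtx) : nat :=
  \sum_(x in val B) \sum_(y in val C | edge x y) len x y.

(* An automorphism permutes the classes; see [con_frobE]. *)
Definition con_frob (B : con_vtx) : con_vtx := insubd B ((@frob G) @: val B).

Lemma con_frobE (B : con_vtx) :
  frob_automorphism G -> val (con_frob B) = (@frob G) @: val B.
Proof.
move=> [Finj FE _]; rewrite val_insubd ifT //.
pose f (m : {set vtx G}) := (@frob G) @: m.
have finj : injective f by exact: imset_inj.
have ordf m : order f (f m) = order f m.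
  exact/order_id_cycle/cycle_orbit.
have oddF x y : odd_edge (frob x) (frob y) = odd_edge x y.
  rewrite /odd_edge FE; congr (_ && odd _).
  have <- : f [set x; y] = [set frob x; frob y] by rewrite /f imsetU1 imset_set1.
  exact: ordf.
have homF (h : vtx G -> vtx G) x y :
    (forall u v, odd_edge (h u) (h v) = odd_edge u v) ->
    connect odd_edge x y -> connect odd_edge (h x) (h y).
  move=> hE /connectP[p xp ->]; apply/connectP; exists (map h p).
    by apply: homo_path xp => u v; rewrite hE.
  by rewrite last_map.
have oddFV u v : odd_edge (finv (@frob G) u) (finv (@frob G) v) = odd_edge u v.
  by rewrite -oddF !(f_finv Finj).
have classF x : (@frob G) @: class_of x = class_of (frob x).
  apply/setP=> y; apply/imsetP/idP=> [[z + ->]|]; rewrite !inE.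
    exact: homF.
  move=> xy; exists (finv (@frob G) y); last by rewrite (f_finv Finj).
  by rewrite inE -[x](finv_f Finj); apply: homF.
by case: B => B /= /imsetP[x _ ->]; apply/imsetP; exists (frob x); rewrite ?classF.
Qed.

Definition contract : lgraph := LGraph con_edge con_len con_frob.

End Contract.

Section Orbits.
Variable T : by_data.

Definition S0 : {set vtx T} := [set x in SV T | ~~ odd (order (@frob T) x)].
Definition S1 : {set vtx T} := [set x in SV T | odd (order (@frob T) x)].

Definition frob_orbit (x : vtx T) : {set vtx T} := [set y | fconnect (@frob T) x y].

Definition A1 : {set {set vtx T}} :=
  [set frob_orbit x | x in [set x in S1 | odd_twig x]].
Definition A0 : {set {set vtx T}} := [set frob_orbit x | x in S1] :\: A1.

Definition c1 : nat :=
  if 0 < #|A0| then 2 ^ (#|A0| - 1)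
  else if odd #|SV T| then 1 else 2.

Definition T'_graph : lgraph := contract (subdivide T).

(* The image of S_0, together with the F-fixed vertex (which is unique). *)
Definition T'_SV : {set vtx T'_graph} :=
  [set B : vtx T'_graph | [exists x in S0, inl x \in val B]]
    :|: [set B : vtx T'_graph | frob B == B].

Definition T' : by_data :=
  @BYData T'_graph T'_SV (fun _ _ => false) (fun _ => false).

End Orbits.

(* Main.v *)
Require Import Defs.
From HB Require Import structures.
From mathcomp Require Import boolp classical_sets cardinality.
From mathcomp Require Import finmap.
From mathcomp Require Import all_boot all_order all_algebra.
From mathcomp Require Import zify ring.

(* Let B(s, t) be the length of the common part of the paths from s and t to a
   root.  The lattice of T is the group of degree-zero functions on S with form
   B, its dual is Z^S / Z, and its image in the dual is L = {lam B + const}.  The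
   kernel and the cokernel of 1 + F on the finite group Z^S / L have the same
   order, so the Tamagawa number is the index of L + (1 + F) Z^S in Z^S.

   Take an F-fixed root and split B over the edges to be contracted and the
   others.  On S_0 the contracted part of B(s, -) is invariant under an odd power
   of F, hence lies in (1 + F) Z^S, and what remains is the form of T'.  A sign
   that is constant on each branch of T' and changes under F turns 1 + F into
   1 - F.  So projecting to S_0 gives the index of T', and the kernel of the
   projection contributes a quotient of an F_2-vector space on S_1 / F; a second
   F_2-coordinate records the degree.  If the root is a branch vertex, condition
   (A) makes B(s, t) even for s <> t, and B(s, s) odd exactly for odd twigs:
   this computes the quotient as c1. *)

Set Implicit Arguments.
Unset Strict Implicit.
Unset Printing Implicit Defensive.

Import Order.TTheory GRing.Theory Num.Theory.
Local Open Scope ring_scope.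


(** * Indices *)

(** The cokernel is used rather than the kernel because any part of the form lying in (1 + F) Z^S
    can then be dropped. The obstacle is that L comes from lam of degree zero, a condition that
    restriction to S_0 does not respect; hence the degree is left free and recorded. Since B(s, -) +
    B(F s, -) lies in (1 + F) Z^S, only its parity counts.

    The constant is the order of an F_2-space with generators delta (the degree) and e_O for O in
    S_1 / F. For t in O the function B(t, -) reduces to e_O if t ends an odd twig and to 0
    otherwise: e_O = delta on A_1, and delta = 0 if A_0 is non-empty. Constant functions give sum
    e_O = 0, as each #O is odd. If A_0 is non-empty, the e_O with O in A_0 and this one relation
    leave dimension #A_0 - 1. If A_0 is empty, all e_O equal delta and the relation reads #A_1 delta
    = 0, where #A_1 has the parity of #S because S_0 is a union of even orbits. No further relation
    comes from S_0: by positivity, if lam B0 lies in (1 - F) Z^S_0, then lam has degree zero. *)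

Definition nb_classes (A : Type) (K : A -> Prop) (R : A -> A -> Prop)
    (n : nat) : Prop :=
  exists (X : finType) (g : A -> X),
    [/\ #|X| = n, forall x, exists2 a, K a & g a = x
      & forall a b, K a -> K b -> (g a = g b <-> R a b)].

Lemma nb_classes_uniq (A : Type) (K : A -> Prop) R m n :
  nb_classes K R m -> nb_classes K R n -> m = n.
Proof.
have le_card (X Y : finType) (g : A -> X) (h : A -> Y) :
    (forall x, exists2 a, K a & g a = x) ->
    (forall a b, K a -> K b -> g a = g b <-> R a b) ->
    (forall a b, K a -> K b -> h a = h b <-> R a b) -> (#|X| <= #|Y|)%N.
  move=> gs gP hP; have /choice[r rP] : forall x, exists a, K a /\ g a = x.
    by move=> x; have [a ? ?] := gs x; exists a.
  apply: (@leq_card _ _ (h \o r)) => x y /= hxy.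
  have [[Kx <-] [Ky <-]] := (rP x, rP y).
  by apply/gP => //; apply/hP.
move=> [X [g [<- gs gP]]] [Y [h [<- hs hP]]].
by apply/eqP; rewrite eqn_leq (le_card _ _ g h) // (le_card _ _ h g).
Qed.

(** Comparisons of finite quotients go through this: [phi] has to be a bijection only up to the two
    relations, so no quotient group is ever formed. *)
Lemma nb_classes_pullback (A A' : Type) (phi : A -> A') (K : A -> Prop) R
    (K' : A' -> Prop) R' n :
    (forall a, K a -> K' (phi a)) ->
    (forall a b, K a -> K b -> (R a b <-> R' (phi a) (phi b))) ->
    (forall a', K' a' -> exists2 a, K a & R' (phi a) a') ->
  nb_classes K' R' n -> nb_classes K R n.
Proof.
move=> KK' RR' surj [X [g [cX gs gP]]]; exists X, (g \o phi); split=> //.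
  move=> x; have [a' Ka' <-] := gs x; have [a Ka ra] := surj _ Ka'.
  by exists a => //=; apply/gP => //; exact: KK'.
by move=> a b Ka Kb /=; rewrite RR' //; apply: gP; exact: KK'.
Qed.

(** A class is determined by the set of values that [g] takes on it, and there are finitely many
    such sets. *)
Lemma nb_classes_finite (A : Type) (X : finType) (g : A -> X) (K : A -> Prop)
    (R : A -> A -> Prop) (a0 : A) :
    K a0 -> (forall a b, R a b -> R b a) ->
    (forall a b c, R a b -> R b c -> R a c) ->
    (forall a b, K a -> K b -> g a = g b -> R a b) ->
  exists n, nb_classes K R n.
Proof.
move=> Ka0 Rsym Rtrans gR.
pose h a := [set x | `[< exists2 b, K b /\ g b = x & R a b >]].
pose P (Y : {set X}) := `[< exists2 a, K a & h a = Y >].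
have Ph a : K a -> P (h a) by move=> Ka; apply/asboolP; exists a.
have hP a b : K a -> K b -> h a = h b <-> R a b.
  move=> Ka Kb; split=> [hab|rab].
    have : g a \in h b.
      rewrite -hab inE; apply/asboolP; exists a => //.
      exact: gR.
    rewrite inE => /asboolP[b' [Kb' gb'] rbb'].
    by apply: Rsym; apply: (Rtrans _ b') => //; exact: gR.
  apply/setP => x; rewrite !inE; apply/asboolP/asboolP => -[c cx rc].
    by exists c => //; apply: (Rtrans _ a) => //; exact: Rsym.
  by exists c => //; exact: (Rtrans _ b).
pose Z : finType := {Y : {set X} | P Y}; exists #|Z|, Z.
exists (fun a => insubd (exist P (h a0) (Ph a0 Ka0)) (h a)); split=> //.
  move=> [Y PY]; have /asboolP[a Ka haY] := PY; exists a => //.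
  by apply: val_inj; rewrite val_insubd haY PY.
move=> a b Ka Kb; rewrite -hP //; split=> [/(congr1 val)|->//].
by rewrite !val_insubd !Ph.
Qed.

Section Index.
Variable A : zmodType.
Implicit Types (H K L : A -> Prop).

Definition subgroup H : Prop := H 0 /\ forall a b, H a -> H b -> H (a - b).

Definition has_index K H n := nb_classes K (fun a b => H (a - b)) n.

Lemma subgroupN H a : subgroup H -> H a -> H (- a).
Proof. by move=> [H0 HB] Ha; rewrite -sub0r; exact: HB. Qed.

Lemma subgroupD H a b : subgroup H -> H a -> H b -> H (a + b).
Proof. by move=> sH Ha Hb; rewrite -[b]opprK; apply: sH.2 => //; exact: subgroupN. Qed.

(** Once a representative of each class of M / K is chosen, a class of M / H is a pair: its class
    modulo K, and the class modulo H of its difference from the representative. *)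
Lemma has_indexM M K H m n :
    subgroup M -> subgroup K -> subgroup H ->
    (forall a, K a -> M a) -> (forall a, H a -> K a) ->
  has_index M K m -> has_index K H n -> has_index M H (m * n)%N.
Proof.
move=> sM sK sH KM HK [X [g [<- gs gP]]] [Y [h [<- hs hP]]].
have /choice[r rP] : forall x, exists a, M a /\ g a = x.
  by move=> x; have [a ? ?] := gs x; exists a.
have Kr a : M a -> K (a - r (g a)).
  by move=> Ma; apply/gP => //; [exact: (rP _).1|rewrite (rP _).2].
exists (X * Y)%type, (fun a => (g a, h (a - r (g a)))); split.
- by rewrite card_prod.
- move=> [x y]; have [k Kk <-] := hs y; have [Mr grx] := rP x.
  have Mk : M (r x + k) by apply: subgroupD => //; exact: KM.
  have gx : g (r x + k) = x.
    by rewrite -[RHS]grx; apply/gP => //; rewrite addrC addKr.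
  by exists (r x + k) => //; rewrite gx addrC addKr.
- move=> a b Ma Mb; split=> [[gab hab]|Hab].
    have -> : a - b = (a - r (g a)) - (b - r (g b)).
      by rewrite gab opprB addrA subrK.
    by apply/hP => //; exact: Kr.
  have gab : g a = g b by apply/gP => //; exact: HK.
  congr pair => //; apply/hP; [exact: Kr|exact: Kr|].
  by rewrite gab opprB addrA subrK.
Qed.

Lemma has_index_between M K H n :
    subgroup K -> subgroup H ->
    (forall a, K a -> M a) -> (forall a, H a -> K a) ->
    has_index M H n ->
  (exists m, has_index M K m) /\ (exists m, has_index K H m).
Proof.
move=> sK sH KM HK [X [g [_ _ gP]]].
have eqv L : subgroup L ->
    (forall a b, L (a - b) -> L (b - a)) /\
    (forall a b c, L (a - b) -> L (b - c) -> L (a - c)).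
  move=> sL; split=> [a b|a b c] Lab; first by rewrite -opprB; exact: subgroupN.
  by move=> Lbc; rewrite -(subrK b a) -addrA; exact: subgroupD.
split; apply: (@nb_classes_finite _ _ g _ _ 0).
- by apply: KM; case: sK.
- by have [] := eqv _ sK.
- by have [] := eqv _ sK.
- by move=> a b Ma Mb /gP gab; apply: HK; exact: gab.
- by case: sK.
- by have [] := eqv _ sH.
- by have [] := eqv _ sH.
- by move=> a b Ka Kb /gP gab; apply: gab; exact: KM.
Qed.

(* On the finite group A / L, the kernel and the cokernel of f have the same
   order. *)
Lemma index_preimage_cokernel (f : {additive A -> A}) L n :
    subgroup L -> (forall a, L a -> L (f a)) -> has_index (fun=> True) L n ->
  exists2 m, has_index (fun a => L (f a)) L m
    & has_index (fun=> True) (fun a => exists b, L (a - f b)) m.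
Proof.
move=> sL fL iL; pose K a := L (f a); pose U a := exists b, L (a - f b).
have sK : subgroup K.
  split=> [|a b Ka Kb]; rewrite /K ?raddf0 ?raddfB; first by case: sL.
  exact: sL.2.
have sU : subgroup U.
  split; first by exists 0; rewrite raddf0 subr0; case: sL.
  move=> a b [a' La'] [b' Lb'].
  exists (a' - b'); rewrite raddfB.
  have -> : a - b - (f a' - f b') = (a - f a') - (b - f b').
    by rewrite !opprD !opprK addrACA.
  exact: sL.2.
have sT : subgroup (fun _ : A => True) by [].
have LU a : L a -> U a by move=> La; exists 0; rewrite raddf0 subr0.
have [[k1 i1] [k2 i2]] := has_index_between sK sL (fun _ _ => I) fL iL.
have [[k3 i3] [k4 i4]] := has_index_between sU sL (fun _ _ => I) LU iL.
(* [f] induces an isomorphism from A / f^-1(L) onto (L + f A) / L. Cancelling this common index from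
   the two chains between L and A, through [K] and through [U], leaves the claim. *)
have i1' : has_index (fun=> True) K k4.
  apply: (nb_classes_pullback (phi := f)) i4 => [a _|a b _ _|a [b Lab]] /=.
  - by exists a; rewrite subrr; case: sL.
  - by rewrite -raddfB.
  - by exists b => //; rewrite -opprB; exact: subgroupN.
have e14 := nb_classes_uniq i1 i1'; subst k4.
have := nb_classes_uniq (has_indexM sT sK sL (fun _ _ => I) fL i1 i2)
  (has_indexM sT sU sL (fun _ _ => I) LU i3 i4).
rewrite [RHS]mulnC => /eqP; rewrite eqn_pmul2l.
  by move=> /eqP e; exists k2 => //; rewrite e.
case: i1 => X [g [<- gs _]]; apply/card_gt0P.
by exists (g 0).
Qed.

End Index.

(** * Parity of integers *)

Definition oddz (a : int) : bool := odd `|a|%N.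

Lemma oddzD a b : oddz (a + b) = oddz a (+) oddz b.
Proof. rewrite /oddz; lia. Qed.

Lemma oddzM a b : oddz (a * b) = oddz a && oddz b.
Proof. by rewrite /oddz abszM oddM. Qed.

Lemma oddzN a : oddz (- a) = oddz a.
Proof. by rewrite /oddz abszN. Qed.

Lemma oddz_sum (I : Type) (r : seq I) (P : pred I) (f : I -> int) :
  oddz (\sum_(i <- r | P i) f i) = \big[addb/false]_(i <- r | P i) oddz (f i).
Proof. by apply: big_morph => //; exact: oddzD. Qed.

Lemma oddz_sum_even (I : Type) (r : seq I) (P : pred I) (f : I -> int) :
  (forall i, P i -> ~~ oddz (f i)) -> oddz (\sum_(i <- r | P i) f i) = false.
Proof. by move=> ev; rewrite oddz_sum big1 // => i /ev/negbTE. Qed.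

Lemma evenz_half a : oddz a = false -> exists q, a = 2 * q.
Proof.
rewrite /oddz => ea; exists (sgz a * (`|a|./2)%:Z); rewrite {1}[a]intEsg mulrCA.
by congr (_ * _); rewrite -PoszM mul2n halfK ea subn0.
Qed.

(** * Lattices of finite index *)

Section FiniteIndex.
Variables (V : finType).
Implicit Types (S : {set V}) (B : V -> V -> int) (x y lam : V -> int).

Definition positive_on S B : Prop := forall lam,
  \sum_(s in S) \sum_(t in S) lam s * lam t * B s t = 0 ->
  forall s, s \in S -> lam s = 0.

(** D is the determinant of the Gram matrix and lam is x times its adjugate; a kernel vector of the
    matrix would be isotropic, so D is non-zero. *)
Lemma positive_multiple S B : positive_on S B ->
  exists2 D : int, D != 0 & forall x, exists lam,
    forall t, t \in S -> D * x t = \sum_(s in S) lam s * B s t.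
Proof.
move=> Bpos; have [->|[s0 s0S]] := set_0Vmem S.
  by exists 1 => // x; exists x => t; rewrite inE.
pose M : 'M[int]_#|S| := \matrix_(i, j) B (enum_val i) (enum_val j).
pose lam (v : 'rV[int]_#|S|) s := v 0 (enum_rank_in s0S s).
have lamE v i : lam v (enum_val i) = v 0 i by rewrite /lam enum_valK_in.
have sumE v t : t \in S ->
    \sum_(s in S) lam v s * B s t = (v *m M) 0 (enum_rank_in s0S t).
  move=> tS; rewrite mxE big_enum_val; apply: eq_bigr => i _.
  by rewrite lamE mxE enum_rankK_in.
exists (\det M).
  apply/negP => /det0P[v v0 vM]; case/negP: v0; apply/eqP/rowP => i.
  rewrite mxE -lamE; apply: Bpos (enum_valP i).
  rewrite exchange_big big1 //= => t tS.
  transitivity (lam v t * \sum_(s in S) lam v s * B s t).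
    by rewrite mulr_sumr; apply: eq_bigr => s _; ring.
  by rewrite sumE // vM mxE mulr0.
move=> x; pose w : 'rV[int]_#|S| := \row_i x (enum_val i); exists (lam (w *m \adj M)) => t tS.
rewrite sumE // -mulmxA mul_adj_mx mul_mx_scalar !mxE.
by rewrite enum_rankK_in.
Qed.

(** Reduction modulo D has a finite target, and two functions with equal residues differ by a
    multiple of D, hence by an element of L. *)
Lemma finite_index_multiple (L : {ffun V -> int} -> Prop) (D : int) :
    subgroup L -> D != 0 ->
    (forall x, L [ffun t => D * x t]) ->
  exists n, has_index (fun=> True) L n.
Proof.
move=> sL D0 DL; have Dgt0 : (0 < `|D|)%N by rewrite absz_gt0.
have lt x t : (`|(x t %% D)%Z| < `|D|)%N.
  by have := modz_ge0 (x t) D0; have := ltz_mod (x t) D0; lia.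
pose g (x : {ffun V -> int}) := [ffun t => Ordinal (lt x t)].
apply: (@nb_classes_finite _ _ g _ _ 0) => //.
- by move=> a b Lab; rewrite -opprB; exact: subgroupN.
- by move=> a b c Lab Lbc; rewrite -(subrK b a) -addrA; exact: subgroupD.
move=> a b _ _ /ffunP gab.
have -> : a - b = [ffun t => D * [ffun u => ((a u - b u) %/ D)%Z] t]; last exact: DL.
apply/ffunP => t; rewrite !ffunE mulrC divzK //.
have := gab t; rewrite !ffunE => /(congr1 val) /= e.
rewrite -eqz_mod_dvd -[(a t %% D)%Z]gez0_abs ?modz_ge0 //.
by rewrite e gez0_abs ?modz_ge0.
Qed.

End FiniteIndex.

(** * Coboundaries of a permutation and averages over its iterates *)

Section Iterate.
Variables (V : finType) (F : V -> V).
Hypothesis Finj : injective F.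
Implicit Types (y : V -> int).

(** For odd n the polynomial 1 + X divides 1 + X^n. *)
Lemma signed_cobound_iter n y : odd n ->
  exists z, forall t, y t + y (iter n F t) = z t + z (F t).
Proof.
rewrite -{2}[n]odd_double_half => ->; rewrite add1n; elim: n./2 => [|m [z zE]].
  by exists y.
pose w t := y (iter m.*2.+1 F t).
exists (fun t => z t - (w t - w (F t))) => t; have := zE t.
by rewrite /w doubleS !iterSr; lia.
Qed.

Lemma iter_period : exists2 m, (0 < m)%N & forall t, iter m F t = t.
Proof.
exists (#|V|)`!; first exact: fact_gt0.
move=> t; have /dvdnP[k ->] : (order F t %| (#|V|)`!)%N.
  by rewrite dvdn_fact // order_gt0 /= max_card.
by rewrite iterM iter_fix // iter_order.
Qed.

Lemma sum_comp (S : {set V}) y : (forall t, (F t \in S) = (t \in S)) ->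
  \sum_(t in S) y (F t) = \sum_(t in S) y t.
Proof. by move=> FS; rewrite [RHS](reindex_inj Finj); apply: eq_bigl => t. Qed.

Lemma sum_iterS m y t : iter m F t = t ->
  \sum_(i < m) y (iter i F (F t)) = \sum_(i < m) y (iter i F t).
Proof.
case: m => [|m] mt; first by rewrite !big_ord0.
rewrite big_ord_recr big_ord_recl /= addrC; congr (_ + _).
  by rewrite -iterSr mt.
by apply: eq_bigr => i _; rewrite -iterSr.
Qed.

Variables (S : {set V}) (B : V -> V -> int).
Hypothesis FS : forall t, (F t \in S) = (t \in S).
Hypothesis BF : forall s t, s \in S -> t \in S -> B (F s) (F t) = B s t.
Hypothesis Bpos : positive_on S B.

(* Pair with the F-average of nu and use positivity. *)
Lemma sum_eq0_of_cobound (nu y : V -> int) :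
  (forall t, t \in S -> \sum_(s in S) nu s * B s t = y t - y (F t)) ->
  \sum_(s in S) nu s = 0.
Proof.
move=> nuE; have [m m0 mF] := iter_period.
pose N s := \sum_(i < m) nu (iter i F s).
have NF s : N (F s) = N s by exact: sum_iterS.
have NFi i s : N (iter i F s) = N s by elim: i => //= i <-; rewrite NF.
have FSi i s : (iter i F s \in S) = (s \in S) by elim: i => //= i <-; rewrite FS.
pose Q (a b : V -> int) := \sum_(s in S) \sum_(t in S) a s * b t * B s t.
have QF a b : Q (a \o F) (b \o F) = Q a b.
  rewrite [RHS]/Q -sum_comp //; apply: eq_bigr => s sS /=.
  by rewrite -[RHS]sum_comp //; apply: eq_bigr => t tS; rewrite BF.
have QN0 : Q nu N = 0.
  rewrite /Q exchange_big /=.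
  transitivity (\sum_(t in S) (N t * y t - N t * y (F t))).
    apply: eq_bigr => t tS; rewrite -mulrBr -nuE // mulr_sumr.
    by apply: eq_bigr => s _; ring.
  rewrite sumrB -[X in X - _](sum_comp (fun t => N t * y t)) //.
  by rewrite -sumrB big1 // => t _; rewrite NF subrr.
have QiN i : Q (nu \o iter i F) N = 0.
  elim: i => [|i IH]; first exact: QN0.
  rewrite -IH -[RHS]QF /Q; apply: eq_bigr => s _; apply: eq_bigr => t _.
  by rewrite /= NF -iterSr.
have N0 s : s \in S -> N s = 0.
  apply: Bpos; transitivity (\sum_(i < m) Q (nu \o iter i F) N).
    rewrite /Q [RHS]exchange_big; apply: eq_bigr => u _.
    rewrite [RHS]exchange_big; apply: eq_bigr => t _.
    by rewrite -mulr_suml -mulr_suml.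
  by rewrite big1.
have : \sum_(s in S) N s = m%:Z * \sum_(s in S) nu s.
  rewrite /N exchange_big /= (eq_bigr (fun=> \sum_(s in S) nu s)).
    by rewrite sumr_const card_ord -mulr_natl natz.
  move=> [i /= _] _; elim: i => //= i <-; rewrite -[RHS]sum_comp //.
  by apply: eq_bigr => s _; rewrite -iterSr.
rewrite big1 // => /esym/eqP; rewrite mulf_eq0 => /orP[|/eqP//].
by rewrite eqz_nat eqn0Ngt m0.
Qed.

End Iterate.

(** * The two lattices and the finiteness of their indices *)

Section Lattices.
Variables (V : finType) (F : V -> V).
Implicit Types (S : {set V}) (B : V -> V -> int) (x : {ffun V -> int}).

(** The preimage in Z^S of the image of the homology lattice in its dual Z^S / Z. Values off S are
    free, here and in [gram_lattice], so an index among functions on V is an index in Z^S. *)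
Definition degree0_lattice S B x : Prop := exists (lam : V -> int) k,
  \sum_(s in S) lam s = 0 /\
  forall t, t \in S -> x t = \sum_(s in S) lam s * B s t + k.

Definition gram_lattice S B x : Prop := exists lam : V -> int,
  forall t, t \in S -> x t = \sum_(s in S) lam s * B s t.

Definition twist (e : int) x : {ffun V -> int} := [ffun t => x t - e * x (F t)].

Lemma twist_is_zmod_morphism e : zmod_morphism (twist e).
Proof. by move=> x y; apply/ffunP => t; rewrite !ffunE; ring. Qed.

HB.instance Definition _ e :=
  GRing.isZmodMorphism.Build _ _ (twist e) (twist_is_zmod_morphism e).

Lemma degree0_lattice_subgroup S B : subgroup (degree0_lattice S B).
Proof.
split=> [|x y [lam [k [l0 xE]]] [mu [j [m0 yE]]]].
  exists (fun=> 0), 0; rewrite big1 //; split=> // t _; rewrite ffunE big1 ?addr0 //.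
  by move=> s _; rewrite mul0r.
exists (fun s => lam s - mu s), (k - j); rewrite sumrB l0 m0 subr0; split=> // t tS.
rewrite !ffunE xE // yE //; under [in RHS]eq_bigr do rewrite mulrBl.
by rewrite sumrB; ring.
Qed.

Lemma gram_lattice_subgroup S B : subgroup (gram_lattice S B).
Proof.
split=> [|x y [lam xE] [mu yE]].
  exists (fun=> 0) => t _; rewrite ffunE big1 // => s _; by rewrite mul0r.
exists (fun s => lam s - mu s) => t tS.
rewrite !ffunE xE // yE //; under [in RHS]eq_bigr do rewrite mulrBl.
by rewrite sumrB.
Qed.

Hypothesis Finj : injective F.

Section Stable.
Variables (S : {set V}) (B : V -> V -> int).
Hypothesis FS : forall s, (F s \in S) = (s \in S).
Hypothesis BF : forall s t, s \in S -> t \in S -> B (F s) (F t) = B s t.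

Lemma gram_twist e (lam : V -> int) t : t \in S ->
  \sum_(s in S) (lam s - e * lam (F s)) * B s t =
  \sum_(s in S) lam s * B s t - e * \sum_(s in S) lam s * B s (F t).
Proof.
move=> tS; under eq_bigr do rewrite mulrBl.
rewrite sumrB; congr (_ - _).
rewrite -[in RHS](sum_comp Finj _ FS) mulr_sumr; apply: eq_bigr => s sS.
by rewrite BF // mulrA.
Qed.

Lemma degree0_lattice_twist e x :
  degree0_lattice S B x -> degree0_lattice S B (twist e x).
Proof.
move=> [lam [k [l0 xE]]]; exists (fun s => lam s - e * lam (F s)), (k - e * k).
rewrite sumrB -mulr_sumr (sum_comp Finj _ FS) l0 mulr0 subr0; split=> // t tS.
by rewrite gram_twist // ffunE !xE ?FS //; ring.
Qed.

Lemma gram_lattice_twist e x : gram_lattice S B x -> gram_lattice S B (twist e x).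
Proof.
move=> [lam xE]; exists (fun s => lam s - e * lam (F s)) => t tS.
by rewrite gram_twist // ffunE !xE ?FS.
Qed.

End Stable.

Lemma gram_lattice_finite S B : positive_on S B ->
  exists n, has_index (fun=> True) (gram_lattice S B) n.
Proof.
move=> /positive_multiple[D D0 DB]; apply: (finite_index_multiple _ D0).
  exact: gram_lattice_subgroup.
by move=> x; have [lam lamE] := DB x; exists lam => t tS; rewrite ffunE lamE.
Qed.

(** Let lam B = D x and mu B = D on S, and let l and a be the degrees of lam and mu. Then a lam - l
    mu has degree zero and is sent to a D x - l D. If a were 0, mu would be isotropic. *)
Lemma degree0_lattice_finite S B s0 : s0 \in S -> positive_on S B ->
  exists n, has_index (fun=> True) (degree0_lattice S B) n.
Proof.
move=> s0S Bpos; have [D D0 DB] := positive_multiple Bpos.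
have [mu muE] := DB (fun=> 1); pose a := \sum_(s in S) mu s.
have a0 : a != 0.
  apply/eqP => a0; have mu0 : forall s, s \in S -> mu s = 0.
    apply: Bpos; rewrite exchange_big /=.
    transitivity (\sum_(t in S) mu t * D); last by rewrite -mulr_suml -/a a0 mul0r.
    apply: eq_bigr => t tS; rewrite -[D]mulr1 (muE t tS) mulr_sumr.
    by apply: eq_bigr => s _; ring.
  have := muE s0 s0S; rewrite big1 => [|s sS]; last by rewrite mu0 // mul0r.
  by move/eqP; rewrite mulr1 (negbTE D0).
apply: (@finite_index_multiple _ _ (a * D)); first exact: degree0_lattice_subgroup.
  by rewrite mulf_neq0.
move=> x; have [lam lamE] := DB x; pose l := \sum_(s in S) lam s.
exists (fun s => a * lam s - l * mu s), (l * D); split.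
  by rewrite sumrB -!mulr_sumr -/a -/l mulrC subrr.
move=> t tS; rewrite ffunE -mulrA lamE //.
have -> : \sum_(s in S) (a * lam s - l * mu s) * B s t =
   a * \sum_(s in S) lam s * B s t - l * \sum_(s in S) mu s * B s t.
  by rewrite !mulr_sumr -sumrB; apply: eq_bigr => s _; ring.
by rewrite -(muE t tS); ring.
Qed.

End Lattices.

(** * Comparison of the two indices *)

(* S0, S1 and n stand for the points of S in even orbits, those in odd orbits, and
   an odd power of F that is trivial on the odd orbits; B0 is the form of T', sg
   the sign on its branches, and tw marks the odd twigs. *)
Section Comparison.
Variables (V : finType) (F : V -> V) (S S0 S1 : {set V}).
Variables (B B0 : V -> V -> int) (sg tw : V -> bool) (n : nat) (s0 : V).
Hypothesis Finj : injective F.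
Hypothesis SE : forall s, (s \in S) = (s \in S0) || (s \in S1).
Hypothesis S01 : forall s, s \in S0 -> s \in S1 = false.
Hypothesis FS0 : forall s, (F s \in S0) = (s \in S0).
Hypothesis FS1 : forall s, (F s \in S1) = (s \in S1).
Hypothesis n_odd : odd n.
Hypothesis nF : forall s, s \in S1 -> iter n F s = s.
Hypothesis BF : forall s t, s \in S -> t \in S -> B (F s) (F t) = B s t.
Hypothesis B0F : forall s t, s \in S0 -> t \in S0 -> B0 (F s) (F t) = B0 s t.
Hypothesis BB0 : forall s t, s \in S0 -> t \in S0 ->
  B s (iter n F t) - B0 s (iter n F t) = B s t - B0 s t.
Hypothesis BS1 : forall s t, s \in S1 -> t \in S0 -> B s (iter n F t) = B s t.
Hypothesis B0sg : forall s t, s \in S0 -> t \in S0 -> B0 s t != 0 -> sg s = sg t.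
Hypothesis sgF : forall s, s \in S0 -> sg (F s) = ~~ sg s.
Hypothesis Bpos : positive_on S B.
Hypothesis B0pos : positive_on S0 B0.
Hypothesis Beven : forall s t, s \in S -> t \in S1 -> s != t -> oddz (B s t) = false.
Hypothesis Btw : forall t, t \in S1 -> oddz (B t t) = tw t.
Hypothesis s0S : s0 \in S.
Implicit Types (x y z lam mu : V -> int) (j k : int).

Let FS s : (F s \in S) = (s \in S).
Proof. by rewrite !SE FS0 FS1. Qed.

Let S0S s : s \in S0 -> s \in S. Proof. by rewrite SE => ->. Qed.
Let S1S s : s \in S1 -> s \in S. Proof. by rewrite SE orbC => ->. Qed.
Let S10 s : s \in S1 -> s \in S0 = false.
Proof. by move=> s1; apply/negP => /S01; rewrite s1. Qed.

Let FiS0 i s : (iter i F s \in S0) = (s \in S0).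
Proof. by elim: i => //= i <-; rewrite FS0. Qed.

Let FiS1 i s : (iter i F s \in S1) = (s \in S1).
Proof. by elim: i => //= i <-; rewrite FS1. Qed.

Let twF t : t \in S1 -> tw (F t) = tw t.
Proof. by move=> t1; rewrite -!Btw ?FS1 // BF ?S1S. Qed.

Let twFi i t : t \in S1 -> tw (iter i F t) = tw t.
Proof. by move=> t1; elim: i => //= i <-; rewrite twF ?FiS1. Qed.

Let sgFi i s : s \in S0 -> sg (iter i F s) = odd i (+) sg s.
Proof. by move=> sS; elim: i => //= i IH; rewrite sgF ?FiS0 // IH addNb. Qed.

Lemma sumSE (f : V -> int) :
  \sum_(s in S) f s = \sum_(s in S0) f s + \sum_(s in S1) f s.
Proof.
rewrite (bigID (mem S0)) /=; congr (_ + _); apply: eq_bigl => s; rewrite SE /=.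
  by case: (s \in S0); rewrite ?andbF.
by case s0' : (s \in S0); rewrite /= ?andbT // S01.
Qed.

(** F exchanges the two values of the sign on S0, so both are taken equally often and #S0 is
    even. *)
Lemma oddS : odd #|S| = odd #|S1|.
Proof.
have -> : S = S0 :|: S1 by apply/setP => s; rewrite SE inE.
have dis : [disjoint S0 & S1] by apply/pred0P => s /=; case h : (s \in S0) => //=; rewrite S01.
rewrite cardsU disjoint_setI0 // cards0 subn0 oddD.
pose P := [set s in S0 | sg s]; pose Q := [set s in S0 | ~~ sg s].
have PQ : F @: P \subset Q.
  apply/subsetP => _ /imsetP[s + ->]; rewrite !inE => /andP[sS s1].
  by rewrite FS0 sS sgF ?s1.
have QP : F @: Q \subset P.
  apply/subsetP => _ /imsetP[s + ->]; rewrite !inE => /andP[sS s1].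
  by rewrite FS0 sS sgF ?s1.
have /subset_leq_card := PQ; have /subset_leq_card := QP.
rewrite !card_imset // => le1 le2.
suff -> : #|S0| = (#|P| + #|Q|)%N by lia.
rewrite -cardsUI [P :&: Q](_ : _ = finset.set0) ?cards0 ?addn0.
  by apply: eq_card => s; rewrite !inE; case: (s \in S0); case: (sg s).
by apply/setP => s; rewrite !inE; case: (sg s); rewrite ?andbF ?andbT ?andNb.
Qed.

(* The subgroup L + (1 + F) Z^S.  The coordinate j records the degree of lam, which
   is therefore unconstrained. *)
Definition discr x j := exists lam k y,
  (forall t, t \in S ->
     x t = \sum_(s in S) lam s * B s t + k + y t + y (F t)) /\
  j = \sum_(s in S) lam s.

Lemma discr_ext x x' j :
  (forall t, t \in S -> x t = x' t) -> discr x j -> discr x' j.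
Proof.
move=> xx' [lam [k [y [xE jE]]]]; exists lam, k, y; split=> // t tS.
by rewrite -xx' // xE.
Qed.

Lemma discr_lin x j m x' j' : discr x j -> discr x' j' ->
  discr (fun t => x t + m * x' t) (j + m * j').
Proof.
move=> [lam [k [y [xE ->]]]] [lam' [k' [y' [xE' ->]]]].
exists (fun s => lam s + m * lam' s), (k + m * k'), (fun t => y t + m * y' t).
split=> [t tS|]; last by rewrite big_split -mulr_sumr.
rewrite xE // xE' //.
have -> : \sum_(s in S) (lam s + m * lam' s) * B s t =
    \sum_(s in S) lam s * B s t + m * \sum_(s in S) lam' s * B s t.
  by rewrite mulr_sumr -big_split; apply: eq_bigr => s _ /=; ring.
ring.
Qed.

Lemma discr0 : discr (fun=> 0) 0.
Proof.
exists (fun=> 0), 0, (fun=> 0); rewrite big1 //; split=> // t _.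
by rewrite big1 // => s _; rewrite mul0r.
Qed.

Lemma discrB x j x' j' : discr x j -> discr x' j' ->
  discr (fun t => x t - x' t) (j - j').
Proof.
move=> dx dx'; have := discr_lin (-1) dx dx'; rewrite mulN1r.
by apply: discr_ext => t _; rewrite mulN1r.
Qed.

Lemma discrD x j x' j' : discr x j -> discr x' j' ->
  discr (fun t => x t + x' t) (j + j').
Proof.
move=> dx dx'; have := discr_lin 1 dx dx'; rewrite mul1r.
by apply: discr_ext => t _; rewrite mul1r.
Qed.

Lemma discrM m x j : discr x j -> discr (fun t => m * x t) (m * j).
Proof.
move=> dx; have := discr_lin m discr0 dx; rewrite add0r.
by apply: discr_ext => t _; rewrite add0r.
Qed.

Lemma discr_sum (I : Type) (r : seq I) (P : pred I) (f : I -> V -> int) (j : I -> int) :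
    (forall i, P i -> discr (f i) (j i)) ->
  discr (fun t => \sum_(i <- r | P i) f i t) (\sum_(i <- r | P i) j i).
Proof.
move=> df; elim: r => [|i r IH].
  by rewrite big_nil; apply: discr_ext discr0 => t _; rewrite big_nil.
rewrite big_cons; case: ifP => Pi.
  by apply: discr_ext (discrD (df _ Pi) IH) => t _; rewrite big_cons Pi.
by apply: discr_ext IH => t _; rewrite big_cons Pi.
Qed.

Lemma discr_cob y : discr (fun t => y t + y (F t)) 0.
Proof.
exists (fun=> 0), 0, y; split=> [t _|]; last by rewrite big1.
by rewrite big1 ?add0r // => s _; rewrite mul0r.
Qed.

Lemma discr_const : discr (fun=> 1) 0.
Proof.
exists (fun=> 0), 1, (fun=> 0); split=> [t _|]; last by rewrite big1.
by rewrite big1 ?add0r ?addr0 // => s _; rewrite mul0r.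
Qed.

Lemma discr_gen s : s \in S -> discr (B s) 1.
Proof.
move=> sS; exists (fun t => (t == s)%:R), 0, (fun=> 0); split.
  move=> t tS; rewrite (bigD1 s) //= eqxx mul1r big1 ?addr0 // => u /andP[_ /negbTE->].
  by rewrite mul0r.
by rewrite (bigD1 s) //= eqxx big1 ?addr0 // => u /andP[_ /negbTE->].
Qed.

(** By invariance of B, the sum B(s0, t) + B(F s0, t) is y(t) + y(F t) for y = B(F s0, -). *)
Lemma discr_0_2 : discr (fun=> 0) 2.
Proof.
have ds : discr (B s0) 1 by exact: discr_gen.
have dFs : discr (B (F s0)) 1 by apply: discr_gen; rewrite FS.
have := discrB (discrD ds dFs) (discr_cob (B (F s0))).
by apply: discr_ext => t tS; rewrite BF //; ring.
Qed.

(** The sign holds at exactly one of t and F^n t. So x = h + h o F^n, where h is x where the sign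
    holds and 0 elsewhere. *)
Lemma cob_of_invariant x : (forall t, t \in S0 -> x (iter n F t) = x t) ->
  exists z, forall t, t \in S0 -> x t = z t + z (F t).
Proof.
move=> xn; pose h t := (sg t)%:R * x t.
have [z zE] := signed_cobound_iter F h n_odd; exists z => t tS.
rewrite -zE /h xn // sgFi // n_odd addTb; case: (sg t) => /=; ring.
Qed.

(** On S0 the sign solves the equation x = z + z o F; on S1 an even function 2 q is q + q o F^n,
    because F^n is trivial there. *)
Lemma discr_trivial x : (forall t, t \in S0 -> x (iter n F t) = x t) ->
  (forall t, t \in S1 -> oddz (x t) = false) -> discr x 0.
Proof.
move=> /cob_of_invariant[z0 z0E] xev.
have /choice[q qE] : forall t, exists q, t \in S1 -> x t = 2 * q.
  move=> t; case: (boolP (t \in S1)) => [/xev/evenz_half[q ->]|_]; first by exists q.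
  by exists 0.
have [z1 z1E] := signed_cobound_iter F q n_odd.
pose z t := if t \in S0 then z0 t else z1 t.
apply: discr_ext (discr_cob z) => t; rewrite /z FS0 SE.
case t0 : (t \in S0) => /=; [move=> _ | move=> t1]; first by rewrite z0E.
by rewrite -z1E nF // qE //; ring.
Qed.

(** B(s, -) differs from the indicator of s, or from 0 when [tw s] fails, by a function that is even
    on S1 and invariant under F^n on S0. This is the relation that each point of S1 imposes on the
    quotient. *)
Lemma discr_single s : s \in S1 -> discr (fun t => ((t == s) && tw s)%:R) 1.
Proof.
move=> s1; have sS := S1S s1.
have dt : discr (fun t => B s t - ((t == s) && tw s)%:R) 0.
  apply: discr_trivial => [t t0|t t1].
    have ne u : u \in S0 -> u == s = false by move=> u0; apply/eqP => us; rewrite us S10 in u0.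
    by rewrite BS1 // !ne ?FiS0.
  rewrite oddzD oddzN; have [->|ts] := eqVneq t s; last by rewrite Beven // eq_sym.
  by rewrite Btw //; case: (tw s).
have := discrB (discr_gen sS) dt; rewrite subr0.
by apply: discr_ext => t tS; ring.
Qed.

(** The constant 1 is the sum of the indicators of S0 and S1, and the first of them is trivial by
    invariance. *)
Lemma discr_S1 : discr (fun t => (t \in S1)%:R) 0.
Proof.
have dt : discr (fun t => (t \in S0)%:R) 0.
  by apply: discr_trivial => t tS; rewrite ?FiS0 // S10.
have := discrB discr_const dt; rewrite subr0; apply: discr_ext => t.
by rewrite SE; case t0 : (t \in S0) => /=; [rewrite S01 | move=> ->].
Qed.

(** Both x + x o F and 2 x are trivial, so F acts trivially on the classes of functions vanishing on
    S0: only the orbits of S1 matter. *)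
Lemma discr_shift x i : (forall t, t \in S0 -> x t = 0) ->
  discr (fun t => x t - x (iter i F t)) 0.
Proof.
move=> x0; elim: i => [|i IH].
  by apply: discr_ext discr0 => t _; rewrite subrr.
pose y t := x (iter i F t).
have d2 : discr (fun t => 2 * y (F t)) 0.
  apply: discr_trivial => t tS; last by rewrite oddzM.
  by rewrite /y !x0 ?FiS0 ?FS0 ?FiS0.
have := discrD IH (discrB (discr_cob y) d2); rewrite subr0 ?addr0.
by apply: discr_ext => t _; rewrite /y iterSr; ring.
Qed.

(** * The sign on S_0 and the reduction to S_1 *)

Definition sig s : int := (-1) ^+ sg s.

Lemma sig2 s : sig s * sig s = 1.
Proof. by rewrite /sig; case: (sg s). Qed.

Lemma sigF s : s \in S0 -> sig (F s) = - sig s.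
Proof. by move=> sS; rewrite /sig sgF //; case: (sg s). Qed.

Lemma oddz_sig s a : oddz (sig s * a) = oddz a.
Proof. by rewrite /sig; case: (sg s); rewrite ?mul1r // mulN1r oddzN. Qed.

Lemma sig_sumB0 lam t : t \in S0 ->
  \sum_(s in S0) sig s * lam s * B0 s t = sig t * \sum_(s in S0) lam s * B0 s t.
Proof.
move=> tS; rewrite mulr_sumr; apply: eq_bigr => s sS.
have [->|nz] := eqVneq (B0 s t) 0; first by rewrite !mulr0.
by rewrite /sig (B0sg sS tS nz) mulrA.
Qed.

(** The discarded part of the form is invariant under F^n in its second argument, so
    [cob_of_invariant] absorbs it. *)
Lemma S0_rest mu : exists z, forall t, t \in S0 ->
  \sum_(s in S) mu s * B s t = \sum_(s in S0) mu s * B0 s t + z t + z (F t).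
Proof.
pose x t := \sum_(s in S0) mu s * (B s t - B0 s t) + \sum_(s in S1) mu s * B s t.
have [t t0|z zE] := @cob_of_invariant x.
  rewrite /x; congr (_ + _); apply: eq_bigr => s sS; first by rewrite BB0.
  by rewrite BS1.
exists z => t t0; rewrite -addrA -zE // /x addrA sumSE; congr (_ + _).
by rewrite -big_split; apply: eq_bigr => s _ /=; ring.
Qed.

(* On S0, the function sig * x lies in the lattice of B0 up to the image of 1 - F. *)
Definition lifted lam y x := forall t, t \in S0 ->
  sig t * x t = \sum_(s in S0) lam s * B0 s t + (y t - y (F t)).

(** Subtracting mu B, with mu = sig lam on S0, clears x on S0 up to the image of 1 + F. On S1 this
    changes x by even amounts only, the values B(s, t) with s in S0 and t in S1 being even. *)
Lemma discr_reduce lam y x : lifted lam y x -> exists x1,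
  [/\ forall t, t \in S0 -> x1 t = 0, forall t, t \in S1 -> oddz (x1 t) = oddz (x t)
    & discr (fun t => x t - x1 t) (\sum_(s in S0) sig s * lam s)].
Proof.
move=> xE; pose mu s := if s \in S0 then sig s * lam s else 0.
have mu0 (f : V -> int) : \sum_(s in S) mu s * f s = \sum_(s in S0) sig s * lam s * f s.
  rewrite sumSE [X in _ + X]big1 ?addr0 => [|s s1].
    by apply: eq_bigr => s sS; rewrite /mu sS.
  by rewrite /mu S10 // mul0r.
have [z zE] := S0_rest mu.
pose x1 t := if t \in S1 then x t - \sum_(s in S) mu s * B s t else 0.
exists x1; split=> [t t0|t t1|]; first by rewrite /x1 S01.
  rewrite /x1 t1 mu0 oddzD oddzN oddz_sum_even ?addbF // => s sS.
  by rewrite oddzM Beven ?S0S ?andbF //; apply/eqP => st; rewrite st S10 in sS.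
exists mu, 0, (fun t => if t \in S0 then sig t * y t - z t else 0); split; last first.
  transitivity (\sum_(s in S) mu s * 1).
    by rewrite (mu0 (fun=> 1)); apply: eq_bigr => s _; rewrite mulr1.
  by apply: eq_bigr => s _; rewrite mulr1.
move=> t; rewrite SE /x1 FS0; case t0 : (t \in S0) => /=; [move=> _ | move=> t1]; last first.
  by rewrite t1; ring.
rewrite S01 // zE // subr0.
have -> : \sum_(s in S0) mu s * B0 s t = sig t * \sum_(s in S0) lam s * B0 s t.
  rewrite -sig_sumB0 //; apply: eq_bigr => s sS; by rewrite /mu sS.
have : x t = sig t * (sig t * x t) by rewrite mulrA sig2 mul1r.
rewrite xE // => ->; rewrite sigF //; ring.
Qed.

(** * The quotient when every point of S_1 ends an odd twig *)

Section AllOdd.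
Hypothesis tw1 : forall s, s \in S1 -> tw s.

Lemma discr_all_odd_S1 x : (forall t, t \in S0 -> x t = 0) ->
  discr x (\sum_(s in S1) x s).
Proof.
move=> x0; have := @discr_sum _ (index_enum V) (mem S1) _ _
  (fun s s1 => discrM (x s) (discr_single s1)).
under eq_bigr do rewrite mulr1; apply: discr_ext => t; rewrite SE.
case t0 : (t \in S0) => /=; [move=> _ | move=> t1].
  rewrite x0 // big1 // => s s1.
  by rewrite (_ : t == s = false) ?mulr0 //; apply/eqP => e; rewrite e S10 in t0.
rewrite (bigD1 t) //= eqxx tw1 // mulr1 big1 ?addr0 // => s /andP[_ /negbTE].
by rewrite eq_sym => ->; rewrite mulr0.
Qed.

Lemma discr_all_odd x j : (forall t, t \in S0 -> x t = 0) ->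
  oddz (j + \sum_(s in S1) x s) = false -> discr x j.
Proof.
move=> x0 ev; have [|q qE] := @evenz_half (j - \sum_(s in S1) x s).
  by rewrite oddzD oddzN -oddzD.
have := discrD (discr_all_odd_S1 x0) (discrM q discr_0_2).
rewrite [q * 2]mulrC -qE addrC subrK; apply: discr_ext => t _; ring.
Qed.

(** For odd #S the indicator of S1 is trivial but has an odd sum, so it corrects a wrong parity. *)
Lemma discr_all_odd_card x j : odd #|S| -> (forall t, t \in S0 -> x t = 0) ->
  discr x j.
Proof.
move=> oS x0.
have [ev|od] := boolP (oddz (j + \sum_(s in S1) x s)); last first.
  by apply: discr_all_odd => //; exact/negbTE.
pose x' t := x t - (t \in S1)%:R.
have : discr x' j.
  apply: discr_all_odd => [t t0|]; first by rewrite /x' x0 // S01.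
  rewrite /x' sumrB addrA oddzD ev oddzN.
  rewrite (eq_bigr (fun=> 1)) => [|s ->//].
  by rewrite sumr_const natz /oddz absz_nat -oddS oS.
move=> /discrD/(_ discr_S1); rewrite addr0; apply: discr_ext => t _.
by rewrite /x' subrK.
Qed.

(** The parity is well defined although lam is not unique: two choices differ by a function that B0
    sends into the image of 1 - F, and positivity forces such a function to have degree zero. *)
Lemma discr_all_oddP lam y x j : ~~ odd #|S| -> lifted lam y x ->
  discr x j <-> oddz (j + \sum_(s in S0) lam s + \sum_(s in S1) x s) = false.
Proof.
move=> evS xE.
have sigsum (f : V -> int) : oddz (\sum_(s in S0) sig s * f s) = oddz (\sum_(s in S0) f s).
  by rewrite !oddz_sum; apply: eq_bigr => s _; rewrite oddz_sig.
split=> [[mu [k [z [xE' ->]]]]|ev]; last first.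
  have [x1 [x10 x11 dx1]] := discr_reduce xE.
  have dx : discr x1 (j - \sum_(s in S0) sig s * lam s).
    apply: discr_all_odd => //; rewrite -ev !oddzD oddzN sigsum.
    by congr (_ (+) _); rewrite !oddz_sum; apply: eq_bigr => s /x11.
  by have := discrD dx dx1; rewrite subrK; apply: discr_ext => t _; ring.
have [w wE] := S0_rest mu.
(* Both lam and sig mu lift x, so B0 sends their difference to a coboundary. *)
have [c cE] : exists c, forall t, t \in S0 ->
    \sum_(s in S0) (lam s - sig s * mu s) * B0 s t = c t - c (F t).
  pose h t := if t \in S0 then k else 0.
  have [t t0|h' h'E] := @cob_of_invariant h; first by rewrite /h FiS0 t0.
  exists (fun t => sig t * (w t + z t + h' t) - y t) => t t0.
  have -> : \sum_(s in S0) (lam s - sig s * mu s) * B0 s t =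
     \sum_(s in S0) lam s * B0 s t - \sum_(s in S0) sig s * mu s * B0 s t.
    by rewrite -sumrB; apply: eq_bigr => s _; ring.
  have hk := h'E t t0; rewrite /h t0 in hk.
  have -> : \sum_(s in S0) lam s * B0 s t = sig t * x t - (y t - y (F t)).
    by rewrite xE // addrK.
  rewrite sig_sumB0 // xE' ?S0S // wE // hk sigF //; ring.
have /eqP := sum_eq0_of_cobound Finj FS0 B0F B0pos cE.
rewrite sumrB subr_eq0 => /eqP ->; rewrite sumSE !oddzD sigsum.
have -> : oddz (\sum_(s in S1) x s) = oddz (\sum_(s in S1) mu s); last first.
  by case: (oddz (\sum_(s in S0) _)); case: (oddz _).
(* The sums of z and of z o F over S1 agree, and the constant contributes k #S1, which is even
   here. *)
have -> : \sum_(t in S1) x t = \sum_(t in S1) \sum_(s in S) mu s * B s t + k * #|S1|%:Z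
   + 2 * \sum_(t in S1) z t.
  transitivity (\sum_(t in S1) (\sum_(s in S) mu s * B s t + k + z t + z (F t))).
    by apply: eq_bigr => t t1; rewrite xE' // S1S.
  by rewrite !big_split /= (sum_comp Finj z FS1) sumr_const -mulr_natr natz; ring.
rewrite !oddzD !oddzM /= addbF [oddz #|S1|](_ : _ = odd #|S1|) //.
rewrite -oddS (negbTE evS) andbF addbF !oddz_sum.
apply: eq_bigr => t t1; rewrite (bigD1 t) ?S1S //= oddzD oddzM Btw // tw1 // andbT.
rewrite oddz_sum_even ?addbF // => s /andP[sS st]; by rewrite oddzM Beven // andbF.
Qed.

End AllOdd.

(** * The quotient when some point of S_1 does not end an odd twig *)

Section SomeEven.
Variable e : V.
Hypothesis e1 : e \in S1.
Hypothesis etw : tw e = false.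

(** As n is odd and a multiple of the size of each orbit in S1, this has the parity of the sum of x
    over the orbit of t, for t in S1. *)
Definition avg x t := \sum_(i < n) x (iter i F t).

Lemma avgF x t : t \in S1 -> avg x (F t) = avg x t.
Proof. by move=> t1; apply: sum_iterS; exact: nF. Qed.

Lemma oddz_avg x x' t : t \in S1 ->
  (forall t, t \in S1 -> oddz (x t) = oddz (x' t)) -> oddz (avg x t) = oddz (avg x' t).
Proof.
by move=> t1 xx'; rewrite !oddz_sum; apply: eq_bigr => i _; rewrite xx' // FiS1.
Qed.

(** Along an orbit of S1 without odd twigs all values of B are even, and y + y o F averages to twice
    [avg y]. What is left is n k, whose parity is the same for all such orbits. *)
Lemma discr_avg x j t : t \in S1 -> tw t = false -> discr x j ->
  oddz (avg x t) = oddz (avg x e).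
Proof.
move=> t1 tt [lam [k [y [xE _]]]].
suff H u : u \in S1 -> tw u = false -> oddz (avg x u) = oddz k by rewrite !H.
move=> u1 uu; have -> : avg x u =
    \sum_(i < n) \sum_(s in S) lam s * B s (iter i F u) + n%:Z * k + 2 * avg y u.
  rewrite /avg (eq_bigr (fun i : 'I_n => \sum_(s in S) lam s * B s (iter i F u) + k
     + y (iter i F u) + y (iter i F (F u)))) => [|i _].
    rewrite !big_split /= sumr_const card_ord -mulr_natl natz.
    by rewrite -[\sum_(i < n) y (iter i F (F u))]/(avg y (F u)) avgF // /avg; ring.
  by rewrite xE ?S1S ?FiS1 // -iterSr.
rewrite !oddzD !oddzM /= addbF [oddz n](_ : _ = true) //= oddz_sum_even //.
move=> i _; rewrite oddz_sum_even // => s sS; rewrite oddzM.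
have [->|su] := eqVneq s (iter i F u); last by rewrite Beven ?FiS1 // andbF.
by rewrite Btw ?FiS1 // twFi // uu andbF.
Qed.

(** B(e, -) is even at e too, hence trivial in degree 0, while it is also a generator in degree
    1. *)
Lemma discr_0_any j : discr (fun=> 0) j.
Proof.
have dB : discr (B e) 0.
  apply: discr_trivial => t tS; first by rewrite BS1.
  by have [->|te] := eqVneq t e; [rewrite Btw | rewrite Beven ?S1S // eq_sym].
have := discrM j (discrB (discr_gen (S1S e1)) dB); rewrite subr0 mulr1.
by apply: discr_ext => t _; ring.
Qed.

(** It is enough to treat the average: n x - avg x is a sum of differences x - x o F^i, and n is
    odd. Once normalised at e, the average is even at the points that end no odd twig, and
    [discr_single] clears it at the others. *)
Lemma discr_some_even x j : (forall t, t \in S0 -> x t = 0) ->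
  (forall t, t \in S1 -> tw t = false -> oddz (avg x t) = oddz (avg x e)) ->
  discr x j.
Proof.
move=> x0 xe; suff dx : discr x 0.
  by have := discrD dx (discr_0_any j); rewrite add0r; apply: discr_ext => t _; ring.
(* Adding the indicator of S1 flips the parity of every average over S1, because n is odd. *)
wlog ee : x x0 xe / oddz (avg x e) = false.
  move=> IH; have [od|] := boolP (oddz (avg x e)); last by move/negbTE; exact: IH.
  pose x' t := x t + (t \in S1)%:R.
  have avg' t : t \in S1 -> oddz (avg x' t) = ~~ oddz (avg x t).
    move=> t1; rewrite /avg /x' big_split oddzD /=.
    under [X in _ (+) oddz X]eq_bigr do rewrite FiS1 t1.
    by rewrite sumr_const card_ord -mulrnA mul1n natz [oddz n](_ : _ = true) ?addbT.
  have := discrB (IH x' _ _ _) discr_S1; rewrite subr0.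
  have H : (forall t, t \in S0 -> x' t = 0) by move=> t t0; rewrite /x' x0 // S01.
  have H1 : (forall t, t \in S1 -> tw t = false -> oddz (avg x' t) = oddz (avg x' e)).
    by move=> t t1 tt; rewrite !avg' // xe.
  have H2 : oddz (avg x' e) = false by rewrite avg' // od.
  by move=> /(_ H H1 H2); apply: discr_ext => t _; rewrite /x' addrK.
have avg0 t : t \in S0 -> avg x t = 0.
  by move=> t0; rewrite /avg big1 // => i _; rewrite x0 // FiS0.
have davg : discr (avg x) 0.
  have := @discr_sum _ (index_enum V) (mem S1) _ _
    (fun s s1 => discrM (avg x s) (discrB (discr_single s1) (discr_0_any 1))).
  rewrite big1 => [|s _]; last by rewrite subrr mulr0.
  set x2 := fun t => _; move=> d2.
  suff dt : discr (fun t => avg x t - x2 t) 0.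
    by have := discrD d2 dt; rewrite addr0; apply: discr_ext => t _; ring.
  apply: discr_trivial => [t t0|t t1].
    have x20 u : u \in S0 -> x2 u = 0.
      move=> u0; rewrite /x2 big1 // => s s1; rewrite (_ : u == s = false).
        by rewrite subr0 mulr0.
      by apply/eqP => us; rewrite us S10 in u0.
    by rewrite !avg0 ?FiS0 // !x20 ?FiS0.
  have -> : x2 t = avg x t * (tw t)%:R.
    rewrite /x2 (bigD1 t) //= eqxx subr0 big1 ?addr0 // => s /andP[_ /negbTE].
    by rewrite eq_sym => ->; rewrite subr0 mulr0.
  case: (boolP (tw t)) => [_|/negbTE tt]; first by rewrite mulr1 subrr.
  by rewrite mulr0 subr0 xe.
have dshift : discr (fun t => n%:Z * x t - avg x t) 0.
  have := @discr_sum _ (index_enum 'I_n) xpredT _ _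
    (fun (i : 'I_n) _ => discr_shift i x0).
  rewrite big1 //; apply: discr_ext => t _.
  by rewrite sumrB sumr_const card_ord -mulr_natl natz.
have d2 : discr (fun t => 2 * (n./2%:Z * x t)) 0.
  apply: discr_trivial => t tS; last by rewrite oddzM.
  by rewrite !x0 ?FiS0.
have := discrB (discrD davg dshift) d2; rewrite addr0 subr0.
have nE : n%:Z = 1 + 2 * n./2%:Z.
  by rewrite -{1}[n]odd_double_half n_odd add1n; lia.
by apply: discr_ext => t _; rewrite nE; ring.
Qed.

End SomeEven.

(** * The index contributed by S_1, and the comparison *)

Definition orbit_of (x : V) : {set V} := [set y | fconnect F x y].
(** [A1s], [A0s] and [twos] copy [A1], [A0] and [c1] for abstract data, so that on an actual tree
    they are convertible to them. *)
Definition A1s : {set {set V}} := [set orbit_of x | x in [set x : V in S1 | tw x]].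
Definition A0s : {set {set V}} := [set orbit_of x | x in S1] :\: A1s.
Definition twos : nat :=
  if (0 < #|A0s|)%N then (2 ^ (#|A0s| - 1))%N else if odd #|S| then 1%N else 2%N.

Lemma orbit_of_eq (x y : V) : (orbit_of x == orbit_of y) = fconnect F x y.
Proof.
apply/eqP/idP => [/setP/(_ y)|xy]; first by rewrite !inE connect0 => ->.
by apply/setP => z; rewrite !inE (same_connect _ xy) //; exact: fconnect_sym.
Qed.

Lemma fconnect_invariant (C : Type) (h : V -> C) (x y : V) : x \in S1 ->
  (forall t, t \in S1 -> h (F t) = h t) -> fconnect F x y -> h y = h x.
Proof.
move=> x1 hF /iter_findex <-; elim: (findex F x y) => //= i <-.
by rewrite hF // FiS1.
Qed.

Lemma mem_A0s (x : V) : x \in S1 -> (orbit_of x \in A0s) = ~~ tw x.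
Proof.
move=> x1; rewrite inE imset_f // andbT; congr (~~ _).
apply/imsetP/idP => [[y /[!inE] /andP[y1 ty] /eqP]|tx].
  by rewrite orbit_of_eq fconnect_sym // => /(fconnect_invariant y1 twF) ->.
by exists x; rewrite ?inE ?x1.
Qed.

Let hat := ({ffun V -> int} * int)%type.
Definition hat_discr (a : hat) := discr a.1 a.2.
(** The quotient of all pairs by [hat_lift] is, up to multiplication by [sig], the cokernel of 1 - F
    on Z^S0 modulo [gram_lattice]: the contribution of T'. *)
Definition hat_lift (a : hat) := exists lam y, lifted lam y a.1.

Lemma hat_discr_subgroup : subgroup hat_discr.
Proof.
split=> [|a b da db].
  by apply: discr_ext discr0 => t _; rewrite ffunE.
by apply: discr_ext (discrB da db) => t _; rewrite !ffunE.
Qed.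

Lemma liftedB lam y x lam' y' x' : lifted lam y x -> lifted lam' y' x' ->
  lifted (fun s => lam s - lam' s) (fun s => y s - y' s) (fun s => x s - x' s).
Proof.
move=> xE xE' t tS; rewrite mulrBr xE // xE' //.
under [in RHS]eq_bigr do rewrite mulrBl.
by rewrite sumrB; ring.
Qed.

Lemma lifted0 x : (forall t, t \in S0 -> x t = 0) -> lifted (fun=> 0) (fun=> 0) x.
Proof. by move=> x0 t tS; rewrite x0 // mulr0 big1 ?subr0 // => s _; rewrite mul0r. Qed.

Lemma lifted_ext lam y x x' : (forall t, x t = x' t) -> lifted lam y x -> lifted lam y x'.
Proof. by move=> xx' xE t tS; rewrite -xx' xE. Qed.

Lemma hat_lift_subgroup : subgroup hat_lift.
Proof.
split=> [|a b [lam [y aE]] [mu [z bE]]].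
  by exists (fun=> 0), (fun=> 0); apply: lifted0 => t _; rewrite ffunE.
exists (fun s => lam s - mu s), (fun s => y s - z s).
by apply: lifted_ext (liftedB aE bE) => t; rewrite !ffunE.
Qed.

Lemma hat_discr_lift a : hat_discr a -> hat_lift a.
Proof.
move=> [mu [k [z [xE _]]]]; have [w wE] := S0_rest mu.
pose h t := if t \in S0 then k else 0.
have [t t0|h' h'E] := @cob_of_invariant h; first by rewrite /h FiS0 t0.
exists (fun s => sig s * mu s), (fun t => sig t * (w t + z t + h' t)) => t t0.
have hk := h'E t t0; rewrite /h t0 in hk.
by rewrite sig_sumB0 // xE ?S0S // wE // hk sigF //; ring.
Qed.

Lemma index_all_odd : (forall s, s \in S1 -> tw s) ->
  has_index hat_lift hat_discr (if odd #|S| then 1 else 2)%N.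
Proof.
move=> tw1; case: ifP => oS.
  exists unit, (fun=> tt); rewrite card_unit; split=> // [[]|a b Ma Mb].
    by exists 0 => //; case: hat_lift_subgroup.
  split=> // _; have [lam [y abE]] : hat_lift (a - b) by apply: hat_lift_subgroup.2.
  have [x1 [x10 _ dx1]] := discr_reduce abE.
  have dx := discr_all_odd_card tw1 ((a - b).2 - \sum_(s in S0) sig s * lam s) oS x10.
  have := discrD dx dx1; rewrite subrK; apply: discr_ext => t _; ring.
have {}oS := negbT oS.
pose par (a : hat) lam := oddz (a.2 + \sum_(s in S0) lam s + \sum_(s in S1) a.1 s).
have dP (a : hat) lam y : lifted lam y a.1 -> hat_discr a <-> par a lam = false.
  exact: discr_all_oddP.
exists bool, (fun a => ~~ `[< hat_discr a >]); rewrite card_bool; split=> //.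
  move=> b; exists (0, b%:Z).
    by exists (fun=> 0), (fun=> 0); apply: lifted0 => t _; rewrite ffunE.
  have l0 : lifted (fun=> 0) (fun=> 0) (0 : {ffun V -> int}).
    by apply: lifted0 => t _; rewrite ffunE.
  have := dP (0, b%:Z) _ _ l0; rewrite /par /= !big1 // => [|s _]; last by rewrite ffunE.
  rewrite !addr0; case: b => /= dE; last by rewrite asboolT //; exact/dE.
  by rewrite asboolF // => /dE.
move=> a b [lam [y aE]] [mu [z bE]].
have abE := lifted_ext (fun t => _) (liftedB aE bE).
have /dP -> : lifted (fun s => lam s - mu s) (fun s => y s - z s) (a - b).1.
  by apply: abE => t; rewrite !ffunE.
have -> : par (a - b) (fun s => lam s - mu s) = par a lam (+) par b mu.
  have eS1 : \sum_(s in S1) (a - b).1 s = \sum_(s in S1) a.1 s - \sum_(s in S1) b.1 s.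
    by rewrite -sumrB; apply: eq_bigr => s _; rewrite !ffunE.
  rewrite /par -[X in _ (+) X]oddzN -oddzD eS1 sumrB /=; congr oddz; ring.
have -> : `[< hat_discr a >] = ~~ par a lam.
  by apply/asboolP/idP => [/(dP _ _ _ aE)->|/negbTE/(dP _ _ _ aE)].
have -> : `[< hat_discr b >] = ~~ par b mu.
  by apply/asboolP/idP => [/(dP _ _ _ bE)->|/negbTE/(dP _ _ _ bE)].
by case: (par a lam); case: (par b mu).
Qed.

(** The orbit of e is the base point: the coordinates are the differences of average parities
    between each other orbit of [A0s] and this one. *)
Lemma index_some_even e : e \in S1 -> tw e = false ->
  has_index hat_lift hat_discr (2 ^ (#|A0s| - 1))%N.
Proof.
move=> e1 te; pose P (O : {set V}) := O \in A0s :\ orbit_of e.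
pose O' : finType := {O | P O}.
have repP (O : O') : exists t, t \in S1 /\ orbit_of t = val O.
  case: O => O /= /setD1P[_ /setDP[/imsetP[t t1 ->] _]].
  by exists t.
have /choice[rep {}repP] := repP.
have rep_tw O : tw (rep O) = false.
  have [r1 rE] := repP O; apply/negbTE; rewrite -mem_A0s // rE.
  by have := valP O; rewrite /P in_setD1 => /andP[].
pose g (a : hat) : {ffun O' -> bool} :=
  [ffun O => oddz (avg a.1 (rep O)) (+) oddz (avg a.1 e)].
have avgB (x y : {ffun V -> int}) t : avg (x - y) t = avg x t - avg y t.
  by rewrite /avg -sumrB; apply: eq_bigr => i _; rewrite !ffunE.
exists {ffun O' -> bool}, g; split.
- rewrite card_ffun card_bool; congr (2 ^ _)%N.
  rewrite card_sig /P; have := cardsD1 (orbit_of e) A0s.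
  rewrite mem_A0s // te /= => ->; rewrite addnC addnK.
  by apply: eq_card => O; rewrite !inE.
(* The witness is b on the orbits that index the coordinates and 0 elsewhere, in particular on the
   orbit of e. *)
- move=> b; pose x : {ffun V -> int} :=
    [ffun t => if (insub (orbit_of t) : option O') is Some Q then (b Q)%:Z else 0].
  have xF t : t \in S1 -> x (F t) = x t.
    move=> t1; rewrite !ffunE (_ : orbit_of (F t) = orbit_of t) //.
    by apply/eqP; rewrite eq_sym orbit_of_eq fconnect1.
  have avgx t : t \in S1 -> oddz (avg x t) = oddz (x t).
    move=> t1; rewrite /avg (eq_bigr (fun=> x t)) => [|i _].
      by rewrite sumr_const card_ord -mulr_natl oddzM natz (_ : oddz n).
    by elim: (i : nat) => //= j <-; rewrite xF // FiS1.
  exists ([ffun t => if t \in S1 then x t else 0], 0).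
    by exists (fun=> 0), (fun=> 0); apply: lifted0 => t t0; rewrite ffunE S01.
  apply/ffunP => O; rewrite ffunE /=; have [r1 rE] := repP O.
  have av t : t \in S1 -> oddz (avg [ffun t => if t \in S1 then x t else 0] t) = oddz (x t).
    move=> t1; rewrite -avgx //; apply: oddz_avg => // u u1; by rewrite ffunE u1.
  rewrite !av // !ffunE rE valK insubN ?addbF; first by case: (b O).
  by rewrite /P in_setD1 eqxx.
move=> a b Ma Mb; have [lam [y abE]] : hat_lift (a - b) by apply: hat_lift_subgroup.2.
split=> [gab|dab]; last first.
  apply/ffunP => O; rewrite !ffunE; have [r1 _] := repP O.
  have := discr_avg e1 te r1 (rep_tw O) dab; rewrite !avgB !oddzD !oddzN.
  by do 4!case: (oddz _).
have [x1 [x10 x11 dx1]] := discr_reduce abE.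
suff dx : discr x1 ((a - b).2 - \sum_(s in S0) sig s * lam s).
  have := discrD dx dx1; rewrite subrK; apply: discr_ext => t _; ring.
apply: (discr_some_even e1) => // t t1 tt; rewrite !(@oddz_avg x1 (a - b).1) //.
have avg_inv u v : u \in S1 -> fconnect F u v -> avg (a - b).1 v = avg (a - b).1 u.
  by move=> u1; apply: fconnect_invariant => // w w1; rewrite avgF.
have [te'|ne] := eqVneq (orbit_of t) (orbit_of e).
  by rewrite (@avg_inv t e) // -orbit_of_eq te'.
have PO : P (orbit_of t) by rewrite /P in_setD1 ne mem_A0s // tt.
pose O : O' := exist _ (orbit_of t) PO; have /ffunP/(_ O) := gab; rewrite !ffunE.
have [r1 rE] := repP O; rewrite (_ : avg _ t = avg (a - b).1 (rep O)); last first.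
  by rewrite (@avg_inv t (rep O)) // -orbit_of_eq rE.
rewrite !avgB !oddzD !oddzN.
by do 4!case: (oddz _).
Qed.

Lemma index_lift_discr : has_index hat_lift hat_discr twos.
Proof.
rewrite /twos; case: ifPn => [/card_gt0P[O]|A00].
  move=> OA; have := OA; rewrite inE => /andP[_ /imsetP[e e1 OE]].
  by apply: (@index_some_even e) => //; apply/negbTE; rewrite -mem_A0s // -OE.
apply: index_all_odd => s s1; apply/negPn; rewrite -mem_A0s //.
by apply: contra A00 => sA; apply/card_gt0P; exists (orbit_of s).
Qed.

Theorem comparison : exists2 m,
  has_index (fun x : {ffun V -> int} => gram_lattice S0 B0 (twist F 1 x)) (gram_lattice S0 B0) m
  & has_index (fun x : {ffun V -> int} => degree0_lattice S B (twist F (-1) x))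
      (degree0_lattice S B) (twos * m)%N.
Proof.
have [k0 fin0] := gram_lattice_finite B0pos.
have [m i0 c0] := index_preimage_cokernel (f := twist F 1)
  (gram_lattice_subgroup S0 B0) (gram_lattice_twist Finj FS0 B0F 1) fin0.
have [k1 fin1] := degree0_lattice_finite s0S Bpos.
have [m1 i1 c1] := index_preimage_cokernel (f := twist F (-1))
  (degree0_lattice_subgroup S B) (degree0_lattice_twist Finj FS BF (-1)) fin1.
exists m => //; suff -> : (twos * m)%N = m1 by [].
apply: nb_classes_uniq c1.
(* The pairs (x, j) and (x - j B(s0, -), 0) are congruent, so the extra degree coordinate does not
   change the quotient. *)
apply: (nb_classes_pullback (phi := fun x : {ffun V -> int} => (x, 0) : hat)
   (K' := fun=> True) (R' := fun a b => hat_discr (a - b))) => //.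
- move=> x y _ _; rewrite /hat_discr /= subrr; split.
    move=> [b [lam [k [l0 bE]]]]; exists lam, k, b; split=> // t tS.
    by have := bE t tS; rewrite !ffunE => H; rewrite -H; ring.
  move=> [lam [k [z [xE l0]]]]; exists [ffun t => z t], lam, k; split=> // t tS.
  by have := xE t tS; rewrite !ffunE => ->; ring.
- move=> [x j] _; exists [ffun t => x t - j * B s0 t] => //.
  have := discrM (- j) (discr_gen s0S); rewrite mulr1 -[X in discr _ X]sub0r.
  by apply: discr_ext => t _; rewrite !ffunE; ring.
rewrite mulnC; apply: (has_indexM (K := hat_lift)) => //.
- exact: hat_lift_subgroup.
- exact: hat_discr_subgroup.
- exact: hat_discr_lift.
- pose signed (a : hat) : {ffun V -> int} := [ffun t => sig t * a.1 t].
  apply: (nb_classes_pullback (phi := signed)) c0 => //.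
    move=> a b _ _; split.
      move=> [lam [y abE]]; exists [ffun t => y t], lam => t tS.
      by have := abE t tS; rewrite !ffunE => H; rewrite -mulrBr H; ring.
    move=> [y [lam abE]]; exists lam, y => t tS; have := abE t tS.
    rewrite !ffunE => <-; ring.
  move=> x _; exists ([ffun t => sig t * x t], 0) => //; exists 0, (fun=> 0) => t _.
  rewrite !ffunE mulrA sig2 big1 => [|s _]; last by rewrite mul0r.
  ring.
- exact: index_lift_discr.
Qed.

End Comparison.

(** * Rooted trees *)

Record rooted (G : lgraph) (r : vtx G) (par : vtx G -> vtx G) : Prop := Rooted {
  par_root : par r = r;
  par_reach : forall x, fconnect par x r;
  edgeE : forall x y, edge x y = ((x != r) && (y == par x)) || ((y != r) && (x == par y))
}.

Section RootedTree.
Variables (G : lgraph) (r : vtx G) (par : vtx G -> vtx G).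
Hypothesis rt : rooted r par.
Implicit Types (x y z s t a b : vtx G).

(** The ancestor is the second argument, and every vertex is its own ancestor. *)
Definition ancestor s x := fconnect par s x.
Local Notation anc := ancestor.

Lemma rooted_ind (P : vtx G -> Prop) :
  P r -> (forall x, x != r -> P (par x) -> P x) -> forall x, P x.
Proof.
move=> Pr Pp x; have /iter_findex := par_reach rt x.
move: (findex par x r) => i; elim: i x => [|i IH] x /=; first by move=> ->.
rewrite -iterS iterSr => e; have [->//|xr] := eqVneq x r.
by apply: Pp => //; exact: IH.
Qed.

Lemma anc_refl x : anc x x. Proof. exact: connect0. Qed.

Lemma anc_trans s x y : anc s x -> anc x y -> anc s y.
Proof. exact: connect_trans. Qed.

Lemma anc_par x : anc x (par x). Proof. exact: fconnect1. Qed.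

Lemma anc_root x : anc x r. Proof. exact: par_reach. Qed.

Lemma ancE s x : anc s x = (s == x) || anc (par s) x.
Proof.
apply/idP/orP => [/iter_findex|[/eqP->|]]; last first.
- by apply: connect_trans; exact: fconnect1.
- exact: connect0.
case: (findex par s x) => [|i] /=; first by move=> ->; left.
by rewrite -iterS iterSr => <-; right; exact: fconnect_iter.
Qed.

Lemma anc_rootE x : anc r x = (x == r).
Proof.
apply/idP/eqP => [/iter_findex <-|->]; last exact: anc_refl.
by elim: (findex par r x) => //= i ->; rewrite par_root.
Qed.

(** A cycle of [par] through x would return to x forever, whereas some number of steps leads to the
    root, which is never left. *)
Lemma anc_par_self x : x != r -> anc (par x) x = false.
Proof.
move=> xr; apply/negP => /iter_findex; set k := findex par _ _ => kx.
have kxn m : iter (m * k.+1) par x = x.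
  by rewrite iterM iter_fix // iterSr.
have /iter_findex := par_reach rt x; set j := findex par _ _ => jr.
have : iter (j * k.+1) par x = r.
  rewrite mulnS addnC iterD jr; elim: (j * k)%N => //= i ->; exact: par_root.
by rewrite kxn => e; rewrite e eqxx in xr.
Qed.

Lemma anc_antisym s x : anc s x -> anc x s -> s = x.
Proof.
rewrite ancE => /orP[/eqP//|psx xs]; have [sr|sr] := eqVneq s r.
  by move: psx; rewrite sr par_root // anc_rootE => /eqP.
by have := anc_trans psx xs; rewrite anc_par_self.
Qed.

Lemma anc_total s x y : anc s x -> anc s y -> anc x y || anc y x.
Proof.
move=> /iter_findex <- /iter_findex <-; move: (findex par s x) (findex par s y) => i j.
apply/orP; case: (leqP i j) => [le|/ltnW le]; [left|right].
  by rewrite -(subnK le) iterD; exact: fconnect_iter.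
by rewrite -(subnK le) iterD; exact: fconnect_iter.
Qed.

Lemma edge_par x : x != r -> edge x (par x).
Proof. by move=> xr; rewrite (edgeE rt) xr eqxx. Qed.

Lemma edge_par' x : x != r -> edge (par x) x.
Proof. by move=> xr; rewrite (edgeE rt) xr eqxx orbT. Qed.

Lemma anc_crossing a b x : edge a b -> x != r -> anc a x -> ~~ anc b x ->
  a = x /\ b = par x.
Proof.
move=> ab xr ax bx; move: ab; rewrite (edgeE rt) => /orP[|] /andP[ar /eqP e].
  by move: ax bx; rewrite ancE e => /orP[/eqP->|->].
by move: bx; rewrite ancE -e ax orbT.
Qed.

Lemma anc_child s z : z != s -> anc s z ->
  exists2 y, (y != r) && anc s y & par y = z.
Proof.
move=> zs /[dup] sz /iter_findex; case e : (findex par s z) => [|i] /= iz.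
  by rewrite iz eqxx in zs.
exists (iter i par s) => //; rewrite /ancestor fconnect_iter andbT.
(* If the predecessor of z were the root, z would be the root as well and would be reached one step
   before [findex] says. *)
apply/eqP => ir; have zr : z = r by rewrite -iz ir par_root.
have hi : (i < order par s)%N.
  by apply: leq_trans (findex_max sz); rewrite e.
have := findex_iter hi; rewrite ir -zr e; lia.
Qed.

Lemma child_uniq s x y : x != r -> y != r -> anc s x -> anc s y ->
  par x = par y -> x = y.
Proof.
move=> xr yr sx sy pxy; have /orP[] := anc_total sx sy; rewrite ancE => /orP[/eqP//|].
  by rewrite pxy anc_par_self.
by rewrite -pxy anc_par_self.
Qed.

(* For P = xpredT, the length of the common part of the paths from s and t to r. *)
Definition gromov (P : pred (vtx G)) s t : int :=
  \sum_(x | P x && (x != r)) (len x (par x))%:Z * ((anc s x)%:R * (anc t x)%:R).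

Lemma gromov_sym P s t : gromov P s t = gromov P t s.
Proof. by apply: eq_bigr => x _; rewrite [X in _ * X]mulrC. Qed.

End RootedTree.

(** * The Tamagawa number of a rooted tree *)

Section Homology.
Variables (T : by_data) (r : vtx T) (par : vtx T -> vtx T) (e : bool).
Hypothesis rt : rooted r par.
Hypothesis len_sym : forall x, x != r -> len (par x) x = len x (par x).
Hypothesis Finj : injective (@frob T).
Hypothesis Fedge : forall x y : vtx T, edge (frob x) (frob y) = edge x y.
Hypothesis FSV : forall x : vtx T, (frob x \in SV T) = (x \in SV T).
Hypothesis SE0 : forall x y : vtx T, SE x y = false.
Hypothesis neg_e : forall x y : vtx T, edge x y -> neg [set x; y] = e.
Variable s0 : vtx T.
Hypothesis s0S : s0 \in SV T.
Implicit Types (x y z s t : vtx T) (u v : lattice T).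
Local Notation anc := (ancestor par).
Local Notation B := (gromov r par xpredT).

Lemma lattice_cycle u : (u : chain T) \in @rel_cycle T.
Proof. by case: u. Qed.

Lemma lattice_anti u x y : lattice_val u (x, y) = - lattice_val u (y, x).
Proof. by have /and3P[/forallP/(_ x)/forallP/(_ y)/eqP] := lattice_cycle u. Qed.

Lemma lattice_edge u x y : lattice_val u (x, y) != 0 -> edge x y.
Proof.
have /and3P[_ /forallP/(_ x)/forallP/(_ y)/implyP H _] := lattice_cycle u.
by move=> /H/andP[].
Qed.

Definition bd (f : chain T) x : int := \sum_y f (x, y).

Lemma bd_off u x : x \notin SV T -> bd u x = 0.
Proof.
by have /and3P[_ _ /forallP/(_ x)/implyP H] := lattice_cycle u => /H/eqP.
Qed.

Lemma sum_bd (u : lattice T) (P : pred (vtx T)) (g : vtx T -> int) :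
  \sum_(x | P x) bd u x * g x = \sum_(x in SV T | P x) bd u x * g x.
Proof.
rewrite big_mkcond [RHS]big_mkcond; apply: eq_bigr => x _ /=.
by case xS : (x \in SV T) => //=; rewrite bd_off ?xS // mul0r; case: (P x).
Qed.

Lemma antisym_sum0 (P : pred (vtx T)) u :
  \sum_(x | P x) \sum_(y | P y) lattice_val u (x, y) = 0.
Proof.
set S := LHS; have : S = - S.
  rewrite {1}/S exchange_big -sumrN; apply: eq_bigr => x _.
  by rewrite -sumrN; apply: eq_bigr => y _; rewrite -lattice_anti.
lia.
Qed.

Lemma bd_degree0 u : \sum_(s in SV T) bd u s = 0.
Proof.
have := sum_bd u xpredT (fun=> 1).
under eq_bigr do rewrite mulr1; under [in RHS]eq_bigr do rewrite mulr1.
under [in RHS]eq_bigl do rewrite andbT.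
by move=> <-; exact: (antisym_sum0 xpredT u).
Qed.

(* Sum the boundary over the subtree above x: only the edge from x to its
   parent leaves it. *)
Lemma lattice_flow u x : x != r ->
  lattice_val u (x, par x) = \sum_(s in SV T) bd u s * (anc s x)%:R.
Proof.
move=> xr; transitivity (\sum_(z | anc z x) bd u z); last first.
  have := sum_bd u (anc^~ x) (fun=> 1).
  under eq_bigr do rewrite mulr1; move=> ->; rewrite big_mkcondr.
  by apply: eq_bigr => s _; case: (anc s x); rewrite ?mulr1 ?mulr0.
rewrite /bd; under eq_bigr => z _ do rewrite (bigID (anc^~ x)) /=.
rewrite big_split /= antisym_sum0 add0r (bigD1 x) ?anc_refl //=.
rewrite (bigD1 (par x)) ?(anc_par_self rt) //=.
rewrite [X in _ = _ + X]big1 => [|z /andP[zx zne]]; last first.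
  rewrite big1 // => y yx; apply/eqP/negPn/negP.
  move=> /lattice_edge/(anc_crossing rt)/(_ xr zx yx)[zE _].
  by rewrite zE eqxx in zne.
rewrite addr0 big1 ?addr0 // => y /andP[yx yne]; apply/eqP/negPn/negP.
move=> /lattice_edge/(anc_crossing rt)/(_ xr (anc_refl _ _) yx)[_ yE].
by rewrite yE eqxx in yne.
Qed.

Lemma lattice_bd_inj u v :
  (forall s, s \in SV T -> bd u s = bd v s) -> u = v.
Proof.
move=> uv; have uvp x : x != r -> lattice_val u (x, par x) = lattice_val v (x, par x).
  by move=> xr; rewrite !lattice_flow //; apply: eq_bigr => s /uv->.
apply/val_inj/ffunP => -[x y] /=.
case xy : (edge x y); last first.
  have H w : lattice_val w (x, y) = 0 by apply/eqP/negPn/negP => /(@lattice_edge w); rewrite xy.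
  by rewrite !H.
move: xy; rewrite (edgeE rt) => /orP[] /andP[zr /eqP ->]; first exact: uvp.
by rewrite lattice_anti uvp // -lattice_anti.
Qed.

(** The paths from each s to the root, taken with multiplicity lam s; their ends at the root cancel
    when lam has degree zero. *)
Definition flow_chain (lam : vtx T -> int) : chain T :=
  [ffun d => \sum_(s in SV T) lam s *
     (((d.1 != r) && (d.2 == par d.1) && anc s d.1)%:R
      - ((d.2 != r) && (d.1 == par d.2) && anc s d.2)%:R)].

Lemma bd_flow_chain lam z :
  bd (flow_chain lam) z =
  \sum_(s in SV T) lam s * ((s == z)%:R - (z == r)%:R).
Proof.
rewrite /bd; under eq_bigr do rewrite ffunE /=.
rewrite exchange_big; apply: eq_bigr => s _; rewrite -mulr_sumr; congr (_ * _).
rewrite sumrB.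
have -> : \sum_y ((z != r) && (y == par z) && anc s z)%:R = ((z != r) && anc s z)%:R :> int.
  rewrite (bigD1 (par z)) //= eqxx andbT big1 ?addr0 // => y /negbTE ->.
  by rewrite andbF.
(* The flow entering z from its children: one of them carries it exactly when z is a proper ancestor
   of s. *)
have -> : \sum_y ((y != r) && (z == par y) && anc s y)%:R = ((s != z) && anc s z)%:R :> int.
  case: (boolP ((s != z) && anc s z)) => [/andP[sz az]|naz].
    have [|y0 /andP[y0r sy0] py0] := anc_child rt _ az; first by rewrite eq_sym.
    rewrite (bigD1 y0) //= y0r py0 eqxx sy0 big1 ?addr0 // => y yy0.
    rewrite (_ : _ && _ = false) //; apply/negP => /andP[/andP[yr /eqP zp] sy].
    case/eqP: yy0; apply: (child_uniq rt yr y0r sy sy0); by rewrite -zp.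
  rewrite big1 // => y _; rewrite (_ : _ && _ = false) //.
  apply/negP => /andP[/andP[yr /eqP zp] sy]; case/negP: naz.
  rewrite zp (anc_trans sy (anc_par _ _)) andbT; apply/eqP => sp.
  by move: sy; rewrite sp (anc_par_self rt).
have [->|zr] := eqVneq z r; first by rewrite (anc_root rt); case: (s == r).
have [->|sz] := eqVneq s z; first by rewrite anc_refl.
by case: (anc s z).
Qed.

Lemma flow_chain_cycle lam : \sum_(s in SV T) lam s = 0 ->
  flow_chain lam \in @rel_cycle T.
Proof.
move=> l0; apply/and3P; split; apply/forallP => x.
- apply/forallP => y; rewrite !ffunE /= -sumrN; apply/eqP; apply: eq_bigr => s _.
  by rewrite -mulrN opprB.
- apply/forallP => y; apply/implyP; rewrite SE0 andbT (edgeE rt) !ffunE /=.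
  case: ((x != r) && _) => //=; case: ((y != r) && _) => //=.
  by rewrite big1 ?eqxx // => s _; rewrite subrr mulr0.
apply/implyP => xS; apply/eqP; rewrite -/(bd _ _) bd_flow_chain.
transitivity (\sum_(s in SV T) lam s * (- (x == r)%:R)); last by rewrite -mulr_suml l0 mul0r.
apply: eq_bigr => s sS; rewrite (_ : s == x = false) ?sub0r //.
by apply/eqP => sx; rewrite sx (negbTE xS) in sS.
Qed.

Lemma lattice_of_degree0 lam : \sum_(s in SV T) lam s = 0 ->
  exists u : lattice T, forall s, s \in SV T -> bd u s = lam s.
Proof.
move=> l0; exists (Lattice (flow_chain_cycle l0)) => s sS.
rewrite bd_flow_chain; under eq_bigr do rewrite mulrBr.
rewrite sumrB -mulr_suml l0 mul0r subr0 (bigD1 s) //= eqxx mulr1 big1 ?addr0 //.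
by move=> t /andP[_ /negbTE->]; rewrite mulr0.
Qed.

(** Orienting by rank and orienting from child to parent both select one of (x, y) and (y, x) for
    each edge, so twice either sum is the sum over all ordered pairs. *)
Lemma pairing_parents u v :
  pairing u v = \sum_(x | x != r)
    (len x (par x))%:Z * (lattice_val u (x, par x) * lattice_val v (x, par x)).
Proof.
pose h (d : vtx T * vtx T) := (len d.1 d.2)%:Z * lattice_val u d * lattice_val v d.
pose P (d : vtx T * vtx T) := (d.1 != r) && (d.2 == par d.1).
pose Q (d : vtx T * vtx T) := (d.2 != r) && (d.1 == par d.2).
have h0 d : ~~ edge d.1 d.2 -> h d = 0.
  case: d => x y /= nxy; rewrite /h (_ : lattice_val u _ = 0) ?mulr0 ?mul0r //.
  by apply/eqP/negPn; apply: contra nxy; exact: lattice_edge.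
have hsym x y : h (x, y) = h (y, x).
  case: (boolP (edge x y)) => [|nxy]; last first.
    by rewrite !h0 //; apply: contra nxy; rewrite /= !(edgeE rt) orbC.
  have lxy : edge x y -> len x y = len y x.
    by rewrite (edgeE rt) => /orP[] /andP[zr /eqP->]; rewrite len_sym.
  by move=> /lxy; rewrite /h /= (lattice_anti u) (lattice_anti v) => ->; ring.
have swap (R : pred (vtx T * vtx T)) : \sum_(d | R d) h d = \sum_(d | R (d.2, d.1)) h d.
  rewrite (reindex_inj (h := fun d : vtx T * vtx T => (d.2, d.1))) /=.
    by apply: eq_bigr => -[x y] _; rewrite hsym.
  by move=> [a b] [c d] /= [-> ->].
have PQ d : P d -> Q d = false.
  case: d => x y /andP[/= xr /eqP ->]; apply/negP => /andP[/= pr /eqP xE].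
  by have := anc_par_self rt xr; rewrite {2}xE anc_par.
have twoP : \sum_d h d = 2 * \sum_(d | P d) h d.
  rewrite (bigID P) /= -[X in _ = X](_ : \sum_(d | P d) h d + \sum_(d | Q d) h d = _).
    congr (_ + _); rewrite big_mkcond [RHS]big_mkcond; apply: eq_bigr => -[x y] _.
    case: (boolP (edge x y)) => [|nxy]; last by rewrite !h0 //; do 2!case: ifP.
    have := PQ (x, y); rewrite (edgeE rt) -/(P (x, y)) -/(Q (x, y)).
    case: (P (x, y)) => /=; first by move=> ->.
    by move=> _ ->.
  by rewrite [X in _ + X]swap mulr_natl mulr2n.
have two_lt : \sum_d h d = 2 * pairing u v.
  pose R (d : vtx T * vtx T) := (enum_rank d.1 < enum_rank d.2)%N.
  rewrite (bigID R) /= -[X in _ = X](_ : \sum_(d | R d) h d + \sum_(d | R (d.2, d.1)) h d = _).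
    congr (_ + _); rewrite big_mkcond [RHS]big_mkcond; apply: eq_bigr => -[x y] _.
    rewrite /R /=; case: ltngtP => //= exy.
    have -> : x = y by apply: enum_rank_inj; exact: val_inj.
    apply: h0; rewrite /= (edgeE rt) orbb; apply/negP => /andP[yr /eqP yE].
    by have := anc_par_self rt yr; rewrite -yE anc_refl.
  by rewrite -swap mulr_natl mulr2n.
apply: (@mulfI _ 2) => //; rewrite -two_lt twoP; congr (_ * _).
rewrite (reindex_onto (fun x => (x, par x)) (fun d => d.1)) /=; last first.
  by move=> [x y] /andP[_ /= /eqP->].
apply: eq_big => x; first by rewrite /P /= !eqxx !andbT.
by move=> _; rewrite /h /= mulrA.
Qed.

Lemma pairing_gromov u v :
  pairing u v = \sum_(s in SV T) \sum_(t in SV T) bd u s * bd v t * B s t.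
Proof.
rewrite pairing_parents; transitivity (\sum_(x | x != r) \sum_(s in SV T) \sum_(t in SV T)
   (len x (par x))%:Z * ((bd u s * (anc s x)%:R) * (bd v t * (anc t x)%:R))).
  apply: eq_bigr => x xr; rewrite !lattice_flow // big_distrlr mulr_sumr /=.
  by apply: eq_bigr => s _; rewrite mulr_sumr.
rewrite exchange_big; apply: eq_bigr => s _; rewrite exchange_big.
apply: eq_bigr => t _; rewrite mulr_sumr; apply: eq_bigr => x _; ring.
Qed.

(** The identification of the dual with Z^S / Z; x is determined by phi up to a constant on S. *)
Definition represents (phi : lattice T -> int) (x : {ffun vtx T -> int}) : Prop :=
  forall u, phi u = \sum_(s in SV T) x s * bd u s.

Lemma bdB u v s : bd (u - v) s = bd u s - bd v s.
Proof. by rewrite /bd -sumrB; apply: eq_bigr => y _; rewrite !ffunE. Qed.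

Definition bdl s u := bd u s.

Lemma bdl_is_zmod_morphism s : zmod_morphism (bdl s).
Proof. by move=> u v; exact: bdB. Qed.

HB.instance Definition _ s :=
  GRing.isZmodMorphism.Build (lattice T) int (bdl s) (bdl_is_zmod_morphism s).

Definition eval_bd (x : {ffun vtx T -> int}) u := \sum_(s in SV T) x s * bd u s.

Lemma eval_bd_is_zmod_morphism (x : {ffun vtx T -> int}) : zmod_morphism (eval_bd x).
Proof.
by move=> u v; rewrite -sumrB; apply: eq_bigr => s _; rewrite bdB mulrBr.
Qed.

HB.instance Definition _ (x : {ffun vtx T -> int}) :=
  GRing.isZmodMorphism.Build (lattice T) int (eval_bd x) (eval_bd_is_zmod_morphism x).

Lemma represents_surj (x : {ffun vtx T -> int}) :
  exists phi : dual_lattice T, represents phi x.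
Proof. by exists (eval_bd x). Qed.

Lemma delta_degree0 s : s \in SV T ->
  \sum_(t in SV T) ((t == s)%:R - (t == s0)%:R) = 0 :> int.
Proof.
have d1 (z : vtx T) : z \in SV T -> \sum_(t in SV T) (t == z)%:R = 1 :> int.
  by move=> zS; rewrite (bigD1 z) //= eqxx big1 ?addr0 // => t /andP[_ /negbTE->].
by move=> sS; rewrite sumrB !d1 // subrr.
Qed.

(** The classes [w s] with boundary s - s0 generate the lattice, so the values of phi on them serve
    as x. *)
Lemma represents_ex (phi : dual_lattice T) : exists x : {ffun vtx T -> int}, represents phi x.
Proof.
have /choice[w wE] : forall s, exists w : lattice T, s \in SV T ->
    forall t, t \in SV T -> bd w t = (t == s)%:R - (t == s0)%:R.
  move=> s; case: (boolP (s \in SV T)) => [sS|_]; last by exists 0.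
  by have [w ww] := lattice_of_degree0 (delta_degree0 sS); exists w.
exists [ffun s => phi (w s)] => u.
have {1}-> : u = \sum_(s in SV T) w s *~ bd u s.
  apply: lattice_bd_inj => t tS; rewrite -!/(bdl _ _) raddf_sum /=.
  rewrite (eq_bigr (fun s => bd u s * ((t == s)%:R - (t == s0)%:R))) => [|s sS].
    under eq_bigr do rewrite mulrBr.
    rewrite sumrB -mulr_suml bd_degree0 mul0r subr0 (bigD1 t) //= eqxx mulr1 big1 ?addr0 //.
    by move=> s /andP[_ /negbTE]; rewrite eq_sym => ->; rewrite mulr0.
  by rewrite raddfMz /= mulrzz mulrC /bdl wE.
rewrite raddf_sum; apply: eq_bigr => s sS.
by rewrite ffunE raddfMz mulrzz.
Qed.

Lemma eq_mod_latticeP phi psi (x y : {ffun vtx T -> int}) : represents phi x -> represents psi y ->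
  eq_mod_lattice phi psi <-> degree0_lattice (SV T) B (x - y).
Proof.
move=> phix psiy; have diffE v : phi v - psi v = \sum_(t in SV T) (x - y) t * bd v t.
  by rewrite phix psiy -sumrB; apply: eq_bigr => t _; rewrite !ffunE mulrBl.
have pairE u v : pairing u v = \sum_(t in SV T) (\sum_(s in SV T) bd u s * B s t) * bd v t.
  rewrite pairing_gromov exchange_big; apply: eq_bigr => t _ /=.
  by rewrite mulr_suml; apply: eq_bigr => s _; ring.
split=> [[u uE]|[lam [k [l0 xE]]]].
  (* [w] annihilates every boundary, in particular t - s0, and is therefore constant on S. *)
  pose w t := (x - y) t - \sum_(s in SV T) bd u s * B s t.
  have w0 v : \sum_(t in SV T) w t * bd v t = 0.
    under eq_bigr do rewrite mulrBl.
    by rewrite sumrB -pairE -diffE uE subrr.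
  exists (bd u), (w s0); split=> [|t tS]; first exact: bd_degree0.
  have [v vE] := lattice_of_degree0 (delta_degree0 tS).
  have := w0 v; under eq_bigr => z zS do rewrite vE // mulrBr.
  have d1 (z : vtx T) : z \in SV T -> \sum_(t in SV T) w t * (t == z)%:R = w z.
    move=> zS; rewrite (bigD1 z) //= eqxx mulr1 big1 ?addr0 //.
    by move=> a /andP[_ /negbTE->]; rewrite mulr0.
  by rewrite sumrB !d1 // => /eqP; rewrite subr_eq0 => /eqP <-; rewrite /w [RHS]addrC subrK.
have [u uE] := lattice_of_degree0 l0; exists u => v; rewrite diffE pairE.
rewrite (eq_bigr (fun t => (\sum_(s in SV T) bd u s * B s t) * bd v t + k * bd v t)) => [|t tS].
  by rewrite big_split /= -mulr_sumr bd_degree0 mulr0 addr0.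
rewrite xE // mulrDl; congr (_ * _ + _); apply: eq_bigr => s sS; by rewrite uE.
Qed.

(** [signedFE] asks for a BY forest; this version rests on the hypotheses of the section alone and
    so serves for T' as well. *)
Lemma signed_push_cycle u : signed_push u \in @rel_cycle T.
Proof.
have Fsurj (z : vtx T) : exists x, z = frob x.
  by exists (finv (@frob T) z); rewrite f_finv.
apply/and3P; split; apply/forallP => x'; have [x {x'}->] := Fsurj x'.
- apply/forallP => y'; have [y {y'}->] := Fsurj y'.
  by rewrite !signed_pushE // lattice_anti mulrN setUC.
- apply/forallP => y'; have [y {y'}->] := Fsurj y'.
  rewrite signed_pushE // SE0 andbT Fedge mulf_eq0 signr_eq0 /=.
  by apply/implyP; exact: lattice_edge.
apply/implyP; rewrite FSV => xS; rewrite (reindex_inj Finj) /=.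
rewrite (eq_bigr (fun y => (-1) ^+ e * lattice_val u (x, y))) => [|y _].
  by rewrite -mulr_sumr -/(bd u x) bd_off ?mulr0.
rewrite signed_pushE //; have [->|/lattice_edge xy] := eqVneq (lattice_val u (x, y)) 0.
  by rewrite !mulr0.
by rewrite neg_e.
Qed.

Lemma bd_signedF u x : bd (signedF u) (frob x) = (-1) ^+ e * bd u x.
Proof.
rewrite /bd mulr_sumr (reindex_inj Finj); apply: eq_bigr => y _ /=.
have -> : lattice_val (signedF u) = signed_push u.
  by rewrite -[LHS]/(val (signedF u)) val_insubd signed_push_cycle.
rewrite signed_pushE //; have [->|/lattice_edge xy] := eqVneq (lattice_val u (x, y)) 0.
  by rewrite !mulr0.
by rewrite neg_e.
Qed.

Lemma represents_signedF phi (x : {ffun vtx T -> int}) : represents phi x ->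
  represents (phi \o @signedF T) [ffun t => (-1) ^+ e * x (frob t)].
Proof.
move=> phix u; rewrite /= phix -(sum_comp Finj _ FSV).
by apply: eq_bigr => s _; rewrite bd_signedF ffunE; ring.
Qed.

End Homology.

(** * Tamagawa numbers as numbers of classes *)

Section TamagawaClasses.
Variable T : by_data.

Lemma pairingB (u v w : lattice T) :
  pairing (u - v : lattice T) w = pairing u w - pairing v w.
Proof. by rewrite /pairing -sumrB; apply: eq_bigr => d _; rewrite !ffunE; ring. Qed.

Lemma pairing0 (w : lattice T) : pairing (0 : lattice T) w = 0.
Proof. by rewrite -[0](subrr w) pairingB subrr. Qed.

Lemma eq_mod_lattice_refl phi : @eq_mod_lattice T phi phi.
Proof. by exists 0 => v; rewrite pairing0 subrr. Qed.

Lemma eq_mod_lattice_sym phi psi :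
  @eq_mod_lattice T phi psi -> eq_mod_lattice psi phi.
Proof.
move=> [u uE]; exists (0 - u) => v; by rewrite pairingB pairing0 -uE; ring.
Qed.

Lemma eq_mod_lattice_trans phi psi chi :
  @eq_mod_lattice T phi psi -> eq_mod_lattice psi chi -> eq_mod_lattice phi chi.
Proof.
move=> [u uE] [w wE]; exists (u - (0 - w)) => v.
by rewrite !pairingB pairing0 -uE -wE; ring.
Qed.

Lemma dual_coset_eq (phi psi : dual_lattice T) :
  dual_coset phi = dual_coset psi <-> eq_mod_lattice phi psi.
Proof.
split=> [e|e].
  have : dual_coset phi phi by exact: eq_mod_lattice_refl.
  by rewrite e.
apply/classical_sets.seteqP; split=> chi /= ch.
  exact: eq_mod_lattice_trans ch e.
exact: eq_mod_lattice_trans ch (eq_mod_lattice_sym e).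
Qed.

Lemma tamagawa_nb_classes n :
  nb_classes (@fixed_mod_lattice T) (fun phi psi => eq_mod_lattice phi psi) n ->
  tamagawa T = n.
Proof.
move=> [X [g [<- gs gP]]].
have /choice[rep repP] : forall x, exists phi, fixed_mod_lattice phi /\ g phi = x.
  by move=> x; have [phi ? ?] := gs x; exists phi.
rewrite /tamagawa.
have -> : [set dual_coset phi | phi in @fixed_mod_lattice T]%classic =
    [set` [fset dual_coset (rep x) | x in X]%fset]%classic.
  apply/classical_sets.seteqP; split=> [_ [phi fphi <-]|C] /=.
    apply/imfsetP; exists (g phi) => //=; apply/dual_coset_eq.
    by have [fr gr] := repP (g phi); apply/gP.
  by move=> /imfsetP[x /= _ ->]; exists (rep x) => //; exact: (repP x).1.
rewrite set_fsetK card_imfset /= ?cardE // => x y /dual_coset_eq/gP.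
by rewrite !(repP _).2; apply; exact: (repP _).1.
Qed.

End TamagawaClasses.

(** If x represents phi, then eps x o F represents phi o (eps F). So the fixed classes form the
    kernel of 1 - eps F on Z^S modulo [degree0_lattice]. *)
Lemma tamagawa_rooted (T : by_data) (r : vtx T) (par : vtx T -> vtx T) (e : bool)
    (s0 : vtx T) n :
    rooted r par -> (forall x, x != r -> len (par x) x = len x (par x)) ->
    injective (@frob T) ->
    (forall x y : vtx T, edge (frob x) (frob y) = edge x y) ->
    (forall x : vtx T, (frob x \in SV T) = (x \in SV T)) ->
    (forall x y : vtx T, SE x y = false) ->
    (forall x y : vtx T, edge x y -> neg [set x; y] = e) ->
    s0 \in SV T ->
    has_index (fun x : {ffun vtx T -> int} => degree0_lattice (SV T) (gromov r par xpredT)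
        (twist (@frob T) ((-1) ^+ e) x))
      (degree0_lattice (SV T) (gromov r par xpredT)) n ->
  tamagawa T = n.
Proof.
move=> rt len_sym Finj Fedge FSV SE0 neg_e s0S idx; apply: tamagawa_nb_classes.
have /choice[h hP] := represents_ex rt SE0 s0S.
have eqP := eq_mod_latticeP rt len_sym SE0 s0S.
have fixP (phi : dual_lattice T) (x : {ffun vtx T -> int}) : represents phi x ->
   fixed_mod_lattice phi <-> degree0_lattice (SV T) (gromov r par xpredT)
        (twist (@frob T) ((-1) ^+ e) x).
  move=> px; have pFx := represents_signedF Finj Fedge FSV SE0 neg_e px.
  have sub := degree0_lattice_subgroup (SV T) (gromov r par xpredT).
  rewrite /fixed_mod_lattice (eqP _ _ _ _ pFx px).
  have -> : twist (@frob T) ((-1) ^+ e) x = - ([ffun t => (-1) ^+ e * x (frob t)] - x).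
    by apply/ffunP => t; rewrite !ffunE; ring.
  by split=> [/(subgroupN sub)//|/(subgroupN sub)]; rewrite opprK.
apply: (nb_classes_pullback (phi := h)) idx => [phi|phi psi _ _|x fx].
- by rewrite (fixP _ _ (hP phi)).
- exact: eqP.
have [phi px] := represents_surj x; exists phi; first exact/(fixP _ _ px).
apply/(eqP _ _ _ _ (hP phi) px); exact: eq_mod_lattice_refl.
Qed.

(** * Forests *)

Section Forest.
Variable G : lgraph.
Hypothesis Gf : is_lforest G.
Hypothesis Gc : forall x y : vtx G, connect (@edge G) x y.
Implicit Types (x y z : vtx G) (p : seq (vtx G)).

Let edgeC : symmetric (@edge G). Proof. by case: Gf. Qed.
Let eirr : irreflexive (@edge G). Proof. by case: Gf. Qed.

(** A longer simple path would close up to a cycle with the edge from x to y. *)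
Lemma forest_simple_path x y p : edge x y -> path (@edge G) x p ->
  uniq (x :: p) -> last x p = y -> p = [:: y].
Proof.
move=> xy; case: p => [|z [|w p]] xp up lp.
- by rewrite -lp /= eirr in xy.
- by rewrite -lp.
have [_ _ cyc _ _] := Gf; case: (cyc (x :: z :: w :: p) isT).
by rewrite /ucycle up andbT /cycle rcons_path xp lp edgeC xy.
Qed.

Lemma simple_path_ex x y :
  exists p, [/\ path (@edge G) x p, uniq (x :: p) & last x p = y].
Proof. by have /connectP[q /shortenP[p xp up _] ->] := Gc x y; exists p. Qed.

Definition avoid x : rel (vtx G) := fun a b => [&& edge a b, a != x & b != x].

Lemma path_avoid x y p : path (@edge G) y p -> x \notin y :: p ->
  path (avoid x) y p.
Proof.
elim: p y => //= z p IH y /andP[yz zp]; rewrite !inE !negb_or => /and3P[xy xz xp].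
by rewrite /avoid yz ![_ == x]eq_sym xy xz IH // inE negb_or xz.
Qed.

Lemma avoid_uniq x y z : edge x y -> edge x z -> connect (avoid x) y z -> y = z.
Proof.
move=> xy xz /connectP[q /shortenP[p yp up _] zl].
have yp' : path (@edge G) y p by apply: sub_path yp => a b /and3P[].
have xp : x \notin y :: p.
  rewrite inE negb_or; apply/andP; split; first by apply: contraTN xy => /eqP->; rewrite eirr.
  elim: p {q up zl yp'} y yp {xy} => //= w p IH y /andP[/and3P[_ _ wx] wp].
  by rewrite inE negb_or eq_sym wx (IH w).
have uxp : uniq (x :: y :: p) by rewrite cons_uniq xp.
have xyp : path (@edge G) x (y :: p) by rewrite /= xy.
by have [] := forest_simple_path xz xyp uxp (esym zl).
Qed.

Variable r : vtx G.

(** The parent of x is the neighbour still connected to r after x is removed; in a tree the default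
    of [odflt] is not reached. *)
Definition par_to x :=
  if x == r then r else odflt r [pick y | edge x y && connect (avoid x) y r].

Lemma par_to_step x y p : path (@edge G) x (y :: p) -> uniq (x :: y :: p) ->
  last y p = r -> x != r /\ par_to x = y.
Proof.
move=> /= /andP[xy yp] /andP[xyp _] lr.
have xr : x != r.
  by apply: contraNN xyp => /eqP->; rewrite -lr mem_last.
have yr : connect (avoid x) y r.
  by apply/connectP; exists p => //; exact: path_avoid.
split=> //; rewrite /par_to (negbTE xr); case: pickP => [z /andP[xz zr]|/(_ y)] /=.
  apply: avoid_uniq xz xy _; apply: connect_trans zr _.
  rewrite (@sym_connect_sym _ (avoid x)) // => a b.
  by rewrite /avoid edgeC [_ && (b != x)]andbC.
by rewrite xy yr.
Qed.

Lemma forest_rooted : rooted r par_to.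
Proof.
split=> [|x|x y]; first by rewrite /par_to eqxx.
  have [p [xp up lp]] := simple_path_ex x r.
  elim: p x xp up lp => [|y p IH] x xp up lp; first by rewrite -lp; exact: connect0.
  have [xr pE] := par_to_step xp up lp.
  apply: connect_trans (fconnect1 _ _) _; rewrite pE.
  by move: xp up => /= /andP[_ yp] /andP[_ uy]; exact: IH.
have stepE z : z != r -> edge z (par_to z).
  move=> zr; have [[|w p] [zp up lp]] := simple_path_ex z r.
    by rewrite -lp eqxx in zr.
  by have [_ ->] := par_to_step zp up lp; move: zp => /andP[].
apply/idP/orP => [xy|[] /andP[zr /eqP->]]; last 2 first.
- exact: stepE.
- by rewrite edgeC; exact: stepE.
have [p [xp up lp]] := simple_path_ex x r.
have [yp|yp] := boolP (y \in p).
  left; case/splitPr: yp xp up lp => p1 p2 xp up lp.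
  have : rcons p1 y = [:: y].
    apply: forest_simple_path xy _ _ (last_rcons _ _ _).
      by move: xp; rewrite -cat_rcons cat_path => /andP[].
    by move: up; rewrite -cat_rcons -cat_cons cat_uniq => /andP[].
  case: p1 xp up lp => [|? []] // xp up lp _.
  by have [-> ->] := par_to_step xp up lp; rewrite eqxx.
right; have [|||-> ->] := @par_to_step y x p; last by rewrite eqxx.
- by rewrite /= edgeC xy.
- rewrite cons_uniq up inE negb_or yp !andbT.
  by apply: contraTN xy => /eqP->; rewrite eirr.
- exact: lp.
Qed.

End Forest.

(** * Automorphisms of rooted trees *)

Section RootedAutomorphism.
Variables (G : lgraph) (r : vtx G) (par : vtx G -> vtx G).
Hypothesis rt : rooted r par.
Hypothesis Finj : injective (@frob G).
Hypothesis Fedge : forall x y : vtx G, edge (frob x) (frob y) = edge x y.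
Implicit Types (x y z s t : vtx G).
Local Notation anc := (ancestor par).

(* Send a vertex x to the edge at x leading towards F x.  A tree has one more
   vertex than edges, so two vertices share their edge, which F inverts. *)
Lemma fixed_vertex_or_inverted_edge :
  (exists v : vtx G, frob v = v) \/ (exists2 x : vtx G, edge x (frob x) & frob (frob x) = x).
Proof.
have [/existsP[v /eqP vF]|nofix] := boolP [exists v : vtx G, frob v == v].
  by left; exists v.
right; have /choice[f fP] : forall x, exists z, z != r /\
   ((z = x /\ ~~ anc (frob x) x) \/ (par z = x /\ anc (frob x) z)).
  move=> x; have [xF|xF] := boolP (anc (frob x) x); last first.
    exists x; split; last by left.
    by apply: contra xF => /eqP->; exact: (anc_root rt).
  have [|z /andP[zr Fz] pz] := anc_child rt _ xF.
    by apply: contra nofix => /eqP e; apply/existsP; exists x; rewrite -e.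
  by exists z; split => //; right.
have /injectivePn[x [y xy fxy]] : ~~ injectiveb f.
  apply/negP => /injectiveP finj; have [g _ gK] := injF_bij finj.
  by have [] := fP (g r); rewrite gK eqxx.
wlog [fx fy] : x y xy fxy / (f x = x /\ ~~ anc (frob x) x) /\ (par (f y) = y /\ anc (frob y) (f y)).
  move=> H; have [_ [hx|hx]] := fP x; have [_ [hy|hy]] := fP y.
  - by move: xy; rewrite -hx.1 -hy.1 fxy eqxx.
  - exact: (H x y).
  - by apply: (H y x) => //; rewrite eq_sym.
  - by move: xy; rewrite -hx.1 -hy.1 fxy eqxx.
move: fx fy; rewrite -fxy => -[-> nx] [py Fy].
have xr : x != r by apply: contraNneq nx => ->; exact: (anc_root rt).
have e : edge (frob y) (frob x) by rewrite Fedge -py (edge_par' rt).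
have [e1 e2] := anc_crossing rt e xr Fy nx.
by exists x; rewrite e2 py ?e1 // -py (edge_par rt).
Qed.

Section FixedRoot.
Hypothesis Fr : frob r = r.

(** Induction from the root: if F (par x) were a child of F x, then F x = F (par (par x)), and x
    would be its own grandparent. *)
Lemma par_frob x : par (frob x) = frob (par x).
Proof.
elim/(rooted_ind rt): x => [|x xr IH]; first by rewrite (par_root rt) Fr (par_root rt).
have : edge (frob x) (frob (par x)) by rewrite Fedge (edge_par rt).
rewrite (edgeE rt) => /orP[/andP[_ /eqP->]//|/andP[pr /eqP]].
rewrite IH => /Finj e; have pr' : par x != r by apply: contra pr => /eqP->; rewrite Fr.
by have := anc_par_self rt xr; rewrite {2}e anc_par.
Qed.

Lemma anc_frob s x : anc (frob s) (frob x) = anc s x.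
Proof.
have H k z : iter k par (frob z) = frob (iter k par z).
  by elim: k => //= k ->; rewrite par_frob.
apply/idP/idP => /iter_findex; [move: (findex par (frob s) (frob x)) | move: (findex par s x)] => k.
  by rewrite H => /Finj <-; exact: fconnect_iter.
by move=> <-; rewrite -H; exact: fconnect_iter.
Qed.

Lemma anc_iter_frob i s x : anc (iter i (@frob G) s) (iter i (@frob G) x) = anc s x.
Proof. by elim: i => //= i <-; rewrite anc_frob. Qed.

Lemma frob_eq_root x : (frob x == r) = (x == r).
Proof. by rewrite -{1}Fr (inj_eq Finj). Qed.

Lemma gromov_frob (P : pred (vtx G)) s t :
    (forall x, P (frob x) = P x) ->
    (forall x, x != r -> len (frob x) (frob (par x)) = len x (par x)) ->
  gromov r par P (frob s) (frob t) = gromov r par P s t.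
Proof.
move=> PF lF; rewrite /gromov (reindex_inj Finj) /=; apply: eq_big => x.
  by rewrite PF frob_eq_root.
by move=> /andP[_]; rewrite frob_eq_root => xr; rewrite par_frob lF // !anc_frob.
Qed.

End FixedRoot.

End RootedAutomorphism.

(** * Depths, meeting points and parities of distances *)

Section Depth.
Variables (G : lgraph) (r : vtx G) (par : vtx G -> vtx G).
Hypothesis rt : rooted r par.
Implicit Types (x y z s t : vtx G) (p : seq (vtx G)).
Local Notation anc := (ancestor par).

Definition depth x : nat := (\sum_(y | (y != r) && anc x y) len y (par y))%N.

Lemma depth_root : depth r = 0%N.
Proof. by rewrite /depth big1 // => y /andP[yr]; rewrite (anc_rootE rt) (negbTE yr). Qed.

Lemma depth_par x : x != r -> depth x = (len x (par x) + depth (par x))%N.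
Proof.
move=> xr; rewrite /depth (bigD1 x) ?xr ?anc_refl //=; congr addn.
apply: eq_bigl => y; rewrite [anc x y]ancE [y == x]eq_sym.
by have [<-|] := eqVneq x y; rewrite ?andbT ?(anc_par_self rt) ?andbF.
Qed.

Lemma gromov_self s : gromov r par xpredT s s = (depth s)%:Z.
Proof.
rewrite /gromov /depth (big_morph Posz PoszD (erefl _)) /= big_mkcondr /=.
by apply: eq_bigr => x _; case: (anc s x); rewrite ?mulr1 ?mulr0.
Qed.

(** m is the first ancestor of s that is also one of t. Its children towards s and t differ, which
    makes m a branch vertex unless it is the root. *)
Lemma meet_ex s t : ~~ anc s t -> ~~ anc t s -> exists m y1 y2,
  [/\ [/\ y1 != y2, y1 != r & y2 != r], par y1 = m /\ par y2 = m,
      anc s y1 /\ anc t y2 & forall x, anc s x && anc t x = anc m x].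
Proof.
move=> st ts; have ex : exists i, anc t (iter i par s).
  by exists (findex par s r); rewrite iter_findex ?(par_reach rt) //; exact: (anc_root rt).
case: (ex_minnP ex) => -[|i] /= im imin; first by rewrite im in ts.
set m := par (iter i par s) in im *.
have nti : ~~ anc t (iter i par s) by apply/negP => /imin; rewrite ltnn.
have sm : anc s m by apply: (fconnect_iter par i.+1 s).
have [|y2 /andP[y2r ty2] py2] := anc_child rt _ im.
  by apply: contraNneq st => <-.
exists m, (iter i par s), y2; split=> //.
- split=> //; first by apply: contraNneq nti => ->.
  by apply: contraNneq nti => ->; exact: (anc_root rt).
- by split=> //; exact: fconnect_iter.
move=> x; apply/andP/idP => [[/iter_findex <-]|mx]; last first.
  by split; apply: anc_trans mx.
by move=> /imin le; rewrite -(subnK le) iterD; exact: fconnect_iter.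
Qed.

Lemma gromov_meet s t m : (forall x, anc s x && anc t x = anc m x) ->
  gromov r par xpredT s t = (depth m)%:Z.
Proof.
move=> H; rewrite -gromov_self; apply: eq_bigr => x _; rewrite -H.
by case: (anc s x); case: (anc t x).
Qed.

Lemma deg_ge2 x y : x != r -> y != r -> par y = x -> (1 < deg x)%N.
Proof.
move=> xr yr pyx; have py : par x != y.
  by apply/eqP => e; have := anc_par_self rt yr; rewrite pyx -e anc_par.
have <- : #|[set par x; y]| = 2%N by rewrite cards2 py.
apply/subset_leq_card/subsetP => z; rewrite !inE => /orP[] /eqP->.
  exact: (edge_par rt).
by rewrite -pyx (edge_par' rt).
Qed.

Lemma deg_ge3 x y1 y2 : x != r -> y1 != r -> y2 != r -> y1 != y2 ->
  par y1 = x -> par y2 = x -> (2 < deg x)%N.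
Proof.
move=> xr yr1 yr2 y12 py1 py2; have py y : y != r -> par y = x -> par x != y.
  by move=> yr pyx; apply/eqP => e; have := anc_par_self rt yr; rewrite pyx -e anc_par.
have <- : #|par x |: [set y1; y2]| = 3%N by rewrite cardsU1 cards2 y12 !inE negb_or !py.
apply/subset_leq_card/subsetP => z; rewrite !inE => /or3P[] /eqP->.
- exact: (edge_par rt).
- by rewrite -py1 (edge_par' rt).
- by rewrite -py2 (edge_par' rt).
Qed.

Lemma anc_leaf s t : (deg s <= 1)%N -> s != r -> anc t s -> t = s.
Proof.
move=> ds sr ts; apply/eqP/negPn/negP => ne.
have [|y /andP[yr _] py] := anc_child rt _ ts; first by rewrite eq_sym.
by have := deg_ge2 sr yr py; rewrite ltnNge ds.
Qed.

Hypothesis len_sym : forall x, x != r -> len (par x) x = len x (par x).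

(** Each edge changes the depth by plus or minus its length, and modulo 2 the sign is invisible. *)
Lemma odd_path_length x p : path (@edge G) x p ->
  odd (path_length x p) = odd (depth x) (+) odd (depth (last x p)).
Proof.
elim: p x => [|y p IH] x /=; first by rewrite addbb.
move=> /andP[xy /IH]; rewrite oddD => ->.
have : odd (len x y) = odd (depth x) (+) odd (depth y).
  move: xy; rewrite (edgeE rt) => /orP[] /andP[zr /eqP->].
    by rewrite [depth x]depth_par // oddD -addbA addbb addbF.
  by rewrite [depth y]depth_par // len_sym // oddD addbCA addbb addbF.
by move=> ->; rewrite -addbA addKb.
Qed.

Lemma dist_path x y : (exists p, [/\ path (@edge G) x p, uniq (x :: p) & last x p = y]) ->
  exists2 p, simple_path x y p & dist x y = path_length x p.
Proof.
move=> [p [xp up lp]]; have sz : (size p <= #|vtx G|)%N.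
  apply: leq_trans (max_card (mem (x :: p))).
  by rewrite (card_uniqP up) /= leqnSn.
rewrite /dist; case: pickP => [q qP|/(_ (Bseq sz))]; first by exists q.
by rewrite [X in X = false](_ : _ = true) // /simple_path; apply/and3P; split=> //; apply/eqP.
Qed.

Hypothesis Gc : forall x y : vtx G, connect (@edge G) x y.

Lemma odd_dist x y : odd (dist x y) = odd (depth x) (+) odd (depth y).
Proof.
have [p] := dist_path (simple_path_ex Gc x y).
by move=> /and3P[xp _ /eqP <-] ->; exact: odd_path_length.
Qed.

(** A simple path from the root cannot turn back, so each of its steps goes from a parent to a
    child. *)
Lemma root_path_length p x : path (@edge G) r (rcons p x) -> uniq (r :: rcons p x) ->
  [/\ x != r, par x = last r p & path_length r (rcons p x) = depth x].
Proof.
have catl y q z : path_length y (rcons q z) = (path_length y q + len (last y q) z)%N.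
  by elim: q y => /= [|a q IH] y; rewrite ?addn0 // IH addnA.
elim/last_ind: p x => [|p w IH] x.
  rewrite /= andbT inE andbT eq_sym => rx xr; move: rx; rewrite (edgeE rt) eqxx /= xr.
  move=> /eqP re; split=> //=.
  by rewrite depth_par // -re depth_root !addn0 {1}re len_sym // -re.
rewrite rcons_path last_rcons -rcons_cons rcons_uniq => /andP[rw wx] /andP[xn uw].
have [wr pw wl] := IH w rw uw.
have xr : x != r by apply: contraNneq xn => ->; rewrite mem_head.
move: wx; rewrite (edgeE rt) => /orP[/andP[_ /eqP xpw]|/andP[_ /eqP wE]].
  by case/negP: xn; rewrite xpw pw -cats1 -cat_cons mem_cat mem_last.
by split=> //; rewrite catl last_rcons wl [depth x]depth_par // -wE wE len_sym // addnC.
Qed.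

Lemma dist_root x : dist r x = depth x.
Proof.
have [p] := dist_path (simple_path_ex Gc r x).
case/lastP: p => [|p y] /and3P[rp up /eqP].
  by move=> /= <- ->; rewrite depth_root.
rewrite last_rcons => yx ->; rewrite yx in rp up *.
by have [] := root_path_length rp up.
Qed.

End Depth.

(** * Orbits of odd and of even size *)

Section OrderParity.
Variables (V : finType) (F : V -> V).
Hypothesis Finj : injective F.

Lemma odd_orderP x : reflect (exists2 k, odd k & iter k F x = x) (odd (order F x)).
Proof.
apply: (iffP idP) => [od|[k ok kx]]; first by exists (order F x) => //; exact: iter_order.
suff /dvdnP[q kE] : (order F x %| k)%N by move: ok; rewrite kE oddM => /andP[].
rewrite /dvdn; set j := (k %% order F x)%N.
have jlt : (j < order F x)%N by rewrite ltn_mod order_gt0.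
have : iter j F x = x.
  rewrite -[RHS]kx (divn_eq k (order F x)) addnC iterD -/j; congr (iter _ _ _).
  by rewrite iterM iter_fix // iter_order.
by move=> /(congr1 (findex F x)); rewrite findex_iter // findex0 => ->.
Qed.

Lemma odd_order_frob x : odd (order F (F x)) = odd (order F x).
Proof.
apply/odd_orderP/odd_orderP => -[k ok kx]; exists k => //.
  by apply: Finj; rewrite -iterS iterSr.
by rewrite -iterSr /= kx.
Qed.

Lemma odd_order_iter i x : odd (order F (iter i F x)) = odd (order F x).
Proof. by elim: i => //= i <-; exact: odd_order_frob. Qed.

(** An odd exponent that trivialises all orbits of odd size at once. *)
Definition odd_period : nat := \prod_(x | odd (order F x)) order F x.

Lemma odd_odd_period : odd odd_period.
Proof.
rewrite /odd_period; elim/big_rec: _ => // x n ox on; by rewrite oddM ox.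
Qed.

Lemma iter_odd_period x : odd (order F x) -> iter odd_period F x = x.
Proof.
move=> ox; rewrite /odd_period (bigD1 x) //= mulnC iterM iter_fix //.
exact: iter_order.
Qed.

(** Colours an orbit alternately, starting from its canonical element; this is consistent around the
    orbit when its size is even. *)
Definition alternating x : bool := odd (findex F (froot F x) x).

Lemma alternating_frob x : ~~ odd (order F x) -> alternating (F x) = ~~ alternating x.
Proof.
have sym := fconnect_sym Finj; move=> ex; rewrite /alternating.
have -> : froot F (F x) = froot F x.
  by apply/eqP; rewrite eq_sym (root_connect sym) fconnect1.
set z := froot F x; have zx : fconnect F z x by rewrite sym connect_root.
have xE := iter_findex zx; set i := findex F z x in xE *.
have ilt : (i < order F z)%N by apply: findex_max.
have ez : ~~ odd (order F z) by rewrite -(odd_order_iter i) xE.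
have -> : F x = iter i.+1 F z by rewrite /= xE.
have [lt|ge] := ltnP i.+1 (order F z); first by rewrite findex_iter.
(* At the wrap-around the position drops from the odd number [order F z - 1] to 0. *)
have e : i.+1 = order F z by apply/eqP; rewrite eqn_leq ilt.
by rewrite e iter_order // findex0 /=; move: ez; rewrite -e /= negbK => ->.
Qed.

End OrderParity.

(** * Contraction *)

Section EvenNodes.
Variables (G : lgraph) (r : vtx G) (par : vtx G -> vtx G).
Hypothesis rt : rooted r par.
Hypothesis Gaut : frob_automorphism G.
Hypothesis Fr : frob r = r.
Implicit Types (x y z s t : vtx G).
Local Notation anc := (ancestor par).
Local Notation F := (@frob G).

Let Finj : injective F. Proof. by case: Gaut. Qed.
Let Fedge x y : edge (F x) (F y) = edge x y. Proof. by case: Gaut. Qed.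

Definition evn x : bool := ~~ odd (order F x).

Lemma evn_frob x : evn (F x) = evn x.
Proof. by rewrite /evn odd_order_frob. Qed.

Lemma evn_root : evn r = false.
Proof. by apply/negbF/odd_orderP => //; exists 1%N. Qed.

(** If an odd power F^k fixes s, then x and F^k x are both ancestors of s, hence comparable, and
    following the comparison around the orbit of x gives F^k x = x. So the vertices in odd orbits
    form a subtree containing the root, on which the even branches are planted. *)
Lemma anc_evn s x : anc s x -> evn x -> evn s.
Proof.
move=> sx; apply: contra => /(odd_orderP Finj)[k ok ks].
apply/(odd_orderP Finj); exists k => //.
have skx : anc s (iter k F x).
  by rewrite -[s in X in anc X _]ks (anc_iter_frob rt Finj Fedge Fr).
have per : iter (order F x * k) F x = x by rewrite mulnC iterM iter_fix // iter_order.
have [a aE] : exists a, order F x = a.+1 by exists (order F x).-1; rewrite prednK ?order_gt0.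
have uS m : iter (m.+1 * k) F x = iter (m * k) F (iter k F x).
  by rewrite mulSn addnC iterD.
have u1 : iter (1 * k) F x = iter k F x by rewrite mul1n.
have /orP[xk|kx] := anc_total sx skx.
  have H m : anc (iter k F x) (iter (m.+1 * k) F x).
    elim: m => [|m IH]; first by rewrite u1 anc_refl.
    apply: anc_trans IH _; rewrite [iter (m.+2 * k) F x]uS.
    by rewrite (anc_iter_frob rt Finj Fedge Fr).
  by apply: (anc_antisym rt _ xk); have := H a; rewrite -aE per.
have H m : anc (iter (m.+1 * k) F x) (iter k F x).
  elim: m => [|m IH]; first by rewrite u1 anc_refl.
  apply: anc_trans IH; rewrite [iter (m.+2 * k) F x]uS.
  by rewrite (anc_iter_frob rt Finj Fedge Fr).
by apply: (anc_antisym rt kx); have := H a; rewrite -aE per.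
Qed.

(* The root of the branch that contains x. *)
Definition top x := odflt x [pick y | [&& anc x y, evn y & ~~ evn (par y)]].

Lemma topP x : evn x -> [/\ anc x (top x), evn (top x) & evn (par (top x)) = false].
Proof.
move=> ex; rewrite /top; case: pickP => [y /and3P[? ? /negbTE]|none] //=.
exfalso; elim/(rooted_ind rt): x ex none => [|x xr IH] ex none.
  by rewrite evn_root in ex.
have [px|px] := boolP (evn (par x)); last by have := none x; rewrite anc_refl ex px.
apply: (IH px) => y; have := none y; case pxy : (anc (par x) y) => //=.
by rewrite (anc_trans (anc_par _ _) pxy).
Qed.

Lemma top_uniq s y z : anc s y -> anc s z -> evn y -> evn z ->
  evn (par y) = false -> evn (par z) = false -> y = z.
Proof.
move=> sy sz ey ez py pz.
by have /orP[] := anc_total sy sz; rewrite ancE => /orP[/eqP//|/anc_evn];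
  [move=> /(_ ez) | move=> /(_ ey)]; rewrite ?py ?pz.
Qed.

Lemma top_anc s x : anc s x -> evn x -> top s = top x.
Proof.
move=> sx ex; have es := anc_evn sx ex.
have [s1 s2 s3] := topP es; have [x1 x2 x3] := topP ex.
by apply: (@top_uniq s) => //; exact: anc_trans x1.
Qed.

Lemma top_frob x : evn x -> top (F x) = F (top x).
Proof.
move=> ex; have [x1 x2 x3] := topP ex.
have [|y1 y2 y3] := @topP (F x); first by rewrite evn_frob.
apply: (@top_uniq (F x)) => //; rewrite ?evn_frob //.
  by rewrite (anc_frob rt Finj Fedge Fr).
by rewrite (par_frob rt Finj Fedge Fr) evn_frob.
Qed.

Definition branch_sign x : bool := alternating F (top x).

Lemma branch_sign_frob x : evn x -> branch_sign (F x) = ~~ branch_sign x.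
Proof.
move=> ex; rewrite /branch_sign top_frob // alternating_frob //.
by have [] := topP ex.
Qed.

(** A non-zero value requires a common ancestor in an even orbit, so s and t lie on one branch. *)
Lemma gromov_evn_sign s t : gromov r par evn s t != 0 -> branch_sign s = branch_sign t.
Proof.
move=> nz; have [/existsP[x /and3P[ex sx tx]]|none] :=
  boolP [exists x, [&& evn x, anc s x & anc t x]].
  by rewrite /branch_sign !(@top_anc _ x).
case/eqP: nz; apply: big1 => x /andP[ex _].
have : ~~ [&& evn x, anc s x & anc t x] by apply: contra none => h; apply/existsP; exists x.
by rewrite ex /=; case: (anc s x); case: (anc t x) => //= _; rewrite ?(mulr0, mul0r).
Qed.

Lemma gromov_split s t : gromov r par xpredT s t - gromov r par evn s t =
  gromov r par (predC evn) s t.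
Proof.
rewrite /gromov (bigID evn) /=.
rewrite (eq_bigl (fun x => evn x && (x != r))) => [|x]; last by rewrite andbC.
rewrite [X in X - _]addrC addrK; apply: eq_bigl => x; by rewrite andbC.
Qed.

(** The sum runs over vertices in odd orbits, and the odd power fixes each of them. *)
Lemma gromov_odd_iter s t :
  gromov r par (predC evn) s (iter (odd_period F) F t) = gromov r par (predC evn) s t.
Proof.
apply: eq_bigr => x /andP[/negbNE ox _].
have {1}<- : anc (iter (odd_period F) F t) (iter (odd_period F) F x) =
    anc (iter (odd_period F) F t) x.
  by rewrite (iter_odd_period Finj ox).
by rewrite (anc_iter_frob rt Finj Fedge Fr).
Qed.

Lemma edge_setC x y : edge x y = edge y x.
Proof. by rewrite !(edgeE rt) orbC. Qed.

(** Because F fixes the root, no iterate exchanges x with its parent: an iterate that fixes the edge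
    fixes x. *)
Lemma odd_edge_par x : x != r -> odd_edge x (par x) = ~~ evn x.
Proof.
move=> xr; rewrite /odd_edge (edge_par rt) //= /evn negbK.
pose f (m : {set vtx G}) := F @: m; have finj : injective f by exact: imset_inj.
have fE k y z : iter k f [set y; z] = [set iter k F y; iter k F z].
  by elim: k => //= k ->; rewrite /f imsetU1 imset_set1.
have parF k : iter k F (par x) = par (iter k F x).
  by elim: k => //= k ->; rewrite (par_frob rt Finj Fedge Fr).
apply/(odd_orderP finj)/(odd_orderP Finj) => -[k ok kx]; exists k => //; last first.
  by rewrite fE parF kx.
move: kx; rewrite fE parF => /setP e.
have xrk : iter k F x != r by elim: k {ok e} => //= k IH; rewrite (frob_eq_root Finj Fr).
have := e (iter k F x); rewrite !inE eqxx /= => /esym/orP[/eqP//|/eqP kx].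
have := e x; rewrite !inE eqxx /= => /orP[/eqP//|/eqP xk].
by have := anc_par_self rt xr; rewrite -kx {2}xk anc_par.
Qed.

Lemma odd_edgeC x y : odd_edge x y = odd_edge y x.
Proof. by rewrite /odd_edge edge_setC finset.setUC. Qed.

Lemma odd_edge_odd x y : odd_edge x y -> evn x = false /\ evn y = false.
Proof.
wlog : x y / (x != r) && (y == par x) => [H xy|/andP[xr /eqP->]].
  have /andP[] := xy; rewrite (edgeE rt) => /orP[h|h] _; first exact: H.
  by move: xy; rewrite odd_edgeC => /(H _ _ h)[].
rewrite odd_edge_par // => ox; split; first exact: negbTE.
by apply: contraNF ox => /(anc_evn (anc_par _ _)).
Qed.

Lemma connect_odd_edge x : ~~ evn x -> connect (@odd_edge G) x r.
Proof.
elim/(rooted_ind rt): x => [|x xr IH] ox; first exact: connect0.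
apply: connect_trans (connect1 _) (IH _); first by rewrite odd_edge_par.
by apply: contra ox => /(anc_evn (anc_par _ _)).
Qed.

(** Contracted edges join every vertex in an odd orbit to the root and meet no vertex in an even
    orbit, so the contraction collapses a single subtree. *)
Lemma mem_class_of x y : (y \in class_of x) = if evn x then y == x else ~~ evn y.
Proof.
rewrite inE; case: ifP => ex.
  apply/idP/eqP => [/connectP[[|z p] /= xp ->//]|->]; last exact: connect0.
  by move: xp => /andP[/odd_edge_odd[]]; rewrite ex.
apply/idP/idP => [/connectP[p xp ->]|oy].
  by elim: p x ex xp => /= [x ->//|z p IH x ex /andP[/odd_edge_odd[_ ez] zp]]; exact: IH.
apply: connect_trans (connect_odd_edge (negbT ex)) _.
by rewrite (@sym_connect_sym _ (@odd_edge G)) ?connect_odd_edge // => a b; exact: odd_edgeC.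
Qed.

(** * The contracted tree as a rooted tree *)

Local Notation G' := (contract G).
Local Notation F' := (@frob G').

Lemma class_of_in x : class_of x \in [set class_of x | x : vtx G].
Proof. by apply/imsetP; exists x. Qed.

Implicit Types B C : vtx G'.

Definition cls x : vtx G' := exist _ (class_of x) (class_of_in x).

Lemma clsP (B : vtx G') : exists x, B = cls x.
Proof.
case: B => B BP; have /imsetP[x _ BE] := BP; exists x.
by apply: val_inj; rewrite /= BE.
Qed.

Lemma mem_cls x y : (y \in val (cls x : con_vtx G)) = if evn x then y == x else ~~ evn y.
Proof. exact: mem_class_of. Qed.

Lemma cls_eq x y : (cls x == cls y) = if evn x then y == x else ~~ evn y.
Proof.
rewrite -mem_cls; apply/eqP/idP => [->|].
  by rewrite mem_cls eqxx; case: (evn y).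
rewrite mem_cls; case: ifPn => [_ /eqP->//|ox oy].
apply/val_inj/setP => z; have := mem_cls x z; have := mem_cls y z => /= -> ->.
by rewrite (negbTE ox) (negbTE oy).
Qed.

Lemma cls_root x : (cls x == cls r) = ~~ evn x.
Proof. by rewrite eq_sym cls_eq evn_root. Qed.

Lemma cls_inj_evn x y : evn x -> cls x = cls y -> x = y.
Proof. by move=> ex /eqP; rewrite cls_eq ex => /eqP. Qed.

Lemma mem_clsE x B : (x \in val (B : con_vtx G)) = (B == cls x).
Proof. by have [y ->] := clsP B; rewrite cls_eq mem_cls. Qed.

Definition rep (B : vtx G') : vtx G := odflt r [pick x in val (B : con_vtx G)].

Lemma repK B : cls (rep B) = B.
Proof.
rewrite /rep; case: pickP => [x|none] /=; first by rewrite mem_clsE => /eqP.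
by have [x BE] := clsP B; have := none x; rewrite mem_clsE BE eqxx.
Qed.

Lemma rep_cls x : evn x -> rep (cls x) = x.
Proof. by move=> ex; apply/esym/cls_inj_evn; rewrite ?repK. Qed.

(** The class of the root has only an arbitrary representative, so it is treated apart; all other
    classes are singletons. *)
Definition con_par (B : vtx G') : vtx G' :=
  if B == cls r then B else cls (par (rep B)).

Lemma con_par_cls x : evn x -> con_par (cls x) = cls (par x).
Proof. by move=> ex; rewrite /con_par cls_root ex /= rep_cls. Qed.

Lemma evn_nonroot x : evn x -> x != r.
Proof. by apply: contraTneq => ->; rewrite evn_root. Qed.

Lemma cls_par_neq x : evn x -> cls x != cls (par x).
Proof.
move=> ex; rewrite cls_eq ex; apply/eqP => px.
by have := anc_par_self rt (evn_nonroot ex); rewrite {1}px anc_refl.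
Qed.

Lemma con_edgeP B C :
  con_edge B C = [exists x, exists y, [&& edge x y, cls x == B, cls y == C & B != C]].
Proof.
apply/andP/existsP => [[BC /existsP[x /andP[xB /existsP[y /andP[yC xy]]]]]|].
  exists x; apply/existsP; exists y.
  by move: xB yC; rewrite !mem_clsE xy BC => /eqP<- /eqP<-; rewrite !eqxx.
move=> [x /existsP[y /and4P[xy /eqP xB /eqP yC BC]]]; split=> //.
apply/existsP; exists x; rewrite mem_clsE -xB eqxx /=; apply/existsP; exists y.
by rewrite mem_clsE -yC eqxx.
Qed.

Lemma contract_rooted : rooted (cls r) con_par.
Proof.
have con_edgeC B C : con_edge B C = con_edge C B.
  rewrite !con_edgeP; apply/existsP/existsP => -[x /existsP[y /and4P[a b c d]]];
    by exists y; apply/existsP; exists x; rewrite edge_setC a b c eq_sym d.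
split=> [|B|B C]; first by rewrite /con_par eqxx.
  have [x ->] := clsP B; elim/(rooted_ind rt): x => [|x xr IH]; first exact: connect0.
  have [ex|ox] := boolP (evn x).
    by apply: connect_trans (fconnect1 _ _) _; rewrite con_par_cls.
  by rewrite (_ : cls x = cls r) ?connect0 //; apply/eqP; rewrite cls_root.
have down D : D != cls r -> con_edge D (con_par D).
  have [x ->] := clsP D; rewrite cls_root negbK => ex.
  rewrite con_edgeP; apply/existsP; exists x; apply/existsP; exists (par x).
  by rewrite con_par_cls // !eqxx cls_par_neq // (edge_par rt) // evn_nonroot.
apply/idP/orP => [|[] /andP[Dr /eqP->]]; last 2 first.
- exact: down.
- by rewrite [edge _ _]con_edgeC; exact: down.
have up x : x != r -> cls x != cls (par x) ->
    (cls x != cls r) && (cls (par x) == con_par (cls x)).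
  move=> xr; rewrite cls_root negbK; case ex : (evn x); first by rewrite con_par_cls // eqxx.
  by rewrite cls_eq ex; case epx : (evn (par x)) => //; rewrite (anc_evn (anc_par par x) epx) in ex.
rewrite [edge _ _]con_edgeP => /existsP[x /existsP[y /and4P[xy /eqP <- /eqP <-]]].
move: xy; rewrite (edgeE rt) => /orP[] /andP[zr /eqP->] neq; [left|right].
  exact: up.
by apply: up => //; rewrite eq_sym.
Qed.

Lemma con_frob_cls x : F' (cls x) = cls (F x).
Proof.
apply: val_inj; rewrite con_frobE //; apply/setP => y.
have [z ->] : exists z, y = F z by exists (finv F y); rewrite f_finv.
rewrite mem_imset // !mem_cls evn_frob (inj_eq Finj) evn_frob //.
Qed.

Lemma con_frob_inj : injective F'.
Proof.
move=> B C; have [x ->] := clsP B; have [y ->] := clsP C.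
move=> /eqP; rewrite !con_frob_cls cls_eq !evn_frob (inj_eq Finj) => h.
by apply/eqP; rewrite cls_eq.
Qed.

Lemma con_frob_root : F' (cls r) = cls r.
Proof. by rewrite con_frob_cls Fr. Qed.

Lemma con_frob_par B : con_par (F' B) = F' (con_par B).
Proof.
have [x ->] := clsP B; case ex : (evn x).
  by rewrite con_frob_cls !con_par_cls ?evn_frob // con_frob_cls (par_frob rt Finj Fedge Fr).
have -> : cls x = cls r by apply/eqP; rewrite cls_root ex.
by rewrite con_frob_root (par_root contract_rooted) con_frob_root.
Qed.

Lemma con_frob_edge (B C : vtx G') : edge (F' B) (F' C) = edge B C.
Proof.
have Fr' D : (F' D == cls r) = (D == cls r).
  by rewrite -{1}con_frob_root (inj_eq con_frob_inj).
by rewrite !(edgeE contract_rooted) !con_frob_par !Fr' !(inj_eq con_frob_inj).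
Qed.

Lemma con_frob_fixed B : (F' B == B) = (B == cls r).
Proof.
have [x ->] := clsP B; rewrite con_frob_cls cls_root cls_eq evn_frob.
case: ifPn => // ex; apply/eqP; move=> e; case/negP: ex.
by apply/odd_orderP => //; exists 1%N.
Qed.

Lemma con_anc s x : evn x -> anc s x = fconnect con_par (cls s) (cls x).
Proof.
move=> ex; elim/(rooted_ind rt): s => [|s sr IH].
  rewrite (anc_rootE rt) -/(ancestor _ _ _) (anc_rootE contract_rooted) cls_root ex.
  exact/negbTE/evn_nonroot.
case es : (evn s).
  rewrite ancE -/(ancestor _ _ _) [RHS]ancE con_par_cls // IH cls_eq es [x == s]eq_sym //.
have -> : cls s = cls r by apply/eqP; rewrite cls_root es.
rewrite -/(ancestor _ _ _) (anc_rootE contract_rooted) cls_root ex /=.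
by apply/negP => /anc_evn /(_ ex); rewrite es.
Qed.

(** The double sum has one term: a neighbour of x other than its parent is a child of x, hence in an
    even orbit and a class by itself. *)
Lemma con_len_par x : evn x -> con_len (cls x) (cls (par x)) = len x (par x).
Proof.
move=> ex; have xr := evn_nonroot ex.
rewrite /con_len (big_pred1 x) => [|y]; last by rewrite mem_cls ex.
apply: big_pred1 => y; rewrite mem_cls /=.
apply/andP/eqP => [[yp xy]|->]; last first.
  by rewrite (edge_par rt) //; split=> //; rewrite eqxx; case: (evn _).
move: xy; rewrite (edgeE rt) => /orP[/andP[_ /eqP//]|/andP[yr /eqP xE]].
have ey : evn y by apply: anc_evn ex; rewrite xE anc_par.
by move: yp; case: ifP => [_ /eqP//|_]; rewrite ey.
Qed.

Lemma con_len_sym B : (forall x, x != r -> len (par x) x = len x (par x)) ->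
  B != cls r -> len (con_par B) B = len B (con_par B).
Proof.
move=> len_sym; have [x ->] := clsP B; rewrite cls_root negbK => ex.
rewrite con_par_cls // -[RHS]/(con_len _ _) con_len_par // -len_sym ?evn_nonroot //.
have xr := evn_nonroot ex.
transitivity (\sum_(y in val (cls (par x) : con_vtx G) | edge y x) len y x)%N.
  rewrite [RHS]big_mkcondr; apply: eq_bigr => y _.
  rewrite big_mkcondr /= (big_pred1 x) // => z; by rewrite mem_cls ex.
apply: big_pred1 => y; rewrite mem_cls /= edge_setC.
apply/andP/eqP => [[yp xy]|->]; last first.
  by rewrite (edge_par rt) //; split=> //; rewrite eqxx; case: (evn _).
move: xy; rewrite (edgeE rt) => /orP[/andP[_ /eqP//]|/andP[yr /eqP xE]].
have ey : evn y by apply: anc_evn ex; rewrite xE anc_par.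
by move: yp; case: ifP => [_ /eqP//|_]; rewrite ey.
Qed.

Lemma con_gromov s t :
  gromov (cls r) con_par xpredT (cls s) (cls t) = gromov r par evn s t.
Proof.
rewrite /gromov (reindex_onto cls rep) /= => [|B _]; last exact: repK.
apply: eq_big => x.
  rewrite cls_root negbK; case ex : (evn x) => //=.
  by rewrite rep_cls // eqxx evn_nonroot.
rewrite cls_root negbK => /andP[ex _].
by rewrite con_par_cls // con_len_par // /ancestor -!con_anc.
Qed.

End EvenNodes.

(** * Lattices with a point at the origin *)

Section Pointed.
Variables (V V' : finType) (F : V -> V) (F' : V' -> V') (h : V -> V').
Variables (S0 : {set V}) (S' : {set V'}) (r' : V').
Variables (B0 : V -> V -> int) (B' : V' -> V' -> int).
Hypothesis S'E : S' = r' |: h @: S0.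
Hypothesis hr : forall s, s \in S0 -> h s != r'.
Hypothesis hinj : {in S0 &, injective h}.
Hypothesis FS0 : forall s, (F s \in S0) = (s \in S0).
Hypothesis Fr' : F' r' = r'.
Hypothesis hF : forall s, s \in S0 -> h (F s) = F' (h s).
Hypothesis B'h : forall s t, s \in S0 -> t \in S0 -> B' (h s) (h t) = B0 s t.
Hypothesis B'l : forall b, B' r' b = 0.
Hypothesis B'r : forall b, B' b r' = 0.

Let sumS' (f : V' -> int) : \sum_(b in S') f b = f r' + \sum_(s in S0) f (h s).
Proof.
rewrite S'E big_setU1 /=; last by apply/imsetP => -[s /hr /eqP h1 h2]; rewrite h2 in h1.
by rewrite big_imset.
Qed.

(* When the point r' of S' is the origin, its coefficient is free, so it absorbs
   the degree condition. *)
Lemma has_index_pointed m :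
  has_index (fun x : {ffun V -> int} => gram_lattice S0 B0 (twist F 1 x))
    (gram_lattice S0 B0) m ->
  has_index (fun x : {ffun V' -> int} => degree0_lattice S' B' (twist F' 1 x))
    (degree0_lattice S' B') m.
Proof.
(* The form vanishes at r', so the value of x there is the constant k of [degree0_lattice];
   subtracting it removes the constants. *)
pose phi (x : {ffun V' -> int}) : {ffun V -> int} := [ffun t => x (h t) - x r'].
have key x : degree0_lattice S' B' x <-> gram_lattice S0 B0 (phi x).
  split=> [[lam [k [_ xE]]]|[lam xE]].
    exists (lam \o h) => t t0; rewrite ffunE !xE ?S'E ?setU11 ?setU1r ?imset_f //.
    rewrite -S'E !sumS' B'l [X in _ - (_ + X + _)]big1 => [|s _]; last by rewrite B'r mulr0.
    rewrite B'l !mulr0 !add0r addrK; apply: eq_bigr => s sS; by rewrite /= B'h.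
  pose lam' b := if b == r' then - \sum_(s in S0) lam s else \sum_(s in S0 | h s == b) lam s.
  have lam'h s : s \in S0 -> lam' (h s) = lam s.
    move=> sS; rewrite /lam' (negbTE (hr sS)) (bigD1 s) /= ?sS ?eqxx // big1 ?addr0 //.
    move=> t /andP[/andP[tS /eqP hts] ts]; by rewrite (hinj tS sS hts) eqxx in ts.
  exists lam', (x r'); rewrite sumS' {1}/lam' eqxx; split.
    by rewrite (eq_bigr _ lam'h) addNr.
  move=> b; rewrite S'E !inE => /orP[/eqP->|/imsetP[t t0 ->]].
    by rewrite -S'E big1 ?add0r // => s _; rewrite B'r mulr0.
  rewrite -S'E sumS' B'l mulr0 add0r (eq_bigr (fun s => lam s * B0 s t)) => [|s sS].
    by rewrite -xE // ffunE subrK.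
  by rewrite lam'h // B'h.
have phiB x y : phi (x - y) = phi x - phi y by apply/ffunP => t; rewrite !ffunE; ring.
have gram_ext (x y : {ffun V -> int}) : (forall t, t \in S0 -> x t = y t) ->
    gram_lattice S0 B0 x -> gram_lattice S0 B0 y.
  by move=> xy [lam xE]; exists lam => t t0; rewrite -xy // xE.
have phiT x t : t \in S0 -> phi (twist F' 1 x) t = twist F 1 (phi x) t.
  by move=> t0; rewrite !ffunE hF // Fr'; ring.
apply: (nb_classes_pullback (phi := phi)) => [x /key|x y _ _|z zK].
- by apply: gram_ext => t /phiT.
- by rewrite key phiB.
pose x : {ffun V' -> int} := [ffun b => \sum_(s in S0 | h s == b) z s].
have xz t : t \in S0 -> phi x t = z t.
  move=> t0; rewrite !ffunE (bigD1 t) /= ?t0 ?eqxx // big1 => [|s].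
    rewrite big1 ?subr0 ?addr0 // => s /andP[sS /eqP e].
    by have := hr sS; rewrite e eqxx.
  move=> /andP[/andP[sS /eqP hst] st]; by rewrite (hinj sS t0 hst) eqxx in st.
exists x.
  apply/key; apply: gram_ext zK => t t0.
  by rewrite phiT // !ffunE -!xz ?FS0 // !ffunE.
exists (fun=> 0) => t t0; rewrite big1 => [|s _]; last by rewrite mul0r.
by rewrite [LHS]ffunE [X in _ + X]ffunE xz // subrr.
Qed.

End Pointed.

(** * Subdivision *)

Section Subdivision.
Variable G : lgraph.
Hypothesis Gaut : frob_automorphism G.
Hypothesis edgeC : symmetric (@edge G).
Hypothesis edgeI : irreflexive (@edge G).
Implicit Types (x y z : vtx G).
Local Notation F := (@frob G).

Let Finj : injective F. Proof. by case: Gaut. Qed.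
Let Fedge x y : edge (F x) (F y) = edge x y. Proof. by case: Gaut. Qed.
Let Flen x y : edge x y -> len (F x) (F y) = len x y. Proof. by case: Gaut => _ _; apply. Qed.

Lemma inverted_mem (m : {set vtx G}) x : inverted m -> x \in m ->
  [/\ edge x (F x), F (F x) = x & m = [set x; F x]].
Proof.
move=> /existsP[z /and3P[ez /eqP zF /eqP ->]]; rewrite !inE => /orP[] /eqP-> //.
by rewrite zF edgeC ez finset.setUC.
Qed.

Lemma inverted_frob (m : {set vtx G}) : inverted (F @: m) = inverted m.
Proof.
have im z : F (F z) = z -> F @: [set z; F z] = [set z; F z].
  by move=> zF; rewrite imsetU1 imset_set1 zF finset.setUC.
apply/idP/idP => [/existsP[z /and3P[ez /eqP zF /eqP]]|].
  rewrite -{1}(im z zF) => /(imset_inj Finj) ->.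
  by apply/existsP; exists z; rewrite ez zF !eqxx.
move=> /existsP[z /and3P[ez /eqP zF /eqP ->]]; rewrite im //.
by apply/existsP; exists z; rewrite ez zF !eqxx.
Qed.

Lemma subdivide_automorphism : frob_automorphism (subdivide G).
Proof.
have FE x y : edge (F x) (F y) && ~~ inverted [set F x; F y] = edge x y && ~~ inverted [set x; y].
  by rewrite Fedge -[in RHS]inverted_frob imsetU1 imset_set1.
have Fm x (m : {m : {set vtx G} | inverted m}) : (F x \in val m) = (x \in val m).
  apply/idP/idP => /(inverted_mem (valP m))[_ xF ->]; rewrite !inE.
    by rewrite (_ : F (F x) = x) ?eqxx ?orbT //; apply: Finj; rewrite xF.
  by rewrite eqxx orbT.
have lF x (m : {m : {set vtx G} | inverted m}) : x \in val m -> len (F x) (F (F x)) = len x (F x).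
  by move=> /(inverted_mem (valP m))[ex _ _]; rewrite Flen.
split; first by move=> [x|m] [y|m'] //= [/Finj ->].
  by move=> [x|m] [y|m'] /=; [exact: FE | exact: Fm | exact: Fm |].
by move=> [x|m] [y|m'] //=; [move=> /andP[/Flen] | move=> /lF -> | move=> /lF ->].
Qed.

(** The midpoint of an inverted edge takes the place of the neighbour F x, so the new neighbours
    inject into the old ones. *)
Lemma deg_subdivide x : (deg (inl x : vtx (subdivide G)) <= deg x)%N.
Proof.
pose f (a : vtx (subdivide G)) := if a is inl w then w else F x.
rewrite /deg -(card_in_imset (f := f)).
  apply/subset_leq_card/subsetP => _ /imsetP[[w|m] + ->]; rewrite !inE /=.
    by move=> /andP[].
  by move=> /(inverted_mem (valP m))[].
have clash w (m : {m : {set vtx G} | inverted m}) :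
    ~~ inverted [set x; w] -> x \in val m -> w <> F x.
  by move=> nI /(inverted_mem (valP m))[_ _ mE] wE; move: nI (valP m); rewrite mE wE => /negbTE->.
move=> [w|m] [w'|m']; rewrite !inE /=.
- by move=> _ _ ->.
- by move=> /andP[_ nI] xm /(clash _ _ nI xm).
- by move=> xm /andP[_ nI] /esym/(clash _ _ nI xm).
move=> /(inverted_mem (valP m))[_ _ mE] /(inverted_mem (valP m'))[_ _ mE'] _.
by congr inr; apply: val_inj; rewrite mE -mE'.
Qed.

Lemma sub_len_sym (a b : vtx (subdivide G)) :
  (forall x y, len x y = len y x) -> len a b = len b a.
Proof. by move=> ls; case: a b => [x|m] [y|m'] //=. Qed.

Lemma sub_len_gt0 (a b : vtx (subdivide G)) :
  (forall x y, edge x y -> (0 < len x y)%N) ->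
  (forall x, edge x (F x) -> F (F x) = x -> ~~ odd (len x (F x))) ->
  edge a b -> (0 < len a b)%N.
Proof.
move=> lpos lev.
have half x (m : {m : {set vtx G} | inverted m}) : x \in val m -> (0 < (len x (F x))./2)%N.
  move=> /(inverted_mem (valP m))[ex xF _].
  have := lpos _ _ ex; have := lev _ ex xF; rewrite -{2}[len _ _]odd_double_half => /negbTE ->.
  by rewrite add0n double_gt0.
case: a b => [x|m] [y|m'] //=; [|exact: half|exact: half].
by move=> /andP[/lpos].
Qed.

Lemma order_subdivide x :
  odd (order (@frob (subdivide G)) (inl x)) = odd (order F x).
Proof.
have [sinj _ _] := subdivide_automorphism.
have it k : iter k (@frob (subdivide G)) (inl x) = inl (iter k F x).
  by elim: k => //= k ->.
apply/(odd_orderP sinj)/(odd_orderP Finj) => -[k ok kx]; exists k => //.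
  by move: kx; rewrite it => -[].
by rewrite it kx.
Qed.

(** * Subdivision when F fixes a vertex *)

Section FixedVertex.
Variables (v : vtx G) (par : vtx G -> vtx G).
Hypothesis rt : rooted v par.
Hypothesis Fv : F v = v.

(** One end of an edge is the parent of the other, a relation that F preserves when it fixes the
    root. *)
Lemma no_inverted (m : {set vtx G}) : inverted m = false.
Proof.
apply/negbTE/negP => /existsP[z /and3P[ez /eqP zF _]].
have H y : y != v -> F y = par y -> F (F y) = y -> False.
  move=> yv Fy; rewrite Fy -(par_frob rt Finj Fedge Fv) Fy => ppy.
  by have := anc_par_self rt yv; rewrite -{2}ppy anc_par.
move: ez; rewrite (edgeE rt) => /orP[] /andP[nv /eqP e]; first exact: (H z).
by apply: (H (F z)) => //; rewrite zF.
Qed.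

Definition sub_par (a : vtx (subdivide G)) : vtx (subdivide G) :=
  if a is inl x then inl (par x) else inl v.

Lemma subdivide_rooted : rooted (inl v : vtx (subdivide G)) sub_par.
Proof.
have no (m : {m : {set vtx G} | inverted m}) : False by have := valP m; rewrite no_inverted.
split=> [|[x|m]|[x|m] [y|m']]; try by case: (no m).
- by rewrite /= (par_root rt).
- have /iter_findex <- := par_reach rt x.
  suff <- k : iter k sub_par (inl x) = inl (iter k par x) by exact: fconnect_iter.
  by elim: k => //= k ->.
- by rewrite /= no_inverted andbT (edgeE rt).
by case: (no m').
Qed.

Lemma subdivide_gromov s t :
  gromov (inl v : vtx (subdivide G)) sub_par xpredT (inl s) (inl t) = gromov v par xpredT s t.
Proof.
rewrite /gromov big_sumType /= [X in _ + X]big1 ?addr0 => [|m]; last first.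
  by have := valP m; rewrite no_inverted.
have ancE x y : ancestor sub_par (inl x) (inl y) = ancestor par x y.
  have it k : iter k sub_par (inl x) = inl (iter k par x) by elim: k => //= k ->.
  apply/idP/idP => /iter_findex; last by move=> <-; rewrite /ancestor -it; exact: fconnect_iter.
  by rewrite it => -[<-]; exact: fconnect_iter.
by apply: eq_bigr => x _; rewrite !ancE.
Qed.

End FixedVertex.

(** * Subdivision when F inverts an edge *)

Section InvertedEdge.
Variables (x0 : vtx G) (par : vtx G -> vtx G).
Hypothesis rt : rooted x0 par.
Hypothesis e0 : edge x0 (F x0).
Hypothesis FF0 : F (F x0) = x0.
Local Notation y0 := (F x0).
Local Notation anc := (ancestor par).

Lemma y0_neq : y0 != x0.
Proof. by apply: contraTneq e0 => ->; rewrite edgeI. Qed.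

Lemma par_y0 : par y0 = x0.
Proof. by move: e0; rewrite (edgeE rt) eqxx y0_neq /= => /eqP. Qed.

(** [anc _ y0] tells on which side of the edge from x0 to y0 a vertex lies, and no other edge joins
    the two sides. *)
Lemma side_edge a b : edge a b -> [set a; b] != [set x0; y0] -> anc a y0 = anc b y0.
Proof.
move=> ab ne; apply/idP/idP => h; apply/negPn/negP => nh; case/eqP: ne.
  by have [-> ->] := anc_crossing rt ab y0_neq h nh; rewrite par_y0 finset.setUC.
rewrite edgeC in ab.
by have [-> ->] := anc_crossing rt ab y0_neq h nh; rewrite par_y0.
Qed.

Lemma side_frob z : anc (F z) y0 = ~~ anc z y0.
Proof.
elim/(rooted_ind rt): z => [|z zx IH].
  by rewrite anc_refl (anc_rootE rt) (negbTE y0_neq).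
have [->|zy] := eqVneq z y0.
  by rewrite FF0 anc_refl (anc_rootE rt) (negbTE y0_neq).
have neq : [set z; par z] != [set x0; y0].
  apply/eqP => /setP/(_ z); rewrite !inE eqxx /= => /esym/orP[] /eqP e.
    by rewrite e eqxx in zx.
  by rewrite e eqxx in zy.
have ez := edge_par rt zx.
rewrite (side_edge ez neq) -IH; apply: side_edge; first by rewrite Fedge.
apply: contra neq => /eqP e; apply/eqP/(imset_inj Finj).
by rewrite !imsetU1 !imset_set1 FF0 e finset.setUC.
Qed.

(** The ends of another inverted edge would lie on the same side, yet F exchanges the sides. *)
Lemma inverted_uniq (m : {set vtx G}) : inverted m -> m = [set x0; y0].
Proof.
move=> /existsP[z /and3P[ez _ /eqP ->]]; apply/eqP/negPn/negP => ne.
by have := side_edge ez ne; rewrite side_frob; case: (anc z y0).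
Qed.

Lemma inverted_e0 : inverted [set x0; y0].
Proof. by apply/existsP; exists x0; rewrite e0 FF0 !eqxx. Qed.

Definition mid : vtx (subdivide G) :=
  inr (exist (fun m : {set vtx G} => inverted m) _ inverted_e0).

Lemma inr_mid m : (inr m : vtx (subdivide G)) = mid.
Proof. by congr inr; apply: val_inj; case: m => m /= /inverted_uniq. Qed.

Definition mid_par (a : vtx (subdivide G)) : vtx (subdivide G) :=
  if a is inl x then if (x == x0) || (x == y0) then mid else inl (par x) else mid.

Lemma mid_rooted : rooted mid mid_par.
Proof.
split=> [|[x|m]|[x|m] [y|m']] //=.
- elim/(rooted_ind rt): x => [|x xx IH].
    by apply: connect_trans (fconnect1 _ _) _; rewrite /= eqxx; exact: connect0.
  apply: connect_trans (fconnect1 _ _) _; rewrite /=; case: ifP => _ //.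
- by rewrite inr_mid; exact: connect0.
- have inl_eq a b : (inl a == mid_par (inl b)) = [&& b != x0, b != y0 & a == par b].
    by rewrite /mid_par; case: (b == x0) => //=; case: (b == y0).
  have invE a b : edge a b -> inverted [set a; b] = ([set a; b] == [set x0; y0]).
    by move=> _; apply/idP/eqP => [/inverted_uniq//|->]; exact: inverted_e0.
  have down a b : a != x0 -> b = par a -> inverted [set a; b] = (a == y0).
    move=> ax ->; rewrite invE ?(edge_par rt) //; apply/eqP/eqP => [/setP/(_ a)|->].
      by rewrite !inE eqxx (negbTE ax) /= => /esym/eqP.
    by rewrite par_y0 finset.setUC.
  rewrite -[if _ then _ else _]/(mid_par (inl x)).
  rewrite -[if (y == _) || _ then _ else _]/(mid_par (inl y)).
  rewrite !inl_eq; apply/andP/orP => [[+ nI]|].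
    rewrite (edgeE rt) => /orP[] /andP[nx /eqP e]; [left|right]; move: nI.
      by rewrite (down x y) // nx e eqxx => ->.
    by rewrite finset.setUC (down y x) // nx e eqxx => ->.
  case=> /and3P[nx ny /eqP e].
    by rewrite down // ny e (edge_par rt).
  by rewrite finset.setUC down // ny e (edge_par' rt).
- have -> : inr m' = mid by exact: inr_mid.
  have -> : val m' = [set x0; y0] by case: m' => m /= /inverted_uniq.
  by rewrite in_set2; case: ifP => _; rewrite !eqxx.
- have -> : inr m = mid by exact: inr_mid.
  have -> : val m = [set x0; y0] by case: m => m /= /inverted_uniq.
  by rewrite in_set2; case: ifP => _; rewrite !eqxx.
- by rewrite !inr_mid eqxx.
Qed.

Lemma mid_anc s z : ancestor mid_par (inl s) (inl z) =
  if z == x0 then ~~ anc s y0 else anc s z.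
Proof.
elim/(rooted_ind rt): s => [|s sx IH].
  rewrite ancE /= eqxx /= (anc_rootE mid_rooted) /= orbF !(anc_rootE rt) (negbTE y0_neq).
  by rewrite [LHS]/eq_op /= [x0 == z]eq_sym; case: (z == x0).
rewrite ancE [LHS]/= (negbTE sx) /=; have [->|sy] /= := eqVneq s y0.
  rewrite (anc_rootE mid_rooted) orbF anc_refl /= [LHS]/eq_op /=.
  case: (eqVneq z x0) => [->|zx]; first exact/negbTE/y0_neq.
  by rewrite [RHS]ancE par_y0 (anc_rootE rt) (negbTE zx) orbF.
rewrite IH [anc s y0]ancE (negbTE sy) /= [anc s z]ancE [inl s == inl z]/eq_op /=.
by case: (eqVneq z x0) => // ->; rewrite (negbTE sx).
Qed.

(** Moving the root changes the common part of two paths by a function of s plus a function of t,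
    which [has_index_shift] ignores. *)
Lemma mid_gromov s t : ~~ odd (len x0 y0) -> len y0 x0 = len x0 y0 ->
  gromov mid mid_par xpredT (inl s) (inl t) =
  gromov x0 par xpredT s t
  + (len x0 y0)./2%:Z * (1 - (anc s y0)%:R - (anc t y0)%:R).
Proof.
move=> lev lsym; rewrite /gromov big_sumType /= [X in _ + X]big1 ?addr0 => [|m]; last first.
  by rewrite inr_mid eqxx.
rewrite (bigD1 x0) //= [in RHS](bigD1 y0) ?y0_neq //= (bigD1 y0) ?y0_neq //=.
rewrite !eqxx orbT /= par_y0 FF0 lsym !mid_anc eqxx (negbTE y0_neq).
have -> : \sum_(i | (i != x0) && (i != y0))
    (len (inl i : vtx (subdivide G)) (mid_par (inl i)))%:Z *
      ((ancestor mid_par (inl s) (inl i))%:R * (ancestor mid_par (inl t) (inl i))%:R) =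
    \sum_(i | (i != x0) && (i != y0)) (len i (par i))%:Z * ((anc s i)%:R * (anc t i)%:R).
  apply: eq_bigr => i /andP[ix iy]; rewrite !mid_anc (negbTE ix).
  by rewrite /= (negbTE ix) (negbTE iy).
have -> : (len x0 y0)%:Z = 2 * (len x0 y0)./2%:Z.
  by rewrite -{1}[len x0 y0]odd_double_half (negbTE lev) add0n -mul2n PoszM.
by case: (anc s y0); case: (anc t y0) => /=; ring.
Qed.

End InvertedEdge.

End Subdivision.

(** * Simple trees *)

(** The quadratic form is a sum of squares [a x * a x] weighted by edge lengths. At x = i s the
    number [a x] is lam s, because i s is an ancestor of no other point of S. *)
Lemma gromov_positive (G : lgraph) (r : vtx G) (par : vtx G -> vtx G)
    (P : pred (vtx G)) (V : finType) (i : V -> vtx G) (S : {set V}) :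
    (forall x, x != r -> (0 < len x (par x))%N) ->
    (forall s, s \in S -> P (i s) && (i s != r)) ->
    (forall s t, s \in S -> t \in S -> ancestor par (i t) (i s) -> t = s) ->
  positive_on S (fun s t => gromov r par P (i s) (i t)).
Proof.
move=> lpos SP leaf lam.
pose a x : int := \sum_(s in S) lam s * (ancestor par (i s) x)%:R.
have -> : \sum_(s in S) \sum_(t in S) lam s * lam t * gromov r par P (i s) (i t) =
    \sum_(x | P x && (x != r)) (len x (par x))%:Z * (a x * a x).
  transitivity (\sum_(x | P x && (x != r)) \sum_(s in S) \sum_(t in S)
    (len x (par x))%:Z *
      ((lam s * (ancestor par (i s) x)%:R) * (lam t * (ancestor par (i t) x)%:R))).
    rewrite [RHS]exchange_big; apply: eq_bigr => s _; rewrite [RHS]exchange_big.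
    apply: eq_bigr => t _; rewrite mulr_sumr; apply: eq_bigr => x _; ring.
  apply: eq_bigr => x _; rewrite /a big_distrlr mulr_sumr /=.
  by apply: eq_bigr => s _; rewrite mulr_sumr.
move=> /psumr_eq0P H s sS; have /andP[Ps sr] := SP s sS.
have : (len (i s) (par (i s)))%:Z * (a (i s) * a (i s)) = 0.
  apply: H; last by rewrite Ps.
  by move=> x _; rewrite mulr_ge0 // -expr2 sqr_ge0.
move/eqP; rewrite mulf_eq0 => /orP[|].
  by have := lpos _ sr; rewrite eqz_nat; case: (len _ _).
rewrite mulf_eq0 orbb /a (bigD1 s) //= anc_refl mulr1 big1 ?addr0 => [/eqP//|t /andP[tS ts]].
case h : (ancestor par (i t) (i s)); last by rewrite mulr0.
by rewrite (leaf s t sS tS h) eqxx in ts.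
Qed.

(** * Change of root *)

Section Shift.
Variables (V : finType) (F : V -> V) (S : {set V}).
Implicit Types (B : V -> V -> int) (x : {ffun V -> int}).

(** For lam of degree zero the terms q(t) drop out, and the terms p(s) add up to a constant,
    absorbed by k. *)
Lemma degree0_lattice_shift B B' (p q : V -> int) :
    (forall s t, s \in S -> t \in S -> B' s t = B s t + p s + q t) ->
  forall x, degree0_lattice S B x <-> degree0_lattice S B' x.
Proof.
move=> H x; split=> -[lam [k [l0 xE]]].
  exists lam, (k - \sum_(s in S) lam s * p s); split=> // t tS; rewrite xE //.
  rewrite [in RHS](eq_bigr (fun s => lam s * B s t + lam s * p s + lam s * q t)) => [|s sS].
    by rewrite !big_split /= -[\sum_(s in S) lam s * q t]mulr_suml l0; ring.
  by rewrite H //; ring.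
exists lam, (k + \sum_(s in S) lam s * p s); split=> // t tS; rewrite xE //.
rewrite [in LHS](eq_bigr (fun s => lam s * B s t + lam s * p s + lam s * q t)) => [|s sS].
  by rewrite !big_split /= -[\sum_(s in S) lam s * q t]mulr_suml l0; ring.
by rewrite H //; ring.
Qed.

Lemma has_index_shift B B' (p q : V -> int) e n :
    (forall s t, s \in S -> t \in S -> B' s t = B s t + p s + q t) ->
  has_index (fun x => degree0_lattice S B' (twist F e x)) (degree0_lattice S B') n ->
  has_index (fun x => degree0_lattice S B (twist F e x)) (degree0_lattice S B) n.
Proof.
move=> /degree0_lattice_shift H; apply: (nb_classes_pullback (phi := id)).
- by move=> x /H.
- by move=> x y _ _; rewrite H.
- by move=> x /H ?; exists x => //; rewrite subrr; have [] := degree0_lattice_subgroup S B'.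
Qed.

End Shift.

Section Simple.
Variable T : by_data.
Hypothesis hT : is_BY_tree T.
Hypothesis hsimple : is_simple T.
Hypothesis hneg : is_negative T.
Hypothesis hA : parityA T.
Hypothesis hB : parityB T.
Implicit Types (x y z s t v : vtx T).
Local Notation F := (@frob T).

Let Tf : is_lforest T. Proof. by case: hT => -[]. Qed.
Let Taut : frob_automorphism T. Proof. by case: hT => -[]. Qed.
Let Finj : injective F. Proof. by case: Taut. Qed.
Let Fedge x y : edge (F x) (F y) = edge x y. Proof. by case: Taut. Qed.
Let Tc x y : connect (@edge T) x y. Proof. by case: hT => _ []. Qed.
Let edgeC : symmetric (@edge T). Proof. by case: Tf. Qed.
Let edgeI : irreflexive (@edge T). Proof. by case: Tf. Qed.
Let lenC x y : len x y = len y x. Proof. by case: Tf. Qed.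
Let len_gt0 x y : edge x y -> (0 < len x y)%N. Proof. by case: Tf => _ _ _ _; apply. Qed.
Let SE0 x y : SE x y = false. Proof. by case: hsimple => _ _ /(_ x y)/negbTE. Qed.
Let deg1 s : s \in SV T -> deg s = 1%N. Proof. by case: hsimple => _ + _; apply. Qed.

Let FSV x : (F x \in SV T) = (x \in SV T).
Proof. by case: hT => -[_ _ _ [FS _] _] _; rewrite -{1}FS mem_imset. Qed.

Let SVS s : (s \in SV T) = (s \in S0 T) || (s \in S1 T).
Proof. by rewrite !inE -andb_orr orNb andbT. Qed.

Let S1_odd s : s \in S1 T -> odd (order F s). Proof. by rewrite inE => /andP[]. Qed.
Let S0_even s : s \in S0 T -> ~~ odd (order F s). Proof. by rewrite inE => /andP[]. Qed.
Let S1_SV s : s \in S1 T -> s \in SV T. Proof. by rewrite inE => /andP[]. Qed.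
Let S0_SV s : s \in S0 T -> s \in SV T. Proof. by rewrite inE => /andP[]. Qed.

Lemma tamagawa_simple r n :
  has_index (fun x : {ffun vtx T -> int} =>
      degree0_lattice (SV T) (gromov r (par_to r) xpredT) (twist F (-1) x))
    (degree0_lattice (SV T) (gromov r (par_to r) xpredT)) n ->
  tamagawa T = n.
Proof.
have [/set0Pn[s0 s0S] _ _] := hsimple.
apply: (@tamagawa_rooted T r (par_to r) true s0) => //.
- exact: forest_rooted.
- by move=> x y xy; rewrite hneg.2 // SE0.
Qed.

Local Notation T2 := (subdivide T).

(* Condition (A) enters only through bp_even and bp_twig. *)
Record base_point (r : vtx T2) (par : vtx T2 -> vtx T2) : Prop := BasePoint {
  bp_rooted : rooted r par;
  bp_fixed : frob r = r;
  bp_SV : forall s, s \in SV T -> inl s != r;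
  bp_tamagawa : forall n,
    has_index (fun x : {ffun vtx T -> int} => degree0_lattice (SV T)
        (fun s t => gromov r par xpredT (inl s) (inl t)) (twist F (-1) x))
      (degree0_lattice (SV T) (fun s t => gromov r par xpredT (inl s) (inl t))) n ->
    tamagawa T = n;
  bp_even : forall s t, s \in SV T -> t \in S1 T -> s != t ->
    oddz (gromov r par xpredT (inl s) (inl t)) = false;
  bp_twig : forall t, t \in S1 T ->
    oddz (gromov r par xpredT (inl t) (inl t)) = odd_twig t
}.

(** * The formula for a tree with a base point *)

Section BasePoint.
Variables (r : vtx T2) (par : vtx T2 -> vtx T2).
Hypothesis bp : base_point r par.

Let rt : rooted r par. Proof. by case: bp. Qed.
Let Fr : frob r = r. Proof. by case: bp. Qed.
Let T2aut : frob_automorphism T2. Proof. exact: subdivide_automorphism. Qed.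
Let T2inj : injective (@frob T2). Proof. by case: T2aut. Qed.
Let T2edge (a b : vtx T2) : edge (frob a) (frob b) = edge a b. Proof. by case: T2aut. Qed.
Let T2len a : a != r -> len (frob a) (frob (par a)) = len a (par a).
Proof. by move=> ar; case: T2aut => _ _; apply; exact: (edge_par rt). Qed.

Let T2len_gt0 a : a != r -> (0 < len a (par a))%N.
Proof.
move=> ar; apply: sub_len_gt0 => //; last exact: (edge_par rt).
by move=> x xF FF; apply/negP => od; apply: (hB (k := 1) xF od).
Qed.

Let T2evn s : evn (inl s : vtx T2) = ~~ odd (order F s).
Proof. by rewrite /evn order_subdivide. Qed.

Let leaf s t : s \in SV T -> t \in SV T -> ancestor par (inl t) (inl s) -> t = s.
Proof.
move=> sS tS h; suff : inl t = inl s :> vtx T2 by case.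
apply: (anc_leaf rt) h; last exact: (bp_SV bp).
by apply: leq_trans (deg_subdivide edgeC _) _; rewrite deg1.
Qed.

Local Notation B := (fun s t => gromov r par xpredT (inl s) (inl t)).
Local Notation B0 := (fun s t => gromov r par (@evn T2) (inl s) (inl t)).

Lemma c1_twos : c1 T = twos F (SV T) (S1 T) (@odd_twig T).
Proof. by []. Qed.

Lemma tamagawa_comparison : exists2 m,
  has_index (fun x : {ffun vtx T -> int} => gram_lattice (S0 T) B0 (twist F 1 x))
    (gram_lattice (S0 T) B0) m
  & tamagawa T = (c1 T * m)%N.
Proof.
have [/set0Pn[s0 s0S] _ _] := hsimple.
have inl_frob k s : inl (iter k F s) = iter k (@frob T2) (inl s).
  by elim: k => //= k <-.
have T2order s : odd (order F (F s)) = odd (order F s) by rewrite odd_order_frob.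
(* Taken in the subdivided tree, whose vertices in odd orbits index the discarded part of the
   form. *)
pose n := odd_period (@frob T2).
have nS1 s : s \in S1 T -> iter n F s = s.
  move=> s1; have : inl (iter n F s) = inl s :> vtx T2.
    by rewrite inl_frob iter_odd_period // order_subdivide // S1_odd.
  by case.
have BFn s t k :
    gromov r par xpredT (iter k (@frob T2) (inl s)) (iter k (@frob T2) (inl t)) = B s t.
  by elim: k => //= k <-; rewrite gromov_frob.
have [||||||||||||||||||m i1 i2] := @comparison _ F (SV T) (S0 T) (S1 T) B B0
    (fun s => branch_sign par (inl s)) (@odd_twig T) n s0.
- exact: Finj.
- exact: SVS.
- by move=> s; rewrite !inE => /andP[-> /negbTE->].
- by move=> s; rewrite !inE FSV T2order.
- by move=> s; rewrite !inE FSV T2order.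
- exact: odd_odd_period.
- exact: nS1.
- by move=> s t _ _; exact: (BFn s t 1%N).
- move=> s t _ _; rewrite -[LHS]/(gromov r par (@evn T2) (@frob T2 (inl s)) (@frob T2 (inl t))).
  by rewrite gromov_frob // => a; rewrite evn_frob.
- move=> s t _ _; rewrite !gromov_split // inl_frob.
  exact: gromov_odd_iter.
(* F^n fixes s, so it may be applied to both arguments. *)
- move=> s t s1 _; rewrite inl_frob -(BFn s t n) -(inl_frob n s) nS1 //.
- move=> s t _ _; exact: gromov_evn_sign.
- move=> s s0'; apply: (@branch_sign_frob T2 r par rt T2aut Fr (inl s)).
  by rewrite T2evn; exact: S0_even.
- by apply: gromov_positive => // s sS; rewrite (bp_SV bp).
- apply: gromov_positive => // [s sS|s t sS tS]; last by apply: leaf; exact: S0_SV.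
  by rewrite T2evn S0_even // (bp_SV bp) // S0_SV.
- exact: (bp_even bp).
- exact: (bp_twig bp).
- exact: s0S.
by exists m => //; rewrite c1_twos; exact: (bp_tamagawa bp).
Qed.

(** T' is rooted at the class of r, its fixed vertex and a point of its S, which is the situation of
    [has_index_pointed]. Its form is the part of B over the even orbits. *)
Lemma tamagawa_T' m :
  has_index (fun x : {ffun vtx T -> int} => gram_lattice (S0 T) B0 (twist F 1 x))
    (gram_lattice (S0 T) B0) m ->
  tamagawa (T' T) = m.
Proof.
move=> i1; pose c (a : vtx T2) : vtx (T' T) := cls a; pose r' := c r.
pose par' : vtx (T' T) -> vtx (T' T) := con_par r par.
have rt' : rooted r' par' := contract_rooted rt T2aut Fr.
have ev s : s \in S0 T -> evn (inl s : vtx T2) by move=> /S0_even; rewrite T2evn.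
have S'E : SV (T' T) = r' |: [set c (inl s) | s in S0 T].
  apply/setP => b; rewrite !inE (con_frob_fixed rt T2aut Fr) orbC; congr orb.
  apply/existsP/imsetP => [[s /andP[sS]]|[s sS ->]].
    by rewrite (mem_clsE rt T2aut Fr) => /eqP ->; exists s.
  by exists s; rewrite sS (mem_clsE rt T2aut Fr) eqxx.
have hr s : s \in S0 T -> c (inl s) != r'.
  by move=> /ev es; rewrite /r' (cls_root rt T2aut Fr) negbK.
have F'c a : frob (c a) = c (frob a) by exact: (con_frob_cls rt T2aut Fr).
have F'r : frob r' = r' by rewrite F'c Fr.
have F'inj : injective (@frob (T' T)) := con_frob_inj rt T2aut Fr.
have FS0 s : (F s \in S0 T) = (s \in S0 T) by rewrite !inE FSV odd_order_frob.
apply: (@tamagawa_rooted (T' T) r' par' false r') => //.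
- move=> b br; apply: (con_len_sym rt T2aut Fr) => // a ar; exact: sub_len_sym.
- exact: (con_frob_edge rt T2aut Fr).
- move=> b; rewrite !S'E !inE -{1}F'r (inj_eq F'inj); congr orb.
  apply/imsetP/imsetP => -[s sS e]; last by exists (F s); rewrite ?FS0 // e F'c.
  have [s' s'E] : exists s', s = F s' by exists (finv F s); rewrite f_finv.
  exists s'; first by rewrite -FS0 -s'E.
  by apply: F'inj; rewrite e F'c s'E.
- by rewrite S'E !inE eqxx.
rewrite expr0; apply: (has_index_pointed (h := fun s => c (inl s)) S'E hr _ FS0 F'r) i1.
- move=> s t sS tS /= h; have := cls_inj_evn rt T2aut Fr (ev s sS) h; by case.
- by move=> s _; rewrite F'c.
- move=> s t _ _; exact: (con_gromov rt T2aut Fr).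
- move=> b; apply: big1 => x /= xr; by rewrite (anc_rootE rt') (negbTE xr) mul0r mulr0.
- move=> b; apply: big1 => x /= xr; by rewrite (anc_rootE rt') (negbTE xr) !mulr0.
Qed.

Lemma tamagawa_base_point : tamagawa T = (c1 T * tamagawa (T' T))%N.
Proof. by have [m i1 ->] := tamagawa_comparison; rewrite (tamagawa_T' i1). Qed.

End BasePoint.

(** * Existence of a base point *)

Lemma not_exempt x : (2 < deg x)%N -> ~ parity_exempt x.
Proof. by move=> d [[e _ _]|[e _]|[e _ _]]; rewrite e in d. Qed.

Lemma branch_even x y : (2 < deg x)%N -> (2 < deg y)%N -> ~~ odd (dist x y).
Proof.
by move=> dx dy; apply/negP => /hA[]; exact: not_exempt.
Qed.

(** Two points of S meet at v or at a branch vertex, whose distance from v is even by (A). Likewise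
    a point of S_1 has distances of the same parity to all branch vertices, so v may replace the
    nearest one. If S_1 is empty there is nothing to check, whatever the degree of v. *)
Lemma base_point_fixed v : F v = v -> v \notin SV T ->
  (forall t, t \in S1 T -> (2 < deg v)%N) ->
  base_point (inl v : vtx T2) (sub_par v (par_to v)).
Proof.
move=> Fv vS vb; have rt := forest_rooted Tf Tc v.
have lsym x : x != v -> len (par_to v x) x = len x (par_to v x) by [].
have gE := subdivide_gromov Taut rt Fv.
split=> [|||n|s t sS t1 st|t t1].
- exact: subdivide_rooted.
- by rewrite /= Fv.
- by move=> s sS; apply: contraNneq vS => -[<-].
- move=> idx; apply: (@tamagawa_simple v).
  apply: (has_index_shift (p := fun=> 0) (q := fun=> 0)) idx.
  by move=> s t _ _; rewrite gE !addr0.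
- have dv := vb t t1; have tS := S1_SV t1.
  have nv u : u \in SV T -> u != v by apply: contraTneq => ->.
  have nanc a b : a \in SV T -> b \in SV T -> a != b -> ~~ ancestor (par_to v) a b.
    move=> aS bS; apply: contra => h.
    by rewrite (@anc_leaf _ _ _ rt b a) ?deg1 ?nv.
  have [|| m [y1 [y2 [[y12 y1v y2v] [p1 p2] _ mE]]]] := meet_ex rt (s := s) (t := t).
  - exact: nanc.
  - by apply: nanc => //; rewrite eq_sym.
  rewrite gE (@gromov_meet T v _ s t m mE) /oddz absz_nat.
  have [->|mv] := eqVneq m v; first by rewrite depth_root.
  have dm := deg_ge3 rt mv y1v y2v y12 p1 p2.
  by have := branch_even dv dm; rewrite (dist_root rt lsym Tc) => /negbTE.
have dv := vb t t1; rewrite gE gromov_self /oddz absz_nat.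
have odE w : (2 < deg w)%N -> odd (dist t w) = odd (depth v (par_to v) t).
  move=> dw; rewrite (odd_dist rt lsym Tc); have := branch_even dv dw.
  by rewrite (dist_root rt lsym Tc) => /negbTE ->; rewrite addbF.
apply/idP/existsP => [od|[w /and3P[dw _]]]; last by rewrite odE.
case: (arg_minnP (P := fun w => (2 < deg w)%N) (dist t) dv) => w dw wmin.
exists w; rewrite dw odE // od andbT /=; apply/forallP => u.
by apply/implyP => /wmin.
Qed.

(** F exchanges the two sides of the edge, so no odd power fixes a vertex: S_1 is empty and both
    parity fields are vacuous. *)
Lemma base_point_inverted x0 (e0 : edge x0 (F x0)) (FF0 : F (F x0) = x0) :
  base_point (mid e0 FF0) (mid_par (par_to x0) e0 FF0).
Proof.
have rt := forest_rooted Tf Tc x0.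
have no1 t : t \in S1 T -> False.
  move=> /S1_odd/(odd_orderP Finj)[k ok kt].
  have H j : ancestor (par_to x0) (iter j F t) (F x0) = odd j (+) ancestor (par_to x0) t (F x0).
    by elim: j => //= j IH; rewrite (side_frob Taut edgeC edgeI rt e0 FF0) IH addNb.
  by have := H k; rewrite kt ok; case: (ancestor _ _ _).
have lev : ~~ odd (len x0 (F x0)).
  by apply/negP => od; apply: (hB (k := 1) e0 od).
have gE s t := mid_gromov Taut edgeC edgeI rt e0 FF0 s t lev (lenC _ _).
split=> [||//|n|s t _ /no1//|t /no1//].
- exact: mid_rooted.
- by [].
move=> idx; apply: (@tamagawa_simple x0).
pose h := (len x0 (F x0))./2%:Z.
apply: (has_index_shift (p := fun s => h - h * (ancestor (par_to x0) s (F x0))%:R)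
  (q := fun t => - h * (ancestor (par_to x0) t (F x0))%:R)) idx.
by move=> s t _ _; rewrite gE /h; ring.
Qed.

(** Take a branch vertex b nearest to v. If F moves b, the paths from b and F b meet at a branch
    vertex nearer to v, unless they meet only at v. In that case v has just two neighbours, which F
    exchanges, and no odd power of F can fix s. *)
Lemma fixed_branch v s : F v = v -> s \in S1 T -> has_branch_vertex T ->
  exists2 b, F b = b & (2 < deg b)%N.
Proof.
move=> Fv s1 /existsP[b0 db0]; have rt := forest_rooted Tf Tc v.
have [dv|ndv] := ltnP 2 (deg v); first by exists v.
pose height x := #|[set y | ancestor (par_to v) x y]|.
case: (arg_minnP (P := fun w => (2 < deg w)%N) height db0) => b db bmin.
have [Fb|Fb] := eqVneq (F b) b; first by exists b.
have ancF := anc_frob rt Finj Fedge Fv.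
have hF x : height (F x) = height x.
  rewrite /height -[RHS](card_imset _ Finj); apply: eq_card => y.
  have [z ->] : exists z, y = F z by exists (finv F y); rewrite f_finv.
  by rewrite mem_imset // !inE ancF.
have hlt x y : ancestor (par_to v) x y -> x != y -> (height y < height x)%N.
  move=> xy ne; apply/proper_card/properP; split.
    by apply/subsetP => z; rewrite !inE; exact: anc_trans.
  exists x; rewrite !inE ?anc_refl //; apply: contra ne => yx.
  by apply/eqP/(anc_antisym rt).
have [|| m [y1 [y2 [[y12 y1v y2v] [p1 p2] [a1 a2] _]]]] := meet_ex rt (s := b) (t := F b).
- by apply/negP => /hlt; rewrite hF ltnn eq_sym => /(_ Fb).
- by apply/negP => /hlt; rewrite hF ltnn => /(_ Fb).
have [mv|mv] := eqVneq m v; last first.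
  have dm := deg_ge3 rt mv y1v y2v y12 p1 p2.
  have bm : ancestor (par_to v) b m by apply: anc_trans a1 _; rewrite -p1 anc_par.
  have bne : b != m.
    apply/eqP => e; rewrite e in a1; have := anc_par_self rt y1v; by rewrite p1 a1.
  by have := bmin m dm; rewrite leqNgt hlt.
have py1 : par_to v y1 = v by rewrite p1.
have parF := par_frob rt Finj Fedge Fv.
have Fy1v : F y1 != v by rewrite (frob_eq_root Finj Fv).
have Fy2v : F y2 != v by rewrite (frob_eq_root Finj Fv).
have only w : w != v -> par_to v w = v -> w = y1 \/ w = y2.
  move=> wv pw; have [/orP[/eqP->|/eqP->]|] := boolP ((w == y1) || (w == y2)); [by left|by right|].
  rewrite negb_or => /andP[w1 w2]; exfalso; move: ndv; rewrite leqNgt => /negP; apply.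
  have <- : #|w |: [set y1; y2]| = 3%N by rewrite cardsU1 cards2 y12 !inE negb_or w1 w2.
  apply/subset_leq_card/subsetP => z; rewrite !inE => /or3P[] /eqP->.
  - by rewrite -pw (edge_par' rt).
  - by rewrite -py1 (edge_par' rt).
  - by rewrite -mv -p2 (edge_par' rt).
have Fy1 : F y1 = y2.
  apply: (child_uniq rt (s := F b)) => //; first by rewrite ancF.
  by rewrite parF py1 Fv p2 mv.
have Fy2 : F y2 = y1.
  have [//|e] := only (F y2) Fy2v (etrans (parF _) (etrans (congr1 F (etrans p2 mv)) Fv)).
  by move: y12; rewrite -(inj_eq Finj) Fy1 e eqxx.
have sw k : iter k F y1 = if odd k then y2 else y1.
  by elim: k => //= k ->; case: (odd k).
have sw2 k : iter k F y2 = if odd k then y1 else y2 by rewrite -Fy1 -iterSr sw /=; case: (odd k).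
have sv : s != v.
  apply/eqP => e; have dv1 : deg v = 1%N by rewrite -e deg1 // S1_SV.
  have : (1 < deg v)%N; last by rewrite dv1.
  have <- : #|[set y1; y2]| = 2%N by rewrite cards2 y12.
  apply/subset_leq_card/subsetP => z; rewrite !inE => /orP[] /eqP->.
  - by rewrite -py1 (edge_par' rt).
  - by rewrite -mv -p2 (edge_par' rt).
have [|y /andP[yv sy] py] := anc_child rt _ (anc_root rt s); first by rewrite eq_sym.
have [k ok ks] := odd_orderP Finj _ (S1_odd s1).
have ky : iter k F y = y.
  apply: (child_uniq rt (s := s)) => //.
  - by elim: k {ok ks} => //= k IH; rewrite (frob_eq_root Finj Fv).
  - by rewrite -{1}ks (anc_iter_frob rt Finj Fedge Fv).
  - have parFk j : par_to v (iter j F y) = iter j F (par_to v y).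
      by elim: j => //= j IH; rewrite parF IH.
    by rewrite parFk py; elim: k {ok ks} => //= k ->.
by have [e|e] := only y yv py; move: ky; rewrite e ?sw ?sw2 ok => e'; rewrite e' eqxx in y12.
Qed.

Lemma base_point_ex : has_branch_vertex T ->
  exists r par, base_point r par.
Proof.
move=> hb; have [/set0Pn[s0 s0S] _ _] := hsimple.
have rt := forest_rooted Tf Tc s0.
have [[v Fv]|[x0 e0 FF0]] := fixed_vertex_or_inverted_edge rt Fedge; last first.
  by do 2!eexists; exact: (base_point_inverted e0 FF0).
have [S10|[s s1]] := set_0Vmem (S1 T).
  do 2!eexists; apply: (base_point_fixed Fv) => [|t]; last by rewrite S10 inE.
  (* A fixed point of S has an orbit of size 1 and would lie in S_1. *)
  apply/negP => vS; suff : v \in S1 T by rewrite S10 inE.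
  by rewrite inE vS; apply/odd_orderP => //; exists 1%N.
have [b Fb db] := fixed_branch Fv s1 hb.
do 2!eexists; apply: (base_point_fixed Fb) => //.
by apply: contraTN db => /deg1 ->.
Qed.

(** On one point every function is constant, so Z^S / L is trivial. *)
Lemma tamagawa_singleton : #|SV T| = 1%N -> tamagawa T = 1%N.
Proof.
move=> /eqP/cards1P[s SE]; apply: (@tamagawa_simple s).
have full (x : {ffun vtx T -> int}) : degree0_lattice (SV T) (gromov s (par_to s) xpredT) x.
  exists (fun=> 0), (x s); split=> [|t]; first by rewrite big1.
  by rewrite SE inE => /eqP->; rewrite big1 ?add0r // => u _; rewrite mul0r.
exists unit, (fun=> tt); rewrite card_unit; split=> //; by case; exists 0.
Qed.

(** * Paths between two points of S *)

Section Path.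
Variables s t : vtx T.
Hypothesis st : s != t.
Hypothesis SVE : SV T = [set s; t].
Local Notation d := (dist s t).
Local Notation B := (gromov s (par_to s) xpredT).

Let rt := forest_rooted Tf Tc s.

Let sumSV (f : vtx T -> int) : \sum_(x in SV T) f x = f s + f t.
Proof. by rewrite SVE big_setU1 ?inE // big_set1. Qed.

Lemma dist_gt0 : (0 < d)%N.
Proof.
have ts : t != s by rewrite eq_sym.
rewrite (dist_root rt _ Tc) // depth_par // addn_gt0 len_gt0 //.
exact: (edge_par rt).
Qed.

(** Rooted at s, the form has the single non-zero value B(t, t) = d on S, so Z^S / L is Z / d
    through x(t) - x(s). *)
Lemma path_lattice (x : {ffun vtx T -> int}) :
  degree0_lattice (SV T) B x <-> (d%:Z %| x t - x s)%Z.
Proof.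
have Bs u : B s u = 0 by apply: big1 => y /= ys; rewrite (anc_rootE rt) (negbTE ys) mul0r mulr0.
have Bs' u : B u s = 0 by rewrite gromov_sym.
have Bt : B t t = d%:Z by rewrite gromov_self (dist_root rt _ Tc).
split=> [[lam [k [_ xE]]]|/dvdzP[q qE]].
  rewrite !xE ?SVE ?set21 ?set22 // -SVE !sumSV !Bs !Bs' Bt.
  by apply/dvdzP; exists (lam t); ring.
exists (fun u => if u == s then - q else q), (x s); rewrite sumSV eqxx eq_sym (negbTE st) addNr.
split=> // u; rewrite SVE !inE => /orP[] /eqP->; rewrite -SVE sumSV !Bs ?Bs' ?Bt eq_sym (negbTE st).
  by rewrite !mulr0 !add0r.
by rewrite -qE mulr0 add0r subrK.
Qed.

(** With F trivial, 1 + F is multiplication by 2, whose kernel on Z / d has order 2. *)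
Lemma tamagawa_path_even : ~~ odd d -> (forall x, F x = x) -> tamagawa T = 2%N.
Proof.
move=> ed Fid; apply: (@tamagawa_simple s); have d0 := dist_gt0.
have dE : d%:Z = d./2%:Z * 2.
  by rewrite -{1}[d]odd_double_half (negbTE ed) add0n -muln2 PoszM.
have h0 : d./2%:Z != 0 by apply: contraTneq d0 => h0; rewrite -ltz_nat dE h0.
have twistE (x : {ffun vtx T -> int}) :
    degree0_lattice (SV T) B (twist F (-1) x) <-> (d./2%:Z %| x t - x s)%Z.
  have e : twist F (-1) x t - twist F (-1) x s = (x t - x s) * 2.
    by rewrite !ffunE !Fid; ring.
  by rewrite path_lattice e dE dvdz_mul2r.
exists bool, (fun x : {ffun vtx T -> int} => (d%:Z %| x t - x s)%Z); rewrite card_bool; split=> //.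
  case; first by exists 0; [apply/twistE|]; rewrite !ffunE subrr dvdz0.
  exists [ffun u => if u == t then d./2%:Z else 0].
    by apply/twistE; rewrite !ffunE eqxx (negbTE st) subr0.
  by rewrite !ffunE eqxx (negbTE st) subr0 dvdzE /= gtnNdvd //; lia.
move=> a b /twistE/dvdzP[p pE] /twistE/dvdzP[q qE]; rewrite path_lattice.
have -> : (a - b) t - (a - b) s = (a t - a s) - (b t - b s) by rewrite !ffunE; ring.
rewrite pE qE dE -mulrBl ![_ * d./2%:Z]mulrC !dvdz_mul2l //.
have ev c : (2 %| c)%Z = ~~ oddz c by rewrite /oddz dvdzE dvdn2.
rewrite !ev oddzD oddzN; by case: (oddz p); case: (oddz q).
Qed.

(** Multiplication by 2 is injective on Z / d. *)
Lemma tamagawa_path_odd : odd d -> (forall x, F x = x) -> tamagawa T = 1%N.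
Proof.
move=> od Fid; apply: (@tamagawa_simple s).
exists unit, (fun=> tt); rewrite card_unit; split=> //.
  by case; exists 0 => //; apply/path_lattice; rewrite !ffunE mulr0 !subrr dvdz0.
move=> a b /path_lattice ha /path_lattice hb; split=> // _; apply/path_lattice.
have half (x : {ffun vtx T -> int}) :
    (d%:Z %| twist F (-1) x t - twist F (-1) x s)%Z -> (d%:Z %| x t - x s)%Z.
  rewrite !ffunE !Fid (_ : _ - _ = (x t - x s) * 2); last by ring.
  by rewrite Gauss_dvdzl // coprimezE /= coprimen2.
have -> : (a - b) t - (a - b) s = (a t - a s) - (b t - b s) by rewrite !ffunE; ring.
by rewrite rpredB // half.
Qed.

(** The reversal acts on Z / d as -1, so 1 + F vanishes and every class is fixed. *)
Lemma tamagawa_path_swap : F s = t -> F t = s -> tamagawa T = d.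
Proof.
move=> Fs Ft; apply: (@tamagawa_simple s); have d0 := dist_gt0.
have dz : d%:Z != 0 by rewrite eqz_nat -lt0n.
have lt (x : {ffun vtx T -> int}) : (`|((x t - x s) %% d)%Z| < d)%N.
  by rewrite -ltz_nat gez0_abs ?modz_ge0 // ltz_pmod.
exists 'I_d, (fun x : {ffun vtx T -> int} => Ordinal (lt x)); rewrite card_ord; split=> //.
  move=> i; exists [ffun u => if u == t then i%:Z else 0].
    by apply/path_lattice; rewrite !ffunE Fs Ft eqxx (negbTE st) (_ : _ - _ = 0) ?dvdz0 //; ring.
  apply: val_inj; rewrite /= !ffunE eqxx (negbTE st) subr0.
  by rewrite modz_small ?absz_nat // ltz_nat ltn_ord.
move=> a b _ _; rewrite path_lattice.
have -> : (a - b) t - (a - b) s = (a t - a s) - (b t - b s) by rewrite !ffunE; ring.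
rewrite -eqz_mod_dvd; split=> [/(congr1 val) /= e|/eqP e]; last by apply: val_inj; rewrite /= e.
apply/eqP; rewrite -[LHS]gez0_abs ?modz_ge0 // e gez0_abs ?modz_ge0 //.
Qed.

End Path.

End Simple.

Local Close Scope ring_scope.

Theorem theorem1p7 (T : by_data)
    (hT : is_BY_tree T) (hsimple : is_simple T) (hneg : is_negative T)
    (hA : parityA T) (hB : parityB T) :
  (has_branch_vertex T -> tamagawa T = c1 T * tamagawa (T' T))
  /\
  (~~ has_branch_vertex T ->
     (#|SV T| = 1 -> tamagawa T = 1)
     /\
     (forall s t : vtx T, s != t -> SV T = [set s; t] ->
        [/\ ~~ odd (dist s t) -> (forall x : vtx T, frob x = x) ->
              tamagawa T = 2,
            odd (dist s t) -> (forall x : vtx T, frob x = x) ->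
              tamagawa T = 1
          & frob s = t -> frob t = s -> tamagawa T = dist s t])).
Proof.
split=> [hb|_].
  have [r [par bp]] := base_point_ex hT hsimple hneg hA hB hb.
  exact: (tamagawa_base_point hT hsimple hB bp).
split; first exact: tamagawa_singleton.
move=> s t st SVE; split.
- exact: tamagawa_path_even.
- exact: tamagawa_path_odd.
- exact: tamagawa_path_swap.
Qed.
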